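(* Let $\gamma\ge1$. For locally analytic initial data $(\rho,u,v)$ (with $\rho>0$) satisfying $$\frac{\rho^{2\gamma}}{\gamma^2}+(u^2+v^2)\frac{\rho^{\gamma+1}}{\gamma}=\kappa$$ (which determines the initial $\kappa$) and $\rho uv\neq0$, there exists a local solution in space-time $(\rho,u,v,\mathbf g)$ of the system $$\partial_1N-\partial_2M=-\Gamma^1_{22}L+2\Gamma^1_{12}M-\Gamma^1_{11}N,\quad \partial_1M-\partial_2L=\Gamma^2_{22}L-2\Gamma^2_{12}M+\Gamma^2_{11}N,\quad LN-M^2=\kappa,$$ $$\partial_t(\rho u)=\Gamma^1_{22}L-2\Gamma^1_{12}M+\Gamma^1_{11}N,\quad \partial_t(\rho v)=\Gamma^2_{22}L-2\Gamma^2_{12}M+\Gamma^2_{11}N,\quad \partial_t\rho+\partial_1(\rho u)+\partial_2(\rho v)=0,$$ where $L=\rho v^2+p$, $M=-\rho uv$, $N=\rho u^2+p$, $p=\rho^\gamma/\gamma$, which satisfies both the compressible Euler equations $$\partial_t(\rho u)+\partial_1(\rho u^2+p)+\partial_2(\rho uv)=0,\quad \partial_t(\rho v)+\partial_1(\rho uv)+\partial_2(\rho v^2+p)=0,\quad \partial_t\rho+\partial_1(\rho u)+\partial_2(\rho v)=0$$ with the given initial data, and defines a propagating two-dimensional Riemannian manifold isometrically immersed in $\mathbb R^3$.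
   Context: $\mathbf g=(g_{ij}(x_1,x_2,t))$ is an evolving Riemannian metric on an open subset of $\mathbb R^2$, with Christoffel symbols $\Gamma^k_{ij}=\frac12 g^{kl}(\partial_jg_{il}+\partial_ig_{jl}-\partial_lg_{ij})$ and Gauss curvature $\kappa$ at each fixed time. ''Defines a propagating two-dimensional Riemannian manifold isometrically immersed in $\mathbb R^3$'' means that for each $t$ there is locally an immersion $\mathbf y(t,\cdot)$ into $\mathbb R^3$ with $\partial_i\mathbf y\cdot\partial_j\mathbf y=g_{ij}(\cdot,t)$ whose second fundamental form divided by $\sqrt{\det\mathbf g}$ is $(L,M,N)$. *)

(* Defs.v *)
From Stdlib Require Import Reals.
From Coquelicot Require Import Coquelicot.
Open Scope R_scope.

(** Functions are total; every property is imposed only on a stated open set,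
    always together with the differentiability that gives [Derive] its meaning. *)

Definition field := R -> R -> R.            (* (x1, x2) *)
Definition stfield := R -> field.           (* time first: [f t] is a slice *)

Inductive index := i1 | i2.
Inductive ambient := e1 | e2 | e3.

Definition sum2 (F : index -> R) : R := F i1 + F i2.
Definition sum3 (F : ambient -> R) : R := F e1 + F e2 + F e3.

Definition square (a b r : R) (x1 x2 : R) : Prop :=
  Rabs (x1 - a) < r /\ Rabs (x2 - b) < r.

Definition open_plane (U : R -> R -> Prop) : Prop :=
  open (fun p : R * R => U (fst p) (snd p)).

Definition partial (i : index) (f : field) : field := fun x1 x2 =>
  match i with
  | i1 => Derive (fun z => f z x2) x1
  | i2 => Derive (fun z => f x1 z) x2
  end.

Definition ex_partial (i : index) (f : field) (x1 x2 : R) : Prop :=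
  match i with
  | i1 => ex_derive (fun z => f z x2) x1
  | i2 => ex_derive (fun z => f x1 z) x2
  end.

Definition dt (f : stfield) : stfield := fun t x1 x2 =>
  Derive (fun s => f s x1 x2) t.

Definition dx (i : index) (f : stfield) : stfield := fun t => partial i (f t).

Fixpoint Ck_plane (n : nat) (D : R -> R -> Prop) (f : field) : Prop :=
  match n with
  | O => forall x1 x2, D x1 x2 ->
      continuous (fun p : R * R => f (fst p) (snd p)) (x1, x2)
  | S m =>
      (forall x1 x2, D x1 x2 -> forall i, ex_partial i f x1 x2) /\
      (forall i, Ck_plane m D (partial i f))
  end.

Definition smooth_plane (D : R -> R -> Prop) (f : field) : Prop :=
  forall n, Ck_plane n D f.

Fixpoint Ck_st (n : nat) (D : R -> R -> R -> Prop) (f : stfield) : Prop :=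
  match n with
  | O => forall t x1 x2, D t x1 x2 ->
      continuous (fun p : R * R * R => f (fst (fst p)) (snd (fst p)) (snd p))
        (t, x1, x2)
  | S m =>
      (forall t x1 x2, D t x1 x2 ->
         ex_derive (fun s => f s x1 x2) t /\
         forall i, ex_partial i (f t) x1 x2) /\
      Ck_st m D (dt f) /\
      (forall i, Ck_st m D (dx i f))
  end.

Definition smooth_st (D : R -> R -> R -> Prop) (f : stfield) : Prop :=
  forall n, Ck_st n D f.

(** Real analyticity at [(a, b)]: the double power series is summed by total
    degree, and is required to converge absolutely on a square. *)
Definition analytic_at (f : field) (a b : R) : Prop :=
  exists (c : nat -> nat -> R) (r : R), 0 < r /\
    forall h k, Rabs h < r -> Rabs k < r ->
      ex_series (fun n =>
        sum_n (fun m => Rabs (c m (n - m)%nat * h ^ m * k ^ (n - m))) n) /\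
      is_series (fun n =>
        sum_n (fun m => c m (n - m)%nat * h ^ m * k ^ (n - m)) n)
        (f (a + h) (b + k)).

Definition metric := index -> index -> field.

Definition riemannian (g : metric) (x1 x2 : R) : Prop :=
  (forall i j, g i j x1 x2 = g j i x1 x2) /\
  (forall c : index -> R, (exists i, c i <> 0) ->
     0 < sum2 (fun i => sum2 (fun j => g i j x1 x2 * c i * c j))).

Definition detg (g : metric) : field := fun x1 x2 =>
  g i1 i1 x1 x2 * g i2 i2 x1 x2 - g i1 i2 x1 x2 * g i2 i1 x1 x2.

Definition ginv (g : metric) (i j : index) : field := fun x1 x2 =>
  match i, j with
  | i1, i1 => g i2 i2 x1 x2 / detg g x1 x2
  | i1, i2 => - g i1 i2 x1 x2 / detg g x1 x2
  | i2, i1 => - g i2 i1 x1 x2 / detg g x1 x2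
  | i2, i2 => g i1 i1 x1 x2 / detg g x1 x2
  end.

(** [christoffel g k i j] is Γ^k_{ij}. *)
Definition christoffel (g : metric) (k i j : index) : field := fun x1 x2 =>
  / 2 * sum2 (fun l => ginv g k l x1 x2 *
    (partial j (g i l) x1 x2 + partial i (g j l) x1 x2
     - partial l (g i j) x1 x2)).

(** [riemann g l k i j] is the l-th component of R(∂_i,∂_j)∂_k, with
    R(X,Y) = ∇_X ∇_Y - ∇_Y ∇_X - ∇_[X,Y]. *)
Definition riemann (g : metric) (l k i j : index) : field := fun x1 x2 =>
  partial i (christoffel g l j k) x1 x2 - partial j (christoffel g l i k) x1 x2
  + sum2 (fun m => christoffel g l i m x1 x2 * christoffel g m j k x1 x2
                 - christoffel g l j m x1 x2 * christoffel g m i k x1 x2).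

(** g(R(∂_1,∂_2)∂_2, ∂_1) / det g, positive on round spheres. *)
Definition gauss_curvature (g : metric) : field := fun x1 x2 =>
  sum2 (fun l => g l i1 x1 x2 * riemann g l i2 i1 i2 x1 x2) / detg g x1 x2.

Definition surface := ambient -> field.

Definition dot (a b : ambient -> R) : R := sum3 (fun e => a e * b e).

Definition cross (a b : ambient -> R) : ambient -> R := fun e =>
  match e with
  | e1 => a e2 * b e3 - a e3 * b e2
  | e2 => a e3 * b e1 - a e1 * b e3
  | e3 => a e1 * b e2 - a e2 * b e1
  end.

Definition tangent (y : surface) (i : index) (x1 x2 : R) : ambient -> R :=
  fun e => partial i (y e) x1 x2.

Definition unit_normal (y : surface) (x1 x2 : R) : ambient -> R :=
  let w := cross (tangent y i1 x1 x2) (tangent y i2 x1 x2) in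
  fun e => w e / sqrt (dot w w).

Definition second_form (y : surface) (i j : index) : field := fun x1 x2 =>
  dot (fun e => partial i (partial j (y e)) x1 x2) (unit_normal y x1 x2).

Definition immersion (D : R -> R -> Prop) (y : surface) : Prop :=
  (forall e, smooth_plane D (y e)) /\
  (forall x1 x2, D x1 x2 -> forall c : index -> R,
     (forall e, sum2 (fun i => c i * tangent y i x1 x2 e) = 0) ->
     forall i, c i = 0).

(** Near every point of [D], the metric [g] is induced by an immersion into R^3
    whose second fundamental form divided by [sqrt (det g)] is [(L, M, N)]. *)
Definition locally_isometrically_immersed
    (D : R -> R -> Prop) (g : metric) (L M N : field) : Prop :=
  forall a b, D a b ->
    exists (r : R) (y : surface), 0 < r /\
      immersion (square a b r) y /\
      forall x1 x2, square a b r x1 x2 ->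
        (forall i j, dot (tangent y i x1 x2) (tangent y j x1 x2) = g i j x1 x2) /\
        second_form y i1 i1 x1 x2 / sqrt (detg g x1 x2) = L x1 x2 /\
        second_form y i1 i2 x1 x2 / sqrt (detg g x1 x2) = M x1 x2 /\
        second_form y i2 i2 x1 x2 / sqrt (detg g x1 x2) = N x1 x2.

(** [Rpower] is the genuine real power only for positive densities. *)
Definition pressure (gamma : R) (rho : field) : field := fun x1 x2 =>
  Rpower (rho x1 x2) gamma / gamma.

Definition Lcoef (gamma : R) (rho u v : field) : field := fun x1 x2 =>
  rho x1 x2 * v x1 x2 ^ 2 + pressure gamma rho x1 x2.
Definition Mcoef (rho u v : field) : field := fun x1 x2 =>
  - (rho x1 x2 * u x1 x2 * v x1 x2).
Definition Ncoef (gamma : R) (rho u v : field) : field := fun x1 x2 =>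
  rho x1 x2 * u x1 x2 ^ 2 + pressure gamma rho x1 x2.

Definition mass_equation (rho u v : stfield) (t x1 x2 : R) : Prop :=
  dt rho t x1 x2
  + partial i1 (fun z1 z2 => rho t z1 z2 * u t z1 z2) x1 x2
  + partial i2 (fun z1 z2 => rho t z1 z2 * v t z1 z2) x1 x2 = 0.

Definition geometric_fluid_system (gamma : R) (rho u v : stfield)
    (g : R -> metric) (t x1 x2 : R) : Prop :=
  let L := Lcoef gamma (rho t) (u t) (v t) in
  let M := Mcoef (rho t) (u t) (v t) in
  let N := Ncoef gamma (rho t) (u t) (v t) in
  let G := fun k i j => christoffel (g t) k i j x1 x2 in
  partial i1 N x1 x2 - partial i2 M x1 x2
    = - G i1 i2 i2 * L x1 x2 + 2 * G i1 i1 i2 * M x1 x2 - G i1 i1 i1 * N x1 x2 /\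
  partial i1 M x1 x2 - partial i2 L x1 x2
    = G i2 i2 i2 * L x1 x2 - 2 * G i2 i1 i2 * M x1 x2 + G i2 i1 i1 * N x1 x2 /\
  L x1 x2 * N x1 x2 - M x1 x2 ^ 2 = gauss_curvature (g t) x1 x2 /\
  dt (fun s z1 z2 => rho s z1 z2 * u s z1 z2) t x1 x2
    = G i1 i2 i2 * L x1 x2 - 2 * G i1 i1 i2 * M x1 x2 + G i1 i1 i1 * N x1 x2 /\
  dt (fun s z1 z2 => rho s z1 z2 * v s z1 z2) t x1 x2
    = G i2 i2 i2 * L x1 x2 - 2 * G i2 i1 i2 * M x1 x2 + G i2 i1 i1 * N x1 x2 /\
  mass_equation rho u v t x1 x2.

Definition euler_equations (gamma : R) (rho u v : stfield) (t x1 x2 : R) : Prop :=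
  dt (fun s z1 z2 => rho s z1 z2 * u s z1 z2) t x1 x2
  + partial i1 (fun z1 z2 =>
      rho t z1 z2 * u t z1 z2 ^ 2 + pressure gamma (rho t) z1 z2) x1 x2
  + partial i2 (fun z1 z2 => rho t z1 z2 * u t z1 z2 * v t z1 z2) x1 x2 = 0 /\
  dt (fun s z1 z2 => rho s z1 z2 * v s z1 z2) t x1 x2
  + partial i1 (fun z1 z2 => rho t z1 z2 * u t z1 z2 * v t z1 z2) x1 x2
  + partial i2 (fun z1 z2 =>
      rho t z1 z2 * v t z1 z2 ^ 2 + pressure gamma (rho t) z1 z2) x1 x2 = 0 /\
  mass_equation rho u v t x1 x2.

(* Main.v *)
Require Import Defs.
From Stdlib Require Import Reals.
From Coquelicot Require Import Coquelicot.
From Stdlib Require Import Lra Lia Factorial FunctionalExtensionality List.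
Open Scope R_scope.

(** Everything is done with real-analytic functions.  First the Euler equations are solved
    by Cauchy-Kovalevskaya in t.  Then (L, M, N) are known analytic functions, and a surface
    y with second fundamental form sqrt (det g) (L, M, N) is found by a second application
    of Cauchy-Kovalevskaya, in x2 and with t as a parameter: the unknowns are the tangent
    vectors y_1, y_2 and the Christoffel symbols, and the line x2 = b is noncharacteristic
    because L = rho v^2 + p > 0.  The metric is the induced one, so that the Gauss and
    Codazzi equations hold, and the latter turn the momentum equations into the equations
    for the time derivatives of rho u and rho v. *)

(** * Formal power series *)

(* Entry (i, j, k) is the derivative at the origin, not the Taylor coefficient:
   differentiation is then a shift, and products are given by the Leibniz rule. *)
Definition fps := nat -> nat -> nat -> R.

Definition d1 (f : fps) : fps := fun i j k => f (S i) j k.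
Definition d2 (f : fps) : fps := fun i j k => f i (S j) k.
Definition d3 (f : fps) : fps := fun i j k => f i j (S k).

Fixpoint cnv (f g : nat -> R) (n : nat) : R :=
  match n with
  | O => f O * g O
  | S m => cnv (fun k => f (S k)) g m + cnv f (fun k => g (S k)) m
  end.

Fixpoint cnv2 (f g : nat -> nat -> R) (j k : nat) : R :=
  match j with
  | O => cnv (f O) (g O) k
  | S m => cnv2 (fun a => f (S a)) g m k + cnv2 f (fun a => g (S a)) m k
  end.

Definition fmul : fps -> fps -> fps := fix fmul (f g : fps) (i j k : nat) : R :=
  match i with
  | O => cnv2 (f O) (g O) j k
  | S m => fmul (d1 f) g m j k + fmul f (d1 g) m j k
  end.

Definition fconst (c : R) : fps := fun i j k =>
  match i, j, k with O, O, O => c | _, _, _ => 0 end.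
Definition fadd (f g : fps) : fps := fun i j k => f i j k + g i j k.
Definition fopp (f : fps) : fps := fun i j k => - f i j k.
Definition fsub (f g : fps) : fps := fadd f (fopp g).

Declare Scope fps_scope.
Delimit Scope fps_scope with fps.
Bind Scope fps_scope with fps.
Notation "f + g" := (fadd f g) : fps_scope.
Notation "f - g" := (fsub f g) : fps_scope.
Notation "f * g" := (fmul f g) : fps_scope.
Notation "- f" := (fopp f) : fps_scope.
Notation "0" := (fconst 0) : fps_scope.
Notation "1" := (fconst 1) : fps_scope.

Lemma fps_ext (f g : fps) : (forall i j k, f i j k = g i j k) -> f = g.
Proof.
  intros H; do 3 (apply functional_extensionality; intro); apply H.
Qed.

Lemma index_ind (P : nat -> nat -> nat -> Prop) :
  P O O O -> (forall k, P O O k -> P O O (S k)) ->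
  (forall j k, P O j k -> P O (S j) k) ->
  (forall i j k, P i j k -> P (S i) j k) -> forall i j k, P i j k.
Proof.
  intros H0 H3 H2 H1 i j k.
  induction i; [|auto]. induction j; [|auto]. induction k; auto.
Qed.

Lemma fmul_S1 f g i j k :
  fmul f g (S i) j k = fmul (d1 f) g i j k + fmul f (d1 g) i j k.
Proof. reflexivity. Qed.

Lemma fmul_S2 i j k : forall f g,
  fmul f g i (S j) k = fmul (d2 f) g i j k + fmul f (d2 g) i j k.
Proof.
  induction i; intros f g; [reflexivity|].
  rewrite !fmul_S1, !IHi. unfold d1, d2; ring.
Qed.

Lemma cnv2_S k j : forall f g, cnv2 f g j (S k) =
  cnv2 (fun a b => f a (S b)) g j k + cnv2 f (fun a b => g a (S b)) j k.
Proof. induction j; intros f g; simpl; [|rewrite !IHj]; ring. Qed.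

Lemma fmul_S3 i j k : forall f g,
  fmul f g i j (S k) = fmul (d3 f) g i j k + fmul f (d3 g) i j k.
Proof.
  induction i; intros f g; [exact (cnv2_S k j (f O) (g O))|].
  rewrite !fmul_S1, !IHi. unfold d1, d3; ring.
Qed.

Lemma fmul_000 f g : fmul f g O O O = f O O O * g O O O.
Proof. reflexivity. Qed.

Lemma d1_mul f g : d1 (f * g)%fps = (d1 f * g + f * d1 g)%fps.
Proof. reflexivity. Qed.
Lemma d2_mul f g : d2 (f * g)%fps = (d2 f * g + f * d2 g)%fps.
Proof. apply fps_ext; intros; apply fmul_S2. Qed.
Lemma d3_mul f g : d3 (f * g)%fps = (d3 f * g + f * d3 g)%fps.
Proof. apply fps_ext; intros; apply fmul_S3. Qed.

Lemma d1_add f g : d1 (f + g)%fps = (d1 f + d1 g)%fps. Proof. reflexivity. Qed.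
Lemma d2_add f g : d2 (f + g)%fps = (d2 f + d2 g)%fps. Proof. reflexivity. Qed.
Lemma d3_add f g : d3 (f + g)%fps = (d3 f + d3 g)%fps. Proof. reflexivity. Qed.
Lemma d1_opp f : d1 (- f)%fps = (- d1 f)%fps. Proof. reflexivity. Qed.
Lemma d2_opp f : d2 (- f)%fps = (- d2 f)%fps. Proof. reflexivity. Qed.
Lemma d3_opp f : d3 (- f)%fps = (- d3 f)%fps. Proof. reflexivity. Qed.
Lemma d1_sub f g : d1 (f - g)%fps = (d1 f - d1 g)%fps. Proof. reflexivity. Qed.
Lemma d2_sub f g : d2 (f - g)%fps = (d2 f - d2 g)%fps. Proof. reflexivity. Qed.
Lemma d3_sub f g : d3 (f - g)%fps = (d3 f - d3 g)%fps. Proof. reflexivity. Qed.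
Lemma d1_const c : d1 (fconst c) = 0%fps.
Proof. apply fps_ext; intros i j k; destruct i, j, k; reflexivity. Qed.
Lemma d2_const c : d2 (fconst c) = 0%fps.
Proof. apply fps_ext; intros i j k; destruct i, j, k; reflexivity. Qed.
Lemma d3_const c : d3 (fconst c) = 0%fps.
Proof. apply fps_ext; intros i j k; destruct i, j, k; reflexivity. Qed.

Ltac leibniz_ind i j k :=
  pattern i, j, k; apply index_ind; clear i j k; [|intros k IH|intros j k IH|intros i j k IH];
  intros; rewrite ?fmul_000, ?fmul_S1, ?fmul_S2, ?fmul_S3.

Lemma fmul_comm f g : (f * g = g * f)%fps.
Proof.
  apply fps_ext; intros i j k; revert f g.
  leibniz_ind i j k; rewrite ?(IH f), ?(IH _ g); ring.
Qed.

Lemma fmul_add_l f g h : ((f + g) * h = f * h + g * h)%fps.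
Proof.
  apply fps_ext; intros i j k; revert f g h; unfold fadd at 2.
  leibniz_ind i j k;
    rewrite ?d1_add, ?d2_add, ?d3_add, ?IH; unfold fadd; ring.
Qed.

Lemma fmul_add_r f g h : (h * (f + g) = h * f + h * g)%fps.
Proof. rewrite !(fmul_comm h). apply fmul_add_l. Qed.

Lemma fmul_assoc f g h : (f * (g * h) = f * g * h)%fps.
Proof.
  apply fps_ext; intros i j k; revert f g h.
  leibniz_ind i j k; rewrite ?d1_mul, ?d2_mul, ?d3_mul, ?fmul_add_l, ?fmul_add_r;
  unfold fadd; rewrite ?IH, ?fmul_000; ring.
Qed.

Lemma fmul_0_l f : (0 * f = 0)%fps.
Proof.
  apply fps_ext; intros i j k; revert f.
  leibniz_ind i j k; rewrite ?d1_const, ?d2_const, ?d3_const, ?IH;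
   try destruct i; try destruct j; try destruct k; simpl; ring.
Qed.

Lemma fmul_const c f i j k : fmul (fconst c) f i j k = c * f i j k.
Proof.
  revert f.
  leibniz_ind i j k; rewrite ?d1_const, ?d2_const, ?d3_const, ?fmul_0_l, ?IH;
   try reflexivity; try destruct i; try destruct j; try destruct k; simpl; unfold d1, d2, d3; ring.
Qed.

Lemma fps_ring_theory :
  ring_theory 0%fps 1%fps fadd fmul fsub fopp (@eq fps).
Proof.
  constructor; intros; try (apply fps_ext; intros i j k; unfold fsub, fadd, fopp; try ring).
  - destruct i, j, k; simpl; ring.
  - rewrite fmul_const; ring.
  - now rewrite fmul_comm.
  - now rewrite fmul_assoc.
  - change (((x + y) * z)%fps i j k = (x * z + y * z)%fps i j k); now rewrite fmul_add_l.
  - destruct i, j, k; simpl; ring.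
Qed.
Add Ring fps_ring : fps_ring_theory.

Lemma fmul_agree i j k : forall f f' g g',
  (forall a b c, (a <= i)%nat -> (b <= j)%nat -> (c <= k)%nat -> f a b c = f' a b c) ->
  (forall a b c, (a <= i)%nat -> (b <= j)%nat -> (c <= k)%nat -> g a b c = g' a b c) ->
  fmul f g i j k = fmul f' g' i j k.
Proof.
  leibniz_ind i j k.
  1: now rewrite H, H0 by lia.
  all: f_equal; apply IH; intros; unfold d1, d2, d3; (apply H || apply H0); lia.
Qed.

Definition tr (f : fps) : fps := fun i j k => f k j i.

Lemma tr_mul f g : tr (f * g)%fps = (tr f * tr g)%fps.
Proof.
  apply fps_ext; intros i j k; revert f g; unfold tr at 1.
  leibniz_ind i j k; rewrite ?IH; reflexivity.
Qed.

Lemma cnv_ext n : forall f f' g g',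
  (forall k, (k <= n)%nat -> f k = f' k) -> (forall k, (k <= n)%nat -> g k = g' k) ->
  cnv f g n = cnv f' g' n.
Proof.
  induction n; intros f f' g g' Hf Hg; simpl.
  - now rewrite Hf, Hg by lia.
  - f_equal; apply IHn; intros; (apply Hf || apply Hg); lia.
Qed.

Lemma cnv_lin_l n : forall a b f f' g,
  cnv (fun k => a * f k + b * f' k) g n = a * cnv f g n + b * cnv f' g n.
Proof. induction n; intros; simpl; [|rewrite !IHn]; ring. Qed.

Lemma cnv_lin_r n : forall a b f f' g,
  cnv g (fun k => a * f k + b * f' k) n = a * cnv g f n + b * cnv g f' n.
Proof. induction n; intros; simpl; [|rewrite !IHn]; ring. Qed.

Lemma cnv_fact n : forall f g,
  cnv f g n / INR (fact n) =
  PS_mult (fun k => f k / INR (fact k)) (fun k => g k / INR (fact k)) n.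
Proof.
  induction n; intros f g.
  - unfold PS_mult; simpl; field.
  - set (a := fun k => f k / INR (fact k)). set (b := fun k => g k / INR (fact k)).
    assert (Hf : forall h : nat -> R, forall k, h (S k) / INR (fact k) =
       INR (S k) * (h (S k) / INR (fact (S k)))).
    { intros h k. rewrite fact_simpl, mult_INR. field. split; [apply INR_fact_neq_0|].
      apply not_0_INR; lia. }
    assert (HS : INR (S n) * PS_mult a b (S n) =
      PS_mult (fun k => INR (S k) * a (S k)) b n + PS_mult a (fun k => INR (S k) * b (S k)) n).
    { unfold PS_mult.
      rewrite scal_sum.
      rewrite (sum_eq _ (fun l => INR l * a l * b (S n - l)%nat
         + a l * (INR (S n - l) * b (S n - l)%nat))).
      2:{ intros l Hl. rewrite minus_INR by lia. ring. }
      rewrite sum_plus. f_equal.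
      - rewrite decomp_sum by lia. simpl Nat.pred. rewrite Rmult_0_l, Rmult_0_l, Rplus_0_l.
        apply sum_eq; intros l Hl. reflexivity.
      - rewrite tech5. rewrite Nat.sub_diag. simpl (INR 0). rewrite Rmult_0_l, Rmult_0_r, Rplus_0_r.
        apply sum_eq; intros l Hl. now replace (S n - l)%nat with (S (n - l)) by lia. }
    apply Rmult_eq_reg_l with (INR (S n)); [|apply not_0_INR; lia].
    rewrite HS. rewrite <- Hf. simpl cnv. rewrite Rdiv_plus_distr, !IHn.
    f_equal; apply sum_eq; intros l Hl; unfold a, b; rewrite <- ?Hf; reflexivity.
Qed.

(** * Evaluation of power series *)

Lemma ex_series_dominated (f A : nat -> R) :
  (forall n, Rabs (f n) <= A n) -> ex_series A -> ex_series (fun n => Rabs (f n)).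
Proof.
  intros H HA. apply (@ex_series_le R_AbsRing R_CompleteNormedModule _ A); auto.
  intro n. unfold norm; simpl. unfold abs; simpl. now rewrite Rabs_Rabsolu.
Qed.

Lemma Series_Rabs_le (f A : nat -> R) :
  (forall n, Rabs (f n) <= A n) -> ex_series A -> Rabs (Series f) <= Series A.
Proof.
  intros H HA. pose proof (ex_series_dominated f A H HA) as Hf.
  eapply Rle_trans; [apply Series_Rabs, Hf|].
  apply Series_le; auto. intro n; split; auto using Rabs_pos.
Qed.

Lemma series_tail_bound (f A : nat -> R) N :
  (forall n, Rabs (f n) <= A n) -> ex_series A ->
  Rabs (Series f - sum_f_R0 f N) <= Series A - sum_f_R0 A N.
Proof.
  intros H HA. pose proof (ex_series_Rabs _ (ex_series_dominated f A H HA)) as Hf.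
  rewrite (Series_incr_n f (S N)), (Series_incr_n A (S N)) by (auto; lia). simpl Nat.pred.
  match goal with |- Rabs ?x <= ?y => ring_simplify x; ring_simplify y end.
  apply Series_Rabs_le; auto. now apply (ex_series_incr_n A (S N)).
Qed.

Lemma Un_cv_Series (f : nat -> R) : ex_series f -> Un_cv (sum_f_R0 f) (Series f).
Proof.
  intros H. apply is_series_Reals. now apply Series_correct.
Qed.

Lemma is_derive_Series (f f' : nat -> R -> R) (A B : nat -> R) (c : R) (r : posreal) :
  (forall n x, Rabs (x - c) < r -> is_derive (f n) x (f' n x)) ->
  (forall n x, Rabs (x - c) < r -> Rabs (f n x) <= A n) ->
  (forall n x, Rabs (x - c) < r -> Rabs (f' n x) <= B n) ->
  ex_series A -> ex_series B ->
  forall x, Rabs (x - c) < r ->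
  is_derive (fun z => Series (fun n => f n z)) x (Series (fun n => f' n x)).
Proof.
  intros Hd HfA HfB HA HB x Hx. apply is_derive_Reals.
  apply (CVU_derivable (fun N z => sum_f_R0 (fun n => f n z) N)
    (fun N z => sum_f_R0 (fun n => f' n z) N)
    (fun z => Series (fun n => f n z)) (fun z => Series (fun n => f' n z)) c r); auto.
  - intros eps Heps. destruct (Un_cv_Series B HB eps Heps) as [N HN].
    exists N. intros n y Hn Hy.
    eapply Rle_lt_trans; [apply (series_tail_bound _ B); auto|].
    specialize (HN n Hn). unfold Rdist in HN. rewrite Rabs_minus_sym in HN.
    eapply Rle_lt_trans; [apply Rle_abs|exact HN].
  - intros y Hy. apply Un_cv_Series, ex_series_Rabs, (ex_series_dominated _ A); auto.
  - intros n y Hy. apply is_derive_Reals.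
    induction n; simpl; [now apply Hd|].
    apply (is_derive_plus (fun z => sum_f_R0 (fun n => f n z) n) (f (S n))); auto.
Qed.

Lemma is_derive_Rplus (f g : R -> R) (x a b : R) :
  is_derive f x a -> is_derive g x b -> is_derive (fun z => f z + g z) x (a + b).
Proof. apply (is_derive_plus (K := R_AbsRing) (V := R_NormedModule)). Qed.

Fixpoint hom (n : nat) (p1 p2 p3 : R) (f : fps) : R :=
  match n with
  | O => f O O O
  | S m => p1 * hom m p1 p2 p3 (d1 f) + p2 * hom m p1 p2 p3 (d2 f)
           + p3 * hom m p1 p2 p3 (d3 f)
  end.

(* [hom n / n!] is the homogeneous part of degree [n] of the Taylor series. *)
Definition ev (f : fps) (p1 p2 p3 : R) : R :=
  Series (fun n => hom n p1 p2 p3 f / INR (fact n)).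

(* For fixed [r] this class is closed under products and derivatives. *)
Definition cls (r : R) (f : fps) : Prop :=
  exists C m, 0 <= C /\ forall i j k,
    Rabs (f i j k) <= C * r ^ (i + j + k) * INR (fact (i + j + k + m)).

Definition l1 (p1 p2 p3 : R) := Rabs p1 + Rabs p2 + Rabs p3.

Lemma hom_bound r C m p1 p2 p3 n : 0 <= r -> 0 <= C -> forall l f,
  (forall i j k, Rabs (f i j k) <= C * r ^ (i + j + k + l) * INR (fact (i + j + k + l + m))) ->
  Rabs (hom n p1 p2 p3 f) <= C * r ^ (n + l) * INR (fact (n + l + m)) * l1 p1 p2 p3 ^ n.
Proof.
  intros Hr HC. induction n; intros l f H.
  - simpl hom. specialize (H O O O). simpl in *. lra.
  - simpl hom.
    assert (H1 := IHn (S l) (d1 f)). assert (H2 := IHn (S l) (d2 f)).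
    assert (H3 := IHn (S l) (d3 f)).
    replace (n + S l)%nat with (S n + l)%nat in * by lia.
    unfold l1 in *. rewrite <- tech_pow_Rmult.
    set (X := C * r ^ (S n + l) * INR (fact (S n + l + m)) * (Rabs p1 + Rabs p2 + Rabs p3) ^ n) in *.
    eapply Rle_trans; [eapply Rle_trans; [apply Rabs_triang|
       apply Rplus_le_compat_r, Rabs_triang]|].
    rewrite !Rabs_mult.
    replace (C * r ^ (S n + l) * INR (fact (S n + l + m)) *
     ((Rabs p1 + Rabs p2 + Rabs p3) * (Rabs p1 + Rabs p2 + Rabs p3) ^ n))
     with (Rabs p1 * X + Rabs p2 * X + Rabs p3 * X) by (unfold X; ring).
    repeat apply Rplus_le_compat; apply Rmult_le_compat_l; try apply Rabs_pos;
      (apply H1 || apply H2 || apply H3); intros i j k;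
      unfold d1, d2, d3.
    + replace (i + j + k + S l)%nat with (S i + j + k + l)%nat by lia. apply H.
    + replace (i + j + k + S l)%nat with (i + S j + k + l)%nat by lia. apply H.
    + replace (i + j + k + S l)%nat with (i + j + S k + l)%nat by lia. apply H.
Qed.

Lemma ex_series_poly_geom q m : 0 <= q < 1 ->
  ex_series (fun n => q ^ n * (INR (fact (n + m)) / INR (fact n))).
Proof.
  intros Hq.  assert (Hs : exists s, q < s < 1) by (exists ((q + 1) / 2); lra). destruct Hs as [s Hs].
  assert (E : ex_series (fun n => Rabs (s ^ n * (INR (fact (n + m)) / INR (fact n))))).
  { apply ex_series_DAlembert with s; [lra| |].
    - intros n. apply Rmult_integral_contrapositive; split; [apply pow_nonzero; lra|].
      apply Rmult_integral_contrapositive; split;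
      [apply INR_fact_neq_0 | apply Rinv_neq_0_compat, INR_fact_neq_0].
    - apply is_lim_seq_ext with (fun n => s * (1 + INR m * / (INR n + 1))).
      + intros n. rewrite Nat.add_succ_l, !fact_simpl, !mult_INR.
        rewrite Rabs_pos_eq.
        * rewrite !S_INR, plus_INR, <- tech_pow_Rmult. field.
          repeat split; try apply INR_fact_neq_0; try (apply pow_nonzero; lra);
           pose proof (pos_INR n); pose proof (pos_INR m); lra.
        * apply Rlt_le. repeat (apply Rdiv_lt_0_compat || apply Rmult_lt_0_compat);
            first [lra | apply INR_fact_lt_0 | apply pow_lt; lra | apply lt_0_INR; lia].
      + replace (Finite s) with (Finite (s * (1 + INR m * 0))) by (f_equal; ring).
        apply (is_lim_seq_scal_l _ s (1 + INR m * 0)).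
        apply is_lim_seq_plus'; [apply is_lim_seq_const|].
        apply (is_lim_seq_scal_l _ (INR m) 0).
        apply is_lim_seq_ext with (fun n => / INR (S n)); [intros; now rewrite S_INR|].
        apply (is_lim_seq_incr_1 (fun n => / INR n)).
        apply (is_lim_seq_inv _ p_infty); [apply is_lim_seq_INR|discriminate]. }
  eapply (@ex_series_le R_AbsRing R_CompleteNormedModule); [|exact E].
  intros n. unfold norm; simpl; unfold abs; simpl. rewrite !Rabs_mult.
  apply Rmult_le_compat_r; [apply Rabs_pos|].
  rewrite <- !RPow_abs. apply pow_incr. rewrite !Rabs_pos_eq by lra. lra.
Qed.

Definition dom_bound (r q : R) (C : R) (m : nat) (n : nat) : R :=
  C * ((r * q) ^ n * (INR (fact (n + m)) / INR (fact n))).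

Lemma ex_series_dom_bound r q C m : 0 <= r -> 0 <= q -> r * q < 1 ->
  ex_series (dom_bound r q C m).
Proof.
  intros Hr Hq H. apply (ex_series_scal_l (K := R_AbsRing) C (fun n => (r * q) ^ n * (INR (fact (n + m)) / INR (fact n)))), ex_series_poly_geom.
  split; [now apply Rmult_le_pos|auto].
Qed.

Lemma l1_pos p1 p2 p3 : 0 <= l1 p1 p2 p3.
Proof.
  unfold l1; pose proof (Rabs_pos p1); pose proof (Rabs_pos p2); pose proof (Rabs_pos p3); lra.
Qed.

Lemma ev_term_bound r q f C m : 0 <= r -> 0 <= C ->
  (forall i j k, Rabs (f i j k) <= C * r ^ (i + j + k) * INR (fact (i + j + k + m))) ->
  forall p1 p2 p3 n, l1 p1 p2 p3 <= q ->
  Rabs (hom n p1 p2 p3 f / INR (fact n)) <= dom_bound r q C m n.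
Proof.
  intros Hr HC H p1 p2 p3 n Hp. unfold dom_bound, Rdiv.
  rewrite Rabs_mult, (Rabs_pos_eq (/ _)) by apply Rlt_le, Rinv_0_lt_compat, INR_fact_lt_0.
  replace (C * ((r * q) ^ n * (INR (fact (n + m)) * / INR (fact n))))
    with (C * r ^ n * INR (fact (n + m)) * q ^ n * / INR (fact n)) by (rewrite Rpow_mult_distr; ring).
  apply Rmult_le_compat_r; [apply Rlt_le, Rinv_0_lt_compat, INR_fact_lt_0|].
  pose proof (l1_pos p1 p2 p3).
  eapply Rle_trans; [apply (hom_bound r C m p1 p2 p3 n Hr HC O f)|].
  - intros. rewrite !Nat.add_0_r. apply H.
  - rewrite !Nat.add_0_r. apply Rmult_le_compat_l; [|apply pow_incr; lra].
    repeat apply Rmult_le_pos; auto using pow_le, pos_INR.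
Qed.

Lemma ev_abs_summable r f p1 p2 p3 : 0 <= r -> cls r f -> r * l1 p1 p2 p3 < 1 ->
  ex_series (fun n => Rabs (hom n p1 p2 p3 f / INR (fact n))).
Proof.
  intros Hr (C & m & HC & H) Hp.
  eapply ex_series_dominated.
  - intros n. apply (ev_term_bound r (l1 p1 p2 p3)); eauto. lra.
  - apply ex_series_dom_bound; auto using l1_pos.
Qed.

Lemma ev_summable r f p1 p2 p3 : 0 <= r -> cls r f -> r * l1 p1 p2 p3 < 1 ->
  ex_series (fun n => hom n p1 p2 p3 f / INR (fact n)).
Proof. intros; eapply ex_series_Rabs, ev_abs_summable; eauto. Qed.

Lemma ev_bounded r q f : 0 <= r -> 0 <= q -> r * q < 1 -> cls r f ->
  exists K, 0 <= K /\ forall p1 p2 p3, l1 p1 p2 p3 <= q -> Rabs (ev f p1 p2 p3) <= K.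
Proof.
  intros Hr Hq Hrq (C & m & HC & H).
  pose proof (ex_series_dom_bound r q C m Hr Hq Hrq).
  assert (B : forall p1 p2 p3, l1 p1 p2 p3 <= q ->
      Rabs (ev f p1 p2 p3) <= Series (dom_bound r q C m)).
  { intros. apply Series_Rabs_le; auto. intros. apply ev_term_bound; auto. }
  exists (Series (dom_bound r q C m)). split; [|exact B].
  eapply Rle_trans; [apply Rabs_pos|apply (B 0 0 0)].
  unfold l1; rewrite Rabs_R0; lra.
Qed.

Lemma hom_add n p1 p2 p3 : forall f g,
  hom n p1 p2 p3 (f + g)%fps = hom n p1 p2 p3 f + hom n p1 p2 p3 g.
Proof.
  induction n; intros; simpl; [reflexivity|].
  rewrite ?d1_add, ?d2_add, ?d3_add, !IHn; ring.
Qed.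

Lemma hom_opp n p1 p2 p3 : forall f, hom n p1 p2 p3 (- f)%fps = - hom n p1 p2 p3 f.
Proof.
  induction n; intros; simpl; [reflexivity|].
  rewrite ?d1_opp, ?d2_opp, ?d3_opp, !IHn; ring.
Qed.

Lemma hom_0 n p1 p2 p3 : hom n p1 p2 p3 0%fps = 0.
Proof.
  induction n; simpl; [reflexivity|].
  rewrite ?d1_const, ?d2_const, ?d3_const, !IHn; ring.
Qed.

Lemma hom_mul n p1 p2 p3 : forall f g, hom n p1 p2 p3 (f * g)%fps =
  cnv (fun k => hom k p1 p2 p3 f) (fun k => hom k p1 p2 p3 g) n.
Proof.
  induction n; intros f g; [reflexivity|].
  simpl hom. rewrite d1_mul, d2_mul, d3_mul, !hom_add, !IHn. simpl cnv.
  assert (E : forall a b c u v w n h, cnv (fun k => a * u k + b * v k + c * w k) h n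
     = a * cnv u h n + b * cnv v h n + c * cnv w h n).
  { intros. rewrite (cnv_ext _ _ (fun k => 1 * (a * u k + b * v k) + c * w k) h h)
      by (intros; ring). rewrite !cnv_lin_l; ring. }
  assert (E' : forall a b c u v w n h, cnv h (fun k => a * u k + b * v k + c * w k) n
     = a * cnv h u n + b * cnv h v n + c * cnv h w n).
  { intros. rewrite (cnv_ext _ h h _ (fun k => 1 * (a * u k + b * v k) + c * w k))
      by (intros; ring). rewrite !cnv_lin_r; ring. }
  rewrite E, E'. ring.
Qed.

Lemma hom_is_derive n : forall a1 a2 a3 b1 b2 b3 f s,
  is_derive (fun z => hom n (a1 + z * b1) (a2 + z * b2) (a3 + z * b3) f) s
    (match n with O => 0 | S m =>
      INR n * (b1 * hom m (a1 + s * b1) (a2 + s * b2) (a3 + s * b3) (d1 f)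
             + b2 * hom m (a1 + s * b1) (a2 + s * b2) (a3 + s * b3) (d2 f)
             + b3 * hom m (a1 + s * b1) (a2 + s * b2) (a3 + s * b3) (d3 f)) end).
Proof.
  induction n; intros.
  - exact (is_derive_const (f O O O) s).
  - simpl hom.
    pose proof (IHn a1 a2 a3 b1 b2 b3 (d1 f) s) as H1.
    pose proof (IHn a1 a2 a3 b1 b2 b3 (d2 f) s) as H2.
    pose proof (IHn a1 a2 a3 b1 b2 b3 (d3 f) s) as H3.
    assert (forall a b h h', is_derive h s h' ->
       is_derive (fun z => (a + z * b) * h z) s (b * h s + (a + s * b) * h')).
    { intros a b h h' Hh. auto_derive; [now exists h'|].
      replace (Derive (fun x => h x) s) with h' by (symmetry; apply is_derive_unique; exact Hh).
      ring. }
    evar_last.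
    { apply is_derive_Rplus; [apply is_derive_Rplus|];
      apply H; eassumption. }
    destruct n.
    + simpl. ring.
    + rewrite (S_INR (S n)). simpl hom.
      change (d1 (d2 f)) with (d2 (d1 f)). change (d1 (d3 f)) with (d3 (d1 f)).
      change (d2 (d3 f)) with (d3 (d2 f)).
      set (h := hom n _ _ _) . ring.
Qed.

Lemma cls_d (r : R) (f f' : fps) : 0 <= r -> cls r f ->
  (forall i j k, exists i' j' k', f' i j k = f i' j' k' /\
     (i' + j' + k' = S (i + j + k))%nat) -> cls r f'.
Proof.
  intros Hr (C & m & HC & H) Hf'. exists (C * r), (S m). split; [now apply Rmult_le_pos|].
  intros i j k. destruct (Hf' i j k) as (i' & j' & k' & -> & E).
  eapply Rle_trans; [apply H|]. rewrite E.
  replace (S (i + j + k) + m)%nat with (i + j + k + S m)%nat by lia.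
  apply Req_le. simpl pow. ring.
Qed.

Lemma cls_d1 r f : 0 <= r -> cls r f -> cls r (d1 f).
Proof. intros Hr H; apply (cls_d r f); auto. intros i j k; exists (S i), j, k; split; [reflexivity|lia]. Qed.
Lemma cls_d2 r f : 0 <= r -> cls r f -> cls r (d2 f).
Proof. intros Hr H; apply (cls_d r f); auto. intros i j k; exists i, (S j), k; split; [reflexivity|lia]. Qed.
Lemma cls_d3 r f : 0 <= r -> cls r f -> cls r (d3 f).
Proof. intros Hr H; apply (cls_d r f); auto. intros i j k; exists i, j, (S k); split; [reflexivity|lia]. Qed.

Lemma ev_is_derive r f a1 a2 a3 b1 b2 b3 s : 0 <= r -> cls r f ->
  r * l1 (a1 + s * b1) (a2 + s * b2) (a3 + s * b3) < 1 ->
  is_derive (fun z => ev f (a1 + z * b1) (a2 + z * b2) (a3 + z * b3)) s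
    (b1 * ev (d1 f) (a1 + s * b1) (a2 + s * b2) (a3 + s * b3)
     + b2 * ev (d2 f) (a1 + s * b1) (a2 + s * b2) (a3 + s * b3)
     + b3 * ev (d3 f) (a1 + s * b1) (a2 + s * b2) (a3 + s * b3)).
Proof.
  intros Hr Hf Hs.
  set (Lb := l1 b1 b2 b3). set (q0 := l1 (a1 + s * b1) (a2 + s * b2) (a3 + s * b3)) in *.
  assert (HL : 0 <= Lb) by apply l1_pos. assert (Hq0 : 0 <= q0) by apply l1_pos.
  assert (He : exists e : posreal, r * (q0 + e * Lb) < 1).
  { assert (0 <= r * Lb) by now apply Rmult_le_pos.
    assert (Hp : 0 < (1 - r * q0) / (2 * (1 + r * Lb))) by (apply Rdiv_lt_0_compat; lra).
    exists (mkposreal _ Hp). simpl.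
    replace (r * (q0 + (1 - r * q0) / (2 * (1 + r * Lb)) * Lb)) with
      (r * q0 + (1 - r * q0) * / 2 * (r * Lb / (1 + r * Lb))) by (field; lra).
    assert (r * Lb / (1 + r * Lb) < 1) by (apply Rlt_div_l; lra).
    nra. }
  destruct He as [e He]. set (q := q0 + e * Lb) in *.
  assert (Hq : forall z, Rabs (z - s) < e -> l1 (a1 + z * b1) (a2 + z * b2) (a3 + z * b3) <= q).
  { intros z Hz. unfold q, q0, Lb, l1.
    assert (forall a b, Rabs (a + z * b) <= Rabs (a + s * b) + e * Rabs b).
    { intros a b. replace (a + z * b) with ((a + s * b) + (z - s) * b) by ring.
      eapply Rle_trans; [apply Rabs_triang|]. rewrite Rabs_mult.
      apply Rplus_le_compat_l, Rmult_le_compat_r; [apply Rabs_pos|lra]. }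
    pose proof (H a1 b1). pose proof (H a2 b2). pose proof (H a3 b3). lra. }
  assert (Hq' : 0 <= q) by (unfold q; pose proof (cond_pos e); nra).
  pose proof (cls_d1 r f Hr Hf) as (C1 & m1 & HC1 & H1).
  pose proof (cls_d2 r f Hr Hf) as (C2 & m2 & HC2 & H2).
  pose proof (cls_d3 r f Hr Hf) as (C3 & m3 & HC3 & H3).
  pose proof Hf as (C & m & HC & H).
  set (G := fun n z => (b1 * hom n (a1 + z * b1) (a2 + z * b2) (a3 + z * b3) (d1 f)
             + b2 * hom n (a1 + z * b1) (a2 + z * b2) (a3 + z * b3) (d2 f)
             + b3 * hom n (a1 + z * b1) (a2 + z * b2) (a3 + z * b3) (d3 f)) / INR (fact n)).
  set (f' := fun n z => match n with O => 0 | S m => G m z end).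
  set (B0 := fun n => Rabs b1 * dom_bound r q C1 m1 n + Rabs b2 * dom_bound r q C2 m2 n
      + Rabs b3 * dom_bound r q C3 m3 n).
  assert (EB0 : ex_series B0).
  { unfold B0. repeat apply (ex_series_plus (K := R_AbsRing) (V := R_NormedModule));
    apply (ex_series_scal_l (K := R_AbsRing) (V := R_NormedModule)); apply ex_series_dom_bound; auto. }
  assert (HG : forall n z, Rabs (z - s) < e -> Rabs (G n z) <= B0 n).
  { intros n z Hz. unfold G, B0. rewrite !Rdiv_plus_distr.
    eapply Rle_trans; [apply Rabs_triang|]. eapply Rle_trans; [apply Rplus_le_compat_r, Rabs_triang|].
    unfold Rdiv. rewrite !Rmult_assoc.
    rewrite (Rabs_mult b1), (Rabs_mult b2), (Rabs_mult b3).
    repeat apply Rplus_le_compat; apply Rmult_le_compat_l; try apply Rabs_pos;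
     apply ev_term_bound; auto. }
  assert (Es : Rabs (s - s) < e) by (rewrite Rminus_diag, Rabs_R0; apply cond_pos).
  evar_last.
  - apply (is_derive_Series _ f' (dom_bound r q C m)
       (fun n => match n with O => 0 | S n => B0 n end) s e); auto.
    + intros n z Hz. unfold Rdiv, f'.
      eapply is_derive_ext; [intros; apply Rmult_comm|].
      evar_last; [apply is_derive_scal; apply hom_is_derive|].
      destruct n; simpl mult; [apply Rmult_0_r|].
      unfold G. rewrite fact_simpl, mult_INR. change (scal ?x ?y) with (x * y).
      unfold mult; simpl. field. split; [apply INR_fact_neq_0|apply (not_0_INR (S n)); lia].
    + intros n z Hz. apply ev_term_bound; auto.
    + intros n z Hz. destruct n; simpl; [rewrite Rabs_R0; lra|auto].
    + now apply ex_series_dom_bound.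
    + now apply ex_series_incr_1.
  - rewrite Series_incr_1; [|apply ex_series_incr_1; unfold f'; eapply ex_series_Rabs, ex_series_dominated; [intro; apply HG|]; auto].
    simpl. rewrite Rplus_0_l. unfold G, ev.
    rewrite <- !Series_scal_l.
    assert (S1 : forall g, cls r g -> ex_series (fun n => hom n (a1 + s * b1) (a2 + s * b2) (a3 + s * b3) g / INR (fact n))).
    { intros g Hg. apply (ev_summable r); auto. }
    pose proof (S1 _ (cls_d1 r f Hr Hf)). pose proof (S1 _ (cls_d2 r f Hr Hf)). pose proof (S1 _ (cls_d3 r f Hr Hf)).
    rewrite <- !Series_plus;
     repeat apply (ex_series_plus (K := R_AbsRing) (V := R_NormedModule));
     try (apply (ex_series_scal_l (K := R_AbsRing) (V := R_NormedModule)); assumption).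
    apply Series_ext; intros n. field. apply INR_fact_neq_0.
Qed.

Lemma ev_add r f g p1 p2 p3 : 0 <= r -> cls r f -> cls r g -> r * l1 p1 p2 p3 < 1 ->
  ev (f + g)%fps p1 p2 p3 = ev f p1 p2 p3 + ev g p1 p2 p3.
Proof.
  intros Hr Hf Hg Hp. unfold ev. rewrite <- Series_plus by now apply (ev_summable r).
  apply Series_ext; intros n. rewrite hom_add. apply Rdiv_plus_distr.
Qed.

Lemma ev_opp f p1 p2 p3 : ev (- f)%fps p1 p2 p3 = - ev f p1 p2 p3.
Proof.
  unfold ev. rewrite <- Series_opp. apply Series_ext; intros n. rewrite hom_opp.
  unfold Rdiv; ring.
Qed.

Lemma ev_mul r f g p1 p2 p3 : 0 <= r -> cls r f -> cls r g -> r * l1 p1 p2 p3 < 1 ->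
  ev (f * g)%fps p1 p2 p3 = ev f p1 p2 p3 * ev g p1 p2 p3.
Proof.
  intros Hr Hf Hg Hp. unfold ev.
  erewrite Series_ext; [|intros n; rewrite hom_mul, cnv_fact; reflexivity].
  apply is_series_unique, is_series_mult; try apply Series_correct;
    try now apply (ev_summable r).
  all: now apply (ev_abs_summable r).
Qed.

Lemma ev_const c p1 p2 p3 : ev (fconst c) p1 p2 p3 = c.
Proof.
  apply is_series_unique.
apply is_series_Reals. intros eps Heps. exists O. intros n _.
  replace (sum_f_R0 _ n) with c; [now rewrite Rdist_eq|].
  induction n; simpl; [field|].
  rewrite <- IHn, d1_const, d2_const, d3_const, hom_0; unfold Rdiv; ring.
Qed.

Lemma ev_0 f : ev f 0 0 0 = f O O O.
Proof.
  rewrite <- (ev_const (f O O O) 0 0 0). apply Series_ext; intros [|n]; simpl; [reflexivity|].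
  f_equal; ring.
Qed.

Lemma ev_axis f g p3 : (forall k, f O O k = g O O k) -> ev f 0 0 p3 = ev g 0 0 p3.
Proof.
  intros H. apply Series_ext; intros n. f_equal. revert f g H.
  induction n; intros; simpl; [apply H|].
  rewrite (IHn (d3 f) (d3 g)) by (intros; apply H). ring.
Qed.

Lemma ev_plane f g p2 p3 : (forall j k, f O j k = g O j k) -> ev f 0 p2 p3 = ev g 0 p2 p3.
Proof.
  intros H. apply Series_ext; intros n. f_equal. revert f g H.
  induction n; intros; simpl; [apply H|].
  rewrite (IHn (d3 f) (d3 g)), (IHn (d2 f) (d2 g)) by (intros; apply H). ring.
Qed.

Lemma cls_add r f g : 0 <= r -> cls r f -> cls r g -> cls r (f + g)%fps.
Proof.
  intros Hr (C & m & HC & H) (C' & m' & HC' & H').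
  exists (C + C'), (max m m'); split; [lra|]. intros.
  eapply Rle_trans; [apply Rabs_triang|]. rewrite Rmult_plus_distr_r, Rmult_plus_distr_r.
  assert (0 <= r ^ (i + j + k)) by now apply pow_le.
  apply Rplus_le_compat; (eapply Rle_trans; [apply H || apply H'|]);
  (apply Rmult_le_compat_l; [now apply Rmult_le_pos|]);
  apply le_INR, fact_le; lia.
Qed.

Lemma cls_opp r f : cls r f -> cls r (- f)%fps.
Proof.
  intros (C & m & HC & H). exists C, m; split; auto. intros; unfold fopp. now rewrite Rabs_Ropp.
Qed.

Lemma cls_sub r f g : 0 <= r -> cls r f -> cls r g -> cls r (f - g)%fps.
Proof. intros; apply cls_add; auto using cls_opp. Qed.

Lemma cls_const r c : 0 <= r -> cls r (fconst c).
Proof.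
  intros Hr. exists (Rabs c), O; split; [apply Rabs_pos|]. intros i j k.
  rewrite Nat.add_0_r. destruct i, j, k;
   try (simpl fconst; rewrite Rabs_R0; repeat apply Rmult_le_pos;
     auto using Rabs_pos, pow_le, pos_INR).
  simpl; lra.
Qed.

Lemma cnv_shifted_fact r n : forall m m',
  cnv (fun k => r ^ k * INR (fact (k + m))) (fun k => r ^ k * INR (fact (k + m'))) n
  = INR (fact m) * INR (fact m') / INR (fact (S (m + m')))
    * (r ^ n * INR (fact (S (n + m + m')))).
Proof.
  induction n; intros.
  - simpl. field. apply (INR_fact_neq_0 (S (m + m'))).
  - cbn [cnv].
    rewrite (cnv_ext n _ (fun k => r * (r ^ k * INR (fact (k + S m))) + 0 * 0) _
        (fun k => r ^ k * INR (fact (k + m')))), cnv_lin_l, IHn;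
    [|intros; rewrite Nat.add_succ_r; simpl pow; simpl Nat.add; ring|reflexivity].
    rewrite (cnv_ext n (fun k => r ^ k * INR (fact (k + m)))  (fun k => r ^ k * INR (fact (k + m))) _
        (fun k => r * (r ^ k * INR (fact (k + S m'))) + 0 * 0)), cnv_lin_r, IHn;
    [|reflexivity|intros; rewrite Nat.add_succ_r; simpl pow; simpl Nat.add; ring].
    replace (S (n + S m + m')) with (S (S n + m + m')) by lia.
    replace (S (n + m + S m')) with (S (S n + m + m')) by lia.
    replace (S (S m + m')) with (S (S (m + m'))) by lia.
    replace (S (m + S m')) with (S (S (m + m'))) by lia.
    rewrite (fact_simpl (S (m + m'))), (fact_simpl m), (fact_simpl m'), !mult_INR.
    rewrite !S_INR, plus_INR. simpl pow. field.
    pose proof (pos_INR m). pose proof (pos_INR m').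
    repeat split; first [apply INR_fact_neq_0 | lra].
Qed.

(** * The Cauchy-Kovalevskaya theorem *)

Lemma cnv_scal_l c f g n : cnv (fun k => c * f k) g n = c * cnv f g n.
Proof.
  rewrite <- (Rplus_0_r (c * _)), <- (Rmult_0_l (cnv (fun _ => 0) g n)), <- cnv_lin_l.
  apply cnv_ext; intros; ring.
Qed.

Lemma cnv_scal_r c f g n : cnv g (fun k => c * f k) n = c * cnv g f n.
Proof.
  rewrite <- (Rplus_0_r (c * _)), <- (Rmult_0_l (cnv g (fun _ => 0) n)), <- cnv_lin_r.
  apply cnv_ext; intros; ring.
Qed.

Lemma cnv_pos n : forall A B, (forall k, 0 <= A k) -> (forall k, 0 <= B k) -> 0 <= cnv A B n.
Proof.
  induction n; intros; simpl; [now apply Rmult_le_pos|].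
  apply Rplus_le_le_0_compat; apply IHn; auto.
Qed.

(* Lexicographic weight: a first-order equation in the first variable involving
   derivatives in the other two only refers to coefficients of smaller weight. *)
Definition wt (i j k : nat) : nat := (3 * i + 2 * j + k)%nat.

Lemma fmul_majorant lam i j k : forall f g A B,
  (forall i j k, Rabs (f i j k) <= lam ^ wt i j k * A (i + j + k)%nat) ->
  (forall i j k, Rabs (g i j k) <= lam ^ wt i j k * B (i + j + k)%nat) ->
  Rabs (fmul f g i j k) <= lam ^ wt i j k * cnv A B (i + j + k)%nat.
Proof.
  assert (E : forall d n f' A B, (forall i j k, Rabs (f' i j k) <= lam ^ (d + wt i j k) * A (S (i + j + k))) ->
    (forall i j k, Rabs (f' i j k) <= lam ^ wt i j k * (lam ^ d * A (S (i + j + k)))) /\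
    cnv (fun n => lam ^ d * A (S n)) B n = lam ^ d * cnv (fun n => A (S n)) B n /\
    cnv B (fun n => lam ^ d * A (S n)) n = lam ^ d * cnv B (fun n => A (S n)) n).
  { intros d n f' A B H. repeat split.
    - intros. eapply Rle_trans; [apply H|]. rewrite pow_add. apply Req_le; ring.
    - apply (cnv_scal_l (lam ^ d) (fun n => A (S n))).
    - apply (cnv_scal_r (lam ^ d) (fun n => A (S n))). }
  assert (T : forall d f g f' g' A B i j k,
     (forall i j k, Rabs (f' i j k) <= lam ^ (d + wt i j k) * A (S (i + j + k))) ->
     (forall i j k, Rabs (g' i j k) <= lam ^ (d + wt i j k) * B (S (i + j + k))) ->
     (forall i j k, Rabs (f i j k) <= lam ^ wt i j k * A (i + j + k)%nat) ->
     (forall i j k, Rabs (g i j k) <= lam ^ wt i j k * B (i + j + k)%nat) ->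
     (forall f g A B, (forall i j k, Rabs (f i j k) <= lam ^ wt i j k * A (i + j + k)%nat) ->
      (forall i j k, Rabs (g i j k) <= lam ^ wt i j k * B (i + j + k)%nat) ->
      Rabs (fmul f g i j k) <= lam ^ wt i j k * cnv A B (i + j + k)%nat) ->
     Rabs (fmul f' g i j k + fmul f g' i j k) <= lam ^ (d + wt i j k) * cnv A B (S (i + j + k))).
  { clear i j k. intros d f g f' g' A B i j k Hf' Hg' Hf Hg IH.
    destruct (E d (i + j + k)%nat f' A B Hf') as (H1 & H2 & _).
    destruct (E d (i + j + k)%nat g' B A Hg') as (H3 & _ & H4).
    eapply Rle_trans; [apply Rabs_triang|].
    eapply Rle_trans; [apply Rplus_le_compat; [exact (IH f' g (fun n => lam ^ d * A (S n)) B H1 Hg)|exact (IH f g' A (fun n => lam ^ d * B (S n)) Hf H3)]|].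
    rewrite H2, H4, pow_add. simpl cnv. apply Req_le; ring. }
  leibniz_ind i j k.
  - rewrite Rabs_mult. specialize (H O O O). specialize (H0 O O O). simpl in *.
    rewrite Rmult_1_l in *. apply Rmult_le_compat; auto using Rabs_pos.
  - replace (wt 0 0 (S k)) with (1 + wt 0 0 k)%nat by (unfold wt; lia).
    replace (0 + 0 + S k)%nat with (S (0 + 0 + k)) by lia. apply T; auto; intros a b c.
    + replace (1 + wt a b c)%nat with (wt a b (S c)) by (unfold wt; lia).
      replace (S (a + b + c)) with (a + b + S c)%nat by lia. apply H.
    + replace (1 + wt a b c)%nat with (wt a b (S c)) by (unfold wt; lia).
      replace (S (a + b + c)) with (a + b + S c)%nat by lia. apply H0.
  - replace (wt 0 (S j) k) with (2 + wt 0 j k)%nat by (unfold wt; lia).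
    replace (0 + S j + k)%nat with (S (0 + j + k)) by lia. apply T; auto; intros a b c.
    + replace (2 + wt a b c)%nat with (wt a (S b) c) by (unfold wt; lia).
      replace (S (a + b + c)) with (a + S b + c)%nat by lia. apply H.
    + replace (2 + wt a b c)%nat with (wt a (S b) c) by (unfold wt; lia).
      replace (S (a + b + c)) with (a + S b + c)%nat by lia. apply H0.
  - replace (wt (S i) j k) with (3 + wt i j k)%nat by (unfold wt; lia).
    replace (S i + j + k)%nat with (S (i + j + k)) by lia. apply T; auto; intros a b c.
    + replace (3 + wt a b c)%nat with (wt (S a) b c) by (unfold wt; lia). apply H.
    + replace (3 + wt a b c)%nat with (wt (S a) b c) by (unfold wt; lia). apply H0.
Qed.

Lemma cls_mul r f g : 0 <= r -> cls r f -> cls r g -> cls r (f * g)%fps.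
Proof.
  intros Hr (C & m & HC & H) (C' & m' & HC' & H').
  exists (C * C' * (INR (fact m) * INR (fact m') / INR (fact (S (m + m'))))), (S (m + m')).
  split.
  { repeat apply Rmult_le_pos; auto using pos_INR.
    apply Rlt_le, Rinv_0_lt_compat, INR_fact_lt_0. }
  intros i j k. eapply Rle_trans.
  - apply (fmul_majorant 1 i j k f g (fun n => C * (r ^ n * INR (fact (n + m))))
       (fun n => C' * (r ^ n * INR (fact (n + m'))))); intros; rewrite pow1;
    (eapply Rle_trans; [apply H || apply H'|]); apply Req_le; ring.
  - rewrite pow1, cnv_scal_l, cnv_scal_r, cnv_shifted_fact.
    replace (i + j + k + S (m + m'))%nat with (S (i + j + k + m + m')) by lia.
    apply Req_le; ring.
Qed.

(* The factor (n+1)^-2 makes [Phi] stable under convolution up to a constant. *)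
Definition Phi (r : R) (n : nat) : R := r ^ n * INR (fact n) / (INR n + 1) ^ 2.

Lemma Phi_pos r n : 0 <= r -> 0 <= Phi r n.
Proof.
  intros. unfold Phi. pose proof (pos_INR n).
  apply Rmult_le_pos; [apply Rmult_le_pos; auto using pow_le, pos_INR|].
  apply Rlt_le, Rinv_0_lt_compat, pow_lt; lra.
Qed.

Lemma sum_inv_sq n : sum_f_R0 (fun k => / (INR k + 1) ^ 2) n <= 2 - / (INR n + 1).
Proof.
  induction n; [simpl; lra|].
  rewrite tech5. eapply Rle_trans; [apply Rplus_le_compat_r, IHn|].
  rewrite S_INR. pose proof (pos_INR n).
  apply Rminus_le_0.
  replace (2 - / (INR n + 1 + 1) - (2 - / (INR n + 1) + / (INR n + 1 + 1) ^ 2))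
   with (/ ((INR n + 1) * (INR n + 1 + 1) ^ 2)) by (field; lra).
  apply Rlt_le, Rinv_0_lt_compat, Rmult_lt_0_compat; [lra|apply pow_lt; lra].
Qed.

Lemma cnv_Phi r n : 0 <= r -> cnv (Phi r) (Phi r) n <= 8 * Phi r n.
Proof.
  intros Hr. pose proof (INR_fact_lt_0 n).
  apply Rmult_le_reg_r with (/ INR (fact n)); [now apply Rinv_0_lt_compat|].
  change (cnv (Phi r) (Phi r) n / INR (fact n) <= 8 * Phi r n / INR (fact n)).
  rewrite cnv_fact. unfold PS_mult.
  pose proof (pos_INR n). assert (0 <= r ^ n) by now apply pow_le.
  apply Rle_trans with (sum_f_R0 (fun k =>
     (/ (INR k + 1) ^ 2 + / (INR (n - k) + 1) ^ 2) * (2 * r ^ n / (INR n + 2) ^ 2)) n).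
  - apply sum_Rle. intros k Hk. unfold Phi.
    set (a := INR k + 1). set (b := INR (n - k) + 1).
    assert (Hab : INR n + 2 = a + b) by (unfold a, b; rewrite minus_INR by lia; ring).
    assert (0 < a) by (unfold a; pose proof (pos_INR k); lra).
    assert (0 < b) by (unfold b; pose proof (pos_INR (n - k)); lra).
    rewrite Hab. replace (r ^ n) with (r ^ k * r ^ (n - k)) in * by (rewrite <- pow_add; f_equal; lia).
    apply Rminus_le_0.
    match goal with |- 0 <= ?x =>
      replace x with (r ^ k * r ^ (n - k) * ((a - b) ^ 2 / (a ^ 2 * b ^ 2 * (a + b) ^ 2))) end.
    + apply Rmult_le_pos; auto. apply Rmult_le_pos; [apply pow2_ge_0|].
      apply Rlt_le, Rinv_0_lt_compat. repeat apply Rmult_lt_0_compat; try apply pow_lt; lra.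
    + field. repeat split; try apply INR_fact_neq_0; lra.
  - rewrite <- scal_sum.
    assert (Hs : sum_f_R0 (fun k => / (INR k + 1) ^ 2 + / (INR (n - k) + 1) ^ 2) n <= 4).
    { rewrite sum_plus.
      pose proof (sum_f_R0_skip (fun k => / (INR k + 1) ^ 2) n) as Hsk. cbv beta in Hsk.
      pose proof (sum_inv_sq n).
      assert (0 < / (INR n + 1)) by (apply Rinv_0_lt_compat; lra). lra. }
    unfold Phi.
    apply Rle_trans with (2 * r ^ n / (INR n + 2) ^ 2 * 4).
    + apply Rmult_le_compat_l; [|exact Hs].
      apply Rmult_le_pos; [lra|]. apply Rlt_le, Rinv_0_lt_compat, pow_lt; lra.
    + replace (8 * (r ^ n * INR (fact n) / (INR n + 1) ^ 2) / INR (fact n))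
       with (8 * r ^ n / (INR n + 1) ^ 2) by (field; split; lra).
      replace (2 * r ^ n / (INR n + 2) ^ 2 * 4) with (8 * r ^ n / (INR n + 2) ^ 2) by (field; lra).
      apply Rmult_le_compat_l; [lra|]. apply Rinv_le_contravar; [apply pow_lt; lra|].
      apply pow_incr; lra.
Qed.

Lemma cnv_Phi_S r n : 0 <= r -> cnv (Phi r) (fun k => Phi r (S k)) n <= 8 * Phi r (S n).
Proof.
  intros Hr. eapply Rle_trans; [|apply (cnv_Phi r (S n) Hr)]. simpl cnv.
  assert (0 <= cnv (fun k => Phi r (S k)) (Phi r) n)
    by (apply cnv_pos; intros; now apply Phi_pos).
  lra.
Qed.

Lemma Phi_le_S r n : 1 <= r -> Phi r n <= 4 * Phi r (S n).
Proof.
  intros Hr. unfold Phi. rewrite fact_simpl, mult_INR, S_INR.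
  pose proof (pos_INR n). assert (0 < r ^ n) by (apply pow_lt; lra). pose proof (INR_fact_lt_0 n).
  apply Rminus_le_0.
  set (x := INR n) in *.
  replace (4 * (r ^ S n * ((x + 1) * INR (fact n)) / (x + 1 + 1) ^ 2) - r ^ n * INR (fact n) / (x + 1) ^ 2)
   with (r ^ n * INR (fact n) * ((4 * r * (x + 1) ^ 3 - (x + 2) ^ 2) / ((x + 1) ^ 2 * (x + 2) ^ 2)))
   by (simpl pow; field; lra).
  apply Rmult_le_pos; [apply Rmult_le_pos; lra|].
  apply Rmult_le_pos; [|apply Rlt_le, Rinv_0_lt_compat, Rmult_lt_0_compat; apply pow_lt; lra].
  assert ((x + 2) ^ 2 <= 4 * (x + 1) ^ 3) by nra.
  assert (0 <= (x + 1) ^ 3) by (apply pow_le; lra). nra.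
Qed.

Lemma geom_le_Phi r0 n : 0 <= r0 -> r0 ^ n * INR (fact n) <= Phi (4 * r0) n.
Proof.
  intros Hr. unfold Phi. rewrite Rpow_mult_distr.
  assert (0 <= r0 ^ n * INR (fact n)) by (apply Rmult_le_pos; auto using pow_le, pos_INR).
  assert (H4 : (INR n + 1) ^ 2 <= 4 ^ n).
  { clear. induction n; [simpl; lra|]. rewrite S_INR. pose proof (pos_INR n). simpl in *. nra. }
  pose proof (pos_INR n).
  replace (4 ^ n * r0 ^ n * INR (fact n) / (INR n + 1) ^ 2)
    with (r0 ^ n * INR (fact n) * (4 ^ n / (INR n + 1) ^ 2)) by (field; lra).
  rewrite <- (Rmult_1_r (r0 ^ n * INR (fact n))) at 1.
  apply Rmult_le_compat_l; auto. apply Rle_div_r; [apply pow_lt; lra|lra].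
Qed.

Definition maj (r lam C : R) (f : fps) : Prop :=
  forall i j k, Rabs (f i j k) <= C * lam ^ wt i j k * Phi r (i + j + k).
Definition majS (d : nat) (r lam C : R) (f : fps) : Prop :=
  forall i j k, Rabs (f i j k) <= C * lam ^ (wt i j k + d) * Phi r (S (i + j + k)).

Definition agree {I : Type} (m : nat) (U V : I -> fps) : Prop :=
  forall c i j k, (wt i j k < m)%nat -> U c i j k = V c i j k.

Definition alg {I : Type} (r K : R) (X : (I -> fps) -> fps) : Prop :=
  (forall m U V, agree m U V -> forall i j k, (wt i j k < m)%nat -> X U i j k = X V i j k) /\
  exists C, 0 <= C /\ forall lam U, 1 <= lam -> (forall c, maj r lam K (U c)) -> maj r lam C (X U).

Definition qlin {I : Type} (r K : R) (d : nat) (X : (I -> fps) -> fps) : Prop :=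
  (forall m U V, agree m U V -> forall i j k, (wt i j k + d < m)%nat -> X U i j k = X V i j k) /\
  exists C, 0 <= C /\ forall lam U, 1 <= lam -> (forall c, maj r lam K (U c)) -> majS d r lam C (X U).

Lemma alg_var {I} r K (c : I) : 0 <= K -> alg r K (fun U => U c).
Proof. intros HK; split; [intros m U V H; apply H|]. exists K; split; auto. Qed.

Lemma alg_known {I} r K (f : fps) C : 0 <= r -> 0 <= C ->
  (forall i j k, Rabs (f i j k) <= C * Phi r (i + j + k)) -> alg (I := I) r K (fun _ => f).
Proof.
  intros Hr HC H; split; [auto|]. exists C; split; auto. intros lam U Hl _ i j k.
  eapply Rle_trans; [apply H|]. apply Rmult_le_compat_r; [now apply Phi_pos|].
  rewrite <- (Rmult_1_r C) at 1. apply Rmult_le_compat_l; auto. now apply pow_R1_Rle.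
Qed.

Lemma alg_const {I} r K c : 0 <= r -> alg (I := I) r K (fun _ => fconst c).
Proof.
  intros Hr. apply (alg_known r K _ (Rabs c)); auto using Rabs_pos. intros i j k.
  destruct i, j, k; try (simpl fconst; rewrite Rabs_R0; apply Rmult_le_pos;
   auto using Rabs_pos, Phi_pos).
  unfold Phi; simpl. apply Req_le; field.
Qed.

Lemma alg_add {I} r K (X Y : (I -> fps) -> fps) : 0 <= r -> alg r K X -> alg r K Y ->
  alg r K (fun U => X U + Y U)%fps.
Proof.
  intros Hr [HX (C & HC & BX)] [HY (C' & HC' & BY)]. split.
  - intros m U V H i j k Hw. unfold fadd. now rewrite (HX m U V H i j k Hw), (HY m U V H i j k Hw).
  - exists (C + C'); split; [lra|]. intros lam U Hl HU i j k.
    eapply Rle_trans; [apply Rabs_triang|]. rewrite !Rmult_plus_distr_r.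
    apply Rplus_le_compat; [now apply BX|now apply BY].
Qed.

Lemma alg_opp {I} r K (X : (I -> fps) -> fps) : alg r K X -> alg r K (fun U => - X U)%fps.
Proof.
  intros [HX (C & HC & BX)]. split.
  - intros m U V H i j k Hw. unfold fopp. now rewrite (HX m U V H i j k Hw).
  - exists C; split; auto. intros lam U Hl HU i j k. unfold fopp. rewrite Rabs_Ropp. now apply BX.
Qed.

Lemma alg_sub {I} r K (X Y : (I -> fps) -> fps) : 0 <= r -> alg r K X -> alg r K Y ->
  alg r K (fun U => X U - Y U)%fps.
Proof. intros; apply alg_add; auto using alg_opp. Qed.

Lemma alg_mul {I} r K (X Y : (I -> fps) -> fps) : 0 <= r -> alg r K X -> alg r K Y ->
  alg r K (fun U => X U * Y U)%fps.
Proof.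
  intros Hr [HX (C & HC & BX)] [HY (C' & HC' & BY)]. split.
  - intros m U V H i j k Hw. apply fmul_agree; intros a b c Ha Hb Hc;
    [apply (HX m)|apply (HY m)]; auto; unfold wt in *; lia.
  - exists (C * C' * 8); split; [apply Rmult_le_pos; [now apply Rmult_le_pos|lra]|].
    intros lam U Hl HU i j k.
    eapply Rle_trans; [apply (fmul_majorant lam i j k _ _ (fun n => C * Phi r n) (fun n => C' * Phi r n))|].
    + intros a b c; eapply Rle_trans; [exact (BX lam U Hl HU a b c)|apply Req_le; ring].
    + intros a b c; eapply Rle_trans; [exact (BY lam U Hl HU a b c)|apply Req_le; ring].
    + rewrite cnv_scal_l, cnv_scal_r.
      replace (C * C' * 8 * lam ^ wt i j k * Phi r (i + j + k))
        with (lam ^ wt i j k * (C * (C' * (8 * Phi r (i + j + k))))) by ring.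
      apply Rmult_le_compat_l; [apply pow_le; lra|].
      repeat (apply Rmult_le_compat_l; auto). now apply cnv_Phi.
Qed.

Lemma qlin_alg {I} r K d (X : (I -> fps) -> fps) : 1 <= r -> alg r K X -> qlin r K d X.
Proof.
  intros Hr [HX (C & HC & BX)]. split.
  - intros m U V H i j k Hw. apply (HX m); auto; lia.
  - exists (C * 4); split; [lra|]. intros lam U Hl HU i j k.
    eapply Rle_trans; [exact (BX lam U Hl HU i j k)|].
    replace (C * 4 * lam ^ (wt i j k + d) * Phi r (S (i + j + k)))
     with (C * lam ^ (wt i j k + d) * (4 * Phi r (S (i + j + k)))) by ring.
    assert (0 <= lam ^ wt i j k) by (apply pow_le; lra).
    apply Rmult_le_compat; [now apply Rmult_le_pos|apply Phi_pos; lra| |now apply Phi_le_S].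
    apply Rmult_le_compat_l; auto. apply Rle_pow; auto; lia.
Qed.

Lemma qlin_d2 {I} r K (X : (I -> fps) -> fps) : alg r K X -> qlin r K 2 (fun U => d2 (X U)).
Proof.
  intros [HX (C & HC & BX)]. split.
  - intros m U V H i j k Hw. apply (HX m); auto; unfold wt in *; lia.
  - exists C; split; auto. intros lam U Hl HU i j k. unfold d2.
    replace (wt i j k + 2)%nat with (wt i (S j) k) by (unfold wt; lia).
    replace (S (i + j + k)) with (i + S j + k)%nat by lia. now apply BX.
Qed.

Lemma qlin_weaken {I} r K d d' (X : (I -> fps) -> fps) : 0 <= r -> (d <= d')%nat ->
  qlin r K d X -> qlin r K d' X.
Proof.
  intros Hr Hd [HX (C & HC & BX)]. split.
  - intros m U V H i j k Hw. apply (HX m); auto; lia.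
  - exists C; split; auto. intros lam U Hl HU i j k.
    eapply Rle_trans; [exact (BX lam U Hl HU i j k)|].
    apply Rmult_le_compat_r; [now apply Phi_pos|]. apply Rmult_le_compat_l; auto.
    apply Rle_pow; auto; lia.
Qed.

Lemma qlin_d3 {I} r K (X : (I -> fps) -> fps) : 0 <= r -> alg r K X -> qlin r K 2 (fun U => d3 (X U)).
Proof.
  intros Hr [HX (C & HC & BX)]. apply (qlin_weaken r K 1); auto. split.
  - intros m U V H i j k Hw. apply (HX m); auto; unfold wt in *; lia.
  - exists C; split; auto. intros lam U Hl HU i j k. unfold d3.
    replace (wt i j k + 1)%nat with (wt i j (S k)) by (unfold wt; lia).
    replace (S (i + j + k)) with (i + j + S k)%nat by lia. now apply BX.
Qed.

Lemma qlin_add {I} r K d (X Y : (I -> fps) -> fps) : qlin r K d X -> qlin r K d Y ->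
  qlin r K d (fun U => X U + Y U)%fps.
Proof.
  intros [HX (C & HC & BX)] [HY (C' & HC' & BY)]. split.
  - intros m U V H i j k Hw. unfold fadd. now rewrite (HX m U V H i j k Hw), (HY m U V H i j k Hw).
  - exists (C + C'); split; [lra|]. intros lam U Hl HU i j k.
    eapply Rle_trans; [apply Rabs_triang|]. rewrite !Rmult_plus_distr_r.
    apply Rplus_le_compat; [now apply BX|now apply BY].
Qed.

Lemma qlin_opp {I} r K d (X : (I -> fps) -> fps) : qlin r K d X -> qlin r K d (fun U => - X U)%fps.
Proof.
  intros [HX (C & HC & BX)]. split.
  - intros m U V H i j k Hw. unfold fopp. now rewrite (HX m U V H i j k Hw).
  - exists C; split; auto. intros lam U Hl HU i j k. unfold fopp. rewrite Rabs_Ropp. now apply BX.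
Qed.

Lemma qlin_sub {I} r K d (X Y : (I -> fps) -> fps) : qlin r K d X -> qlin r K d Y ->
  qlin r K d (fun U => X U - Y U)%fps.
Proof. intros; apply qlin_add; auto using qlin_opp. Qed.

Lemma qlin_mul {I} r K d (X Y : (I -> fps) -> fps) : 0 <= r -> alg r K X -> qlin r K d Y ->
  qlin r K d (fun U => X U * Y U)%fps.
Proof.
  intros Hr [HX (C & HC & BX)] [HY (C' & HC' & BY)]. split.
  - intros m U V H i j k Hw. apply fmul_agree; intros a b c Ha Hb Hc;
    [apply (HX m)|apply (HY m)]; auto; unfold wt in *; lia.
  - exists (C * C' * 8); split; [apply Rmult_le_pos; [now apply Rmult_le_pos|lra]|].
    intros lam U Hl HU i j k.
    eapply Rle_trans; [apply (fmul_majorant lam i j k _ _ (fun n => C * Phi r n)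
      (fun n => C' * lam ^ d * Phi r (S n)))|].
    + intros a b c; eapply Rle_trans; [exact (BX lam U Hl HU a b c)|apply Req_le; ring].
    + intros a b c; eapply Rle_trans; [exact (BY lam U Hl HU a b c)|rewrite pow_add; apply Req_le; ring].
    + rewrite cnv_scal_l, (cnv_scal_r (C' * lam ^ d) (fun n => Phi r (S n))), pow_add.
      replace (C * C' * 8 * (lam ^ wt i j k * lam ^ d) * Phi r (S (i + j + k)))
        with (lam ^ wt i j k * (C * (C' * lam ^ d * (8 * Phi r (S (i + j + k)))))) by ring.
      assert (forall n, 0 <= lam ^ n) by (intro; apply pow_le; lra).
      apply Rmult_le_compat_l; [auto|].
      apply Rmult_le_compat_l; [auto|].
      apply Rmult_le_compat_l; [now apply Rmult_le_pos|]. now apply cnv_Phi_S.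
Qed.

Definition ck_step {I} (V0 : I -> R) (X1 X2 X3 : I -> (I -> fps) -> fps) (U : I -> fps) : I -> fps :=
  fun c i j k =>
  match i, j, k with
  | S i, _, _ => X1 c U i j k
  | O, S j, _ => X2 c U O j k
  | O, O, S k => X3 c U O O k
  | O, O, O => V0 c
  end.

(* Cauchy-Kovalevskaya for quasilinear systems, in Goursat form: [X1] is the
   evolution in the first variable, [X2] governs the data on the plane i = 0, and
   [X3] the data on the axis i = j = 0.  All right-hand sides gain at least one
   power of [lam] over the left-hand sides, so the majorant closes for [lam] large. *)
Lemma cauchy_kovalevskaya {I : Type} (l : list I) (r K : R) (V0 : I -> R)
  (X1 X2 X3 : I -> (I -> fps) -> fps) :
  (forall c, In c l) -> 1 <= r -> 0 < K -> (forall c, Rabs (V0 c) <= K) ->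
  (forall c, qlin r K 2 (X1 c)) -> (forall c, qlin r K 1 (X2 c)) -> (forall c, qlin r K 0 (X3 c)) ->
  exists U : I -> fps, exists lam, 1 <= lam /\ (forall c, maj r lam K (U c)) /\
    (forall c, U c O O O = V0 c) /\
    (forall c i j k, U c (S i) j k = X1 c U i j k) /\
    (forall c j k, U c O (S j) k = X2 c U O j k) /\
    (forall c k, U c O O (S k) = X3 c U O O k).
Proof.
  intros Hl Hr HK HV H1 H2 H3.
  assert (HC : exists C, 0 <= C /\ forall c lam U, In c l -> 1 <= lam -> (forall c, maj r lam K (U c)) ->
     majS 2 r lam C (X1 c U) /\ majS 1 r lam C (X2 c U) /\ majS 0 r lam C (X3 c U)).
  { clear Hl. induction l as [|c l IH]; [exists 0; split; [lra|intros c _ _ []]|].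
    destruct IH as (C & HC & IH).
    destruct (H1 c) as [_ (C1 & HC1 & B1)]. destruct (H2 c) as [_ (C2 & HC2 & B2)].
    destruct (H3 c) as [_ (C3 & HC3 & B3)].
    exists (C + C1 + C2 + C3). split; [lra|].
    assert (W : forall d lam C C' f, 1 <= lam -> C <= C' -> majS d r lam C f -> majS d r lam C' f).
    { intros d lam D D' f Hlam HD H i j k. eapply Rle_trans; [apply H|].
      apply Rmult_le_compat_r; [apply Phi_pos; lra|].
      apply Rmult_le_compat_r; auto. apply pow_le; lra. }
    intros c' lam U [<-|Hin] Hlam HU.
    - split; [|split]; [apply (W _ _ C1)|apply (W _ _ C2)|apply (W _ _ C3)]; auto; lra.
    - destruct (IH c' lam U Hin Hlam HU) as (? & ? & ?).
      split; [|split]; apply (W _ _ C); auto; lra. }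
  destruct HC as (C & HC & B).
  set (lam := Rmax 1 (C / K)).
  assert (Hlam : 1 <= lam) by apply Rmax_l.
  assert (HCl : C <= K * lam).
  { rewrite Rmult_comm. apply Rle_div_l; auto. apply Rmax_r. }
  set (T := ck_step V0 X1 X2 X3).
  assert (TB : forall U, (forall c, maj r lam K (U c)) -> forall c, maj r lam K (T U c)).
  { intros U HU c. destruct (B c lam U (Hl c) Hlam HU) as (B1 & B2 & B3).
    assert (Hlp : forall n, 0 <= lam ^ n) by (intro; apply pow_le; lra).
    assert (E : forall w x P, 0 <= P -> Rabs x <= C * lam ^ w * P -> Rabs x <= K * lam ^ (S w) * P).
    { intros w x P HP Hx. eapply Rle_trans; [exact Hx|]. apply Rmult_le_compat_r; auto.
      simpl. replace (K * (lam * lam ^ w)) with (K * lam * lam ^ w) by ring.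
      now apply Rmult_le_compat_r. }
    intros i j k. destruct i; [destruct j; [destruct k|]|]; simpl T.
    - unfold T, ck_step. eapply Rle_trans; [apply HV|]. unfold Phi; simpl. apply Req_le; field.
    - replace (wt 0 0 (S k)) with (S (wt 0 0 k + 0)) by (unfold wt; lia).
      apply E; [apply Phi_pos; lra|]. apply B3.
    - replace (wt 0 (S j) k) with (S (wt 0 j k + 1)) by (unfold wt; lia).
      apply E; [apply Phi_pos; lra|]. apply B2.
    - replace (wt (S i) j k) with (S (wt i j k + 2)) by (unfold wt; lia).
      apply E; [apply Phi_pos; lra|]. apply B1. }
  assert (TA : forall m U V, agree m U V -> agree (S m) (T U) (T V)).
  { intros m U V H c i j k Hw. unfold T, ck_step.
    destruct i; [destruct j; [destruct k|]|]; auto.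
    - apply (proj1 (H3 c) m); auto. unfold wt in *; lia.
    - apply (proj1 (H2 c) m); auto. unfold wt in *; lia.
    - apply (proj1 (H1 c) m); auto. unfold wt in *; lia. }
  set (It := fun n => Nat.iter n T (fun _ _ _ _ => 0)).
  assert (ItB : forall n c, maj r lam K (It n c)).
  { induction n; intros c; [|now apply TB]. intros i j k. simpl. rewrite Rabs_R0.
    apply Rmult_le_pos; [apply Rmult_le_pos; [lra|apply pow_le; lra]|apply Phi_pos; lra]. }
  assert (ItA : forall n m, agree n (It n) (It (n + m)%nat)).
  { induction n; intros m; [intros c i j k Hw; lia|]. now apply TA. }
  set (U := fun c i j k => It (S (wt i j k)) c i j k).
  assert (UA : forall n, agree n (It n) U).
  { intros n c i j k Hw. unfold U. symmetry.
    replace n with (S (wt i j k) + (n - S (wt i j k)))%nat by lia. apply ItA. lia. }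
  assert (UT : forall c i j k, U c i j k = T U c i j k).
  { intros c i j k. apply (TA (wt i j k) (It (wt i j k)) U (UA _)). lia. }
  exists U, lam. repeat split; auto; try (intros; now rewrite UT).
  intros c i j k. apply ItB.
Qed.

Lemma maj_cls r lam C f : 1 <= r -> 1 <= lam -> 0 <= C -> maj r lam C f ->
  forall i j k, Rabs (f i j k) <= C * (lam ^ 3 * r) ^ (i + j + k) * INR (fact (i + j + k)).
Proof.
  intros Hr Hl HC H i j k. eapply Rle_trans; [apply H|]. rewrite Rpow_mult_distr, <- pow_mult.
  unfold Phi. rewrite !Rmult_assoc. apply Rmult_le_compat_l; auto.
  pose proof (pos_INR (i + j + k)).
  assert (0 <= r ^ (i + j + k) * INR (fact (i + j + k))) by (apply Rmult_le_pos; [apply pow_le; lra|apply pos_INR]).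
  apply Rmult_le_compat; [apply pow_le; lra| | |].
  - apply Rmult_le_pos; auto. apply Rlt_le, Rinv_0_lt_compat, pow_lt; lra.
  - apply Rle_pow; auto. unfold wt; lia.
  - unfold Rdiv.
    match goal with |- ?x * _ <= _ => rewrite <- (Rmult_1_r x) at 2 end.
    apply Rmult_le_compat_l; auto. rewrite <- Rinv_1. apply Rinv_le_contravar; [lra|].
    apply pow_R1_Rle; lra.
Qed.

(** * The Euler equations *)

Lemma cls_mono r r' f : 0 <= r <= r' -> cls r f -> cls r' f.
Proof.
  intros Hr (C & m & HC & H). exists C, m; split; auto. intros.
  eapply Rle_trans; [apply H|]. apply Rmult_le_compat_r; [apply pos_INR|].
  apply Rmult_le_compat_l; auto. now apply pow_incr.
Qed.

Lemma term_le_Series (a : nat -> R) n : (forall k, 0 <= a k) -> ex_series a -> a n <= Series a.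
Proof.
  intros H E. apply Rle_trans with (sum_f_R0 a n).
  - destruct n; [apply Rle_refl|]. rewrite tech5.
    pose proof (cond_pos_sum a n H). lra.
  - apply sum_incr; auto using Un_cv_Series.
Qed.

Lemma cls_Phi r f : 0 <= r -> cls r f ->
  exists C, 0 <= C /\ forall i j k, Rabs (f i j k) <= C * Phi (8 * r) (i + j + k).
Proof.
  intros Hr (C & m & HC & H).
  set (a := fun n => (/ 2) ^ n * (INR (fact (n + m)) / INR (fact n))).
  assert (Ha : forall n, 0 <= a n).
  { intros n. apply Rmult_le_pos; [apply pow_le; lra|].
    apply Rmult_le_pos; [apply pos_INR|apply Rlt_le, Rinv_0_lt_compat, INR_fact_lt_0]. }
  assert (E : ex_series a) by (apply ex_series_poly_geom; lra).
  assert (HS : 0 <= Series a) by (eapply Rle_trans; [apply (Ha O)|now apply term_le_Series]).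
  exists (C * Series a); split; [now apply Rmult_le_pos|].
  intros i j k. eapply Rle_trans; [apply H|]. set (n := (i + j + k)%nat).
  rewrite !Rmult_assoc. apply Rmult_le_compat_l; auto.
  apply Rle_trans with (Series a * ((2 * r) ^ n * INR (fact n))).
  - replace (r ^ n * INR (fact (n + m))) with (a n * ((2 * r) ^ n * INR (fact n))).
    + apply Rmult_le_compat_r; [|now apply term_le_Series].
      apply Rmult_le_pos; [apply pow_le; lra|apply pos_INR].
    + unfold a. rewrite Rpow_mult_distr, pow_inv. field.
      split; first [apply INR_fact_neq_0|apply pow_nonzero; lra].
  - apply Rmult_le_compat_l; auto. replace (8 * r) with (4 * (2 * r)) by ring.
    apply geom_le_Phi; lra.
Qed.

Lemma alg_cls {I} r K f : 0 <= r -> cls r f -> alg (I := I) (8 * r) K (fun _ => f).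
Proof.
  intros Hr Hf. destruct (cls_Phi r f Hr Hf) as (C & HC & H).
  apply (alg_known _ _ _ C); auto; lra.
Qed.

Lemma fmul_agree_plane f f' g g' j k : (forall b c, f O b c = f' O b c) ->
  (forall b c, g O b c = g' O b c) -> fmul f g O j k = fmul f' g' O j k.
Proof.
  intros Hf Hg. apply fmul_agree; intros a b c Ha _ _;
  replace a with O by lia; auto.
Qed.

Lemma fmul_agree_axis f f' g g' k : (forall c, f O O c = f' O O c) ->
  (forall c, g O O c = g' O O c) -> fmul f g O O k = fmul f' g' O O k.
Proof.
  intros Hf Hg. apply fmul_agree; intros a b c Ha Hb _;
  replace a with O by lia; replace b with O by lia; auto.
Qed.

Lemma fmul_vanish f g i j k :
  (forall a b c, (a <= i)%nat -> (b <= j)%nat -> (c <= k)%nat -> g a b c = 0) ->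
  fmul f g i j k = 0.
Proof.
  intros H. rewrite (fmul_agree i j k f f g 0%fps), fmul_comm, fmul_0_l; auto.
  - destruct i, j, k; reflexivity.
  - intros a b c Ha Hb Hc. rewrite H by auto. destruct a, b, c; reflexivity.
Qed.

Lemma vanish_all {I} (Z : I -> fps) :
  (forall c, Z c O O O = 0) ->
  (forall c i j k, (forall c' x y z, (x <= i)%nat -> (y <= j)%nat -> (z <= k)%nat ->
     Z c' x y z = 0) -> Z c (S i) j k = 0) ->
  (forall c j k, (forall c' y z, (y <= j)%nat -> (z <= k)%nat ->
     Z c' O y z = 0) -> Z c O (S j) k = 0) ->
  (forall c k, (forall c' z, (z <= k)%nat -> Z c' O O z = 0) -> Z c O O (S k) = 0) ->
  forall c, Z c = 0%fps.
Proof.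
  intros H0 H1 H2 H3.
  assert (H : forall n c i j k, (i + j + k <= n)%nat -> Z c i j k = 0).
  { induction n; intros c i j k Hn.
    - replace i with O by lia. replace j with O by lia. replace k with O by lia. auto.
    - destruct i; [destruct j; [destruct k|]|]; auto;
      [apply H3|apply H2|apply H1]; intros; apply IHn; lia. }
  intros c. apply fps_ext; intros i j k. rewrite (H _ c i j k (Nat.le_refl _)).
  destruct i, j, k; reflexivity.
Qed.

Lemma fps_inverse (f g : fps) :
  f O O O * g O O O = 1 -> d1 g = (- (g * g * d1 f))%fps ->
  (forall j k, d2 g O j k = (- (g * g * d2 f))%fps O j k) ->
  (forall k, d3 g O O k = (- (g * g * d3 f))%fps O O k) ->
  (f * g = 1)%fps.
Proof.
  intros H0 H1 H2 H3. set (e := (f * g - 1)%fps).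
  assert (E : forall _ : unit, e = 0%fps).
  { apply (vanish_all (fun _ : unit => e)).
    - intros _. unfold e, fsub, fadd, fopp. rewrite fmul_000, H0. simpl; ring.
    - intros _ i j k H. change (d1 e i j k = 0).
      assert (Hd : d1 e = (- (g * d1 f) * e)%fps :> fps).
      { unfold e. rewrite d1_sub, d1_mul, H1, d1_const. ring. }
      rewrite Hd. apply fmul_vanish; intros; now apply (H tt).
    - intros _ j k H. change (d2 e O j k = 0).
      transitivity ((- (g * d2 f) * e)%fps O j k).
      + unfold e. rewrite d2_sub, d2_mul, d2_const.
        replace (- (g * d2 f) * (f * g - 1))%fps with (d2 f * g + f * (- (g * g * d2 f)) - 0)%fps by ring.
        unfold fsub, fadd. f_equal. f_equal.
        apply fmul_agree_plane; auto.
      + apply fmul_vanish; intros a b c Ha Hb Hc. replace a with O by lia. now apply (H tt).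
    - intros _ k H. change (d3 e O O k = 0).
      transitivity ((- (g * d3 f) * e)%fps O O k).
      + unfold e. rewrite d3_sub, d3_mul, d3_const.
        replace (- (g * d3 f) * (f * g - 1))%fps with (d3 f * g + f * (- (g * g * d3 f)) - 0)%fps by ring.
        unfold fsub, fadd. f_equal. f_equal.
        apply fmul_agree_axis; auto.
      + apply fmul_vanish; intros a b c Ha Hb Hc. replace a with O by lia. replace b with O by lia.
        now apply (H tt). }
  specialize (E tt). unfold e in E.
  replace (f * g)%fps with (f * g - 1 + 1)%fps by ring. rewrite E. ring.
Qed.

Ltac alg_tac :=
  repeat first
  [ apply alg_add; [lra| |] | apply alg_sub; [lra| |] | apply alg_opp | apply alg_mul; [lra| |]
  | apply alg_const; lra | apply alg_var; lra
  | apply alg_cls; [lra|repeat first [assumption | apply cls_d1; [lra|] | apply cls_d2; [lra|] | apply cls_d3; [lra|]]] ].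

Ltac qlin_tac :=
  repeat first
  [ apply qlin_alg; [lra|solve [alg_tac]]
  | apply qlin_add | apply qlin_sub | apply qlin_opp
  | apply qlin_d2; solve [alg_tac] | apply qlin_d3; [lra|solve [alg_tac]]
  | apply qlin_mul; [lra|solve [alg_tac]|] ].

(* [Vsig] is 1/rho and [Vp] the pressure; with these unknowns the system is polynomial. *)
Inductive euler_var := Vrho | Vsig | Vu | Vv | Vp.

Lemma euler_formal (gamma : R) (r0 u0 v0 : fps) (r p00 : R) :
  1 <= r -> cls r r0 -> cls r u0 -> cls r v0 -> r0 O O O <> 0 ->
  exists r' rho sig u v p,
    r <= r' /\ cls r' rho /\ cls r' sig /\ cls r' u /\ cls r' v /\ cls r' p /\
    (rho * sig = 1)%fps /\
    (d1 rho + d2 (rho * u) + d3 (rho * v) = 0)%fps /\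
    (d1 (rho * u) + d2 (rho * (u * u) + p) + d3 (rho * u * v) = 0)%fps /\
    (d1 (rho * v) + d2 (rho * u * v) + d3 (rho * (v * v) + p) = 0)%fps /\
    (forall j k, rho O j k = r0 O j k /\ u O j k = u0 O j k /\ v O j k = v0 O j k) /\
    p O O O = p00 /\
    d1 p = (fconst gamma * p * sig * d1 rho)%fps /\
    (forall j k, d2 p O j k = (fconst gamma * p * sig * d2 rho)%fps O j k) /\
    (forall k, d3 p O O k = (fconst gamma * p * sig * d3 rho)%fps O O k).
Proof.
  intros Hr Hr0 Hu0 Hv0 H0.
  set (V0 := fun c => match c with Vrho => r0 O O O | Vsig => / r0 O O O
     | Vu => u0 O O O | Vv => v0 O O O | Vp => p00 end).
  set (mass := fun U : euler_var -> fps => (d2 (U Vrho * U Vu) + d3 (U Vrho * U Vv))%fps).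
  set (X1 := fun c (U : euler_var -> fps) => match c with
     | Vrho => (- mass U)%fps
     | Vsig => (U Vsig * U Vsig * mass U)%fps
     | Vu => (- (U Vu * d2 (U Vu) + U Vv * d3 (U Vu) + U Vsig * d2 (U Vp)))%fps
     | Vv => (- (U Vu * d2 (U Vv) + U Vv * d3 (U Vv) + U Vsig * d3 (U Vp)))%fps
     | Vp => (- (fconst gamma * U Vp * U Vsig * mass U))%fps end).
  set (X := fun (d : fps -> fps) c (U : euler_var -> fps) => match c with
     | Vrho => d r0 | Vsig => (- (U Vsig * U Vsig * d r0))%fps
     | Vu => d u0 | Vv => d v0
     | Vp => (fconst gamma * U Vp * U Vsig * d r0)%fps end).
  set (K := 1 + (Rabs (r0 O O O) + Rabs (/ r0 O O O) + Rabs (u0 O O O) + Rabs (v0 O O O) + Rabs p00)).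
  assert (HK : 0 < K /\ forall c, Rabs (V0 c) <= K).
  { unfold K. pose proof (Rabs_pos (r0 O O O)). pose proof (Rabs_pos (/ r0 O O O)).
    pose proof (Rabs_pos (u0 O O O)). pose proof (Rabs_pos (v0 O O O)). pose proof (Rabs_pos p00).
    split; [lra|]. intros []; simpl; lra. }
  destruct HK as [HK HV0]. clearbody K.
  destruct (cauchy_kovalevskaya (Vrho :: Vsig :: Vu :: Vv :: Vp :: nil) (8 * r) K V0
     X1 (X d2) (X d3)) as (U & lam & Hlam & HU & U0 & U1 & U2 & U3); auto; try lra.
  - intros []; simpl; tauto.
  - intros []; unfold X1, mass; cbv beta iota; qlin_tac.
  - intros []; unfold X; cbv beta iota; qlin_tac.
  - intros []; unfold X; cbv beta iota; qlin_tac.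
  - assert (E1 : forall c, d1 (U c) = X1 c U) by (intros c; apply fps_ext; intros; apply U1).
    assert (Hrho : forall j k, U Vrho O j k = r0 O j k).
    { intros [|j] k; [destruct k|]; [apply U0|apply U3|apply U2]. }
    assert (E2 : forall f j k, (f * d2 (U Vrho))%fps O j k = (f * d2 r0)%fps O j k).
    { intros. apply fmul_agree_plane; auto. intros; apply Hrho. }
    assert (E3 : forall f k, (f * d3 (U Vrho))%fps O O k = (f * d3 r0)%fps O O k).
    { intros. apply fmul_agree_axis; auto. intros; apply Hrho. }
    assert (Hinv : (U Vrho * U Vsig = 1)%fps).
    { apply fps_inverse.
      - rewrite !U0. simpl. now field.
      - rewrite !E1. simpl. ring.
      - intros j k. unfold fopp at 1. rewrite E2. apply U2.
      - intros k. unfold fopp at 1. rewrite E3. apply U3. }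
    assert (Hcls : forall c, cls (lam ^ 3 * (8 * r)) (U c)).
    { intros c. exists K, O; split; [lra|]. intros i j k. rewrite Nat.add_0_r.
      apply maj_cls; auto; lra. }
    exists (lam ^ 3 * (8 * r)), (U Vrho), (U Vsig), (U Vu), (U Vv), (U Vp).
    split. { assert (1 <= lam ^ 3) by now apply pow_R1_Rle. nra. }
    do 5 (split; [apply Hcls|]). split; [exact Hinv|].
    split. { rewrite E1. simpl. unfold mass. ring. }
    split. { rewrite d1_mul, !E1. simpl. unfold mass.
      rewrite !d2_add, !d2_mul, !d3_mul.
      replace (d2 (U Vp)) with (U Vrho * U Vsig * d2 (U Vp))%fps at 2 by (rewrite Hinv; ring).
      ring. }
    split. { rewrite d1_mul, !E1. simpl. unfold mass.
      rewrite !d3_add, !d2_mul, !d3_mul.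
      replace (d3 (U Vp)) with (U Vrho * U Vsig * d3 (U Vp))%fps at 2 by (rewrite Hinv; ring).
      ring. }
    split. { intros j k. split; [apply Hrho|]. destruct j; [destruct k|]; split; (apply U0||apply U3||apply U2). }
    split; [apply U0|].
    split. { rewrite !E1. simpl. ring. }
    split. { intros j k. rewrite E2. apply U2. }
    intros k. rewrite E3. apply U3.
Qed.

(** * The moving frame *)

Definition fvec := ambient -> fps.

Definition fdot (X Y : fvec) : fps := (X e1 * Y e1 + X e2 * Y e2 + X e3 * Y e3)%fps.

Definition fcross (X Y : fvec) : fvec := fun e =>
  match e with
  | e1 => X e2 * Y e3 - X e3 * Y e2
  | e2 => X e3 * Y e1 - X e1 * Y e3
  | e3 => X e1 * Y e2 - X e2 * Y e1
  end%fps.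

Definition zero_below (i j k : nat) (f : fps) : Prop :=
  forall a b c, (a <= i)%nat -> (b <= j)%nat -> (c <= k)%nat -> f a b c = 0.

Lemma zero_below_at i j k f : zero_below i j k f -> f i j k = 0.
Proof. intros H; apply H; lia. Qed.

Lemma zero_below_add i j k f g : zero_below i j k f -> zero_below i j k g ->
  zero_below i j k (f + g)%fps.
Proof. intros Hf Hg a b c Ha Hb Hc. unfold fadd. rewrite Hf, Hg by auto. ring. Qed.

Lemma zero_below_opp i j k f : zero_below i j k f -> zero_below i j k (- f)%fps.
Proof. intros Hf a b c Ha Hb Hc. unfold fopp. rewrite Hf by auto. ring. Qed.

Lemma zero_below_mul_r i j k f g : zero_below i j k g -> zero_below i j k (f * g)%fps.
Proof.
  intros Hg a b c Ha Hb Hc. apply fmul_vanish. intros x y z Hx Hy Hz. apply Hg; lia.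
Qed.

Lemma zero_below_mul_l i j k f g : zero_below i j k f -> zero_below i j k (f * g)%fps.
Proof. rewrite fmul_comm. apply zero_below_mul_r. Qed.

Ltac zero_below_tac :=
  repeat first
  [ assumption | match goal with H : forall e, zero_below _ _ _ _ |- _ => apply H end
  | apply zero_below_add | apply zero_below_opp
  | solve [apply zero_below_mul_r; zero_below_tac] | solve [apply zero_below_mul_l; zero_below_tac] ].

(* [FX], [FY] are the tangent vectors of the surface and [Fl] is 1/L; the Christoffel
   symbols are A = G^1_11, B = G^1_12, C = G^2_11, D = G^2_12, P = G^1_22, Q = G^2_22.
   The evolution variable is x2, followed by x1 and t.  The Codazzi equations are solved
   for P and Q, which is possible because L <> 0; the other four symbols evolve by the
   tangential part of the compatibility conditions for the Gauss formulas
   y_ij = G^k_ij y_k + L_ij (y_1 x y_2), where [L_ij] is h_ij / sqrt (det g). *)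
Inductive frame_var := Fl | FA | FB | FC | FD | FX (e : ambient) | FY (e : ambient).

Lemma frame_formal (L M N : fps) (r : R) :
  1 <= r -> cls r L -> cls r M -> cls r N -> L O O O <> 0 ->
  exists r' A B C D P Q (X Y : fvec),
    r <= r' /\ cls r' A /\ cls r' B /\ cls r' C /\ cls r' D /\ cls r' P /\ cls r' Q /\
    (forall e, cls r' (X e)) /\ (forall e, cls r' (Y e)) /\
    (L * P = d1 M - d2 N + (B + B) * M - A * N)%fps /\
    (L * Q = d2 M - d1 L + (D + D) * M - C * N)%fps /\
    (d1 A = d2 B + D * B - C * P - (L * N - M * M) * fdot X Y)%fps /\
    (d1 C = d2 D + B * C + D * D - A * D - C * Q + (L * N - M * M) * fdot X X)%fps /\
    (d1 B = d2 P + P * A + Q * B - B * B - D * P - (L * N - M * M) * fdot Y Y)%fps /\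
    (d1 D = d2 Q + P * C - B * D + (L * N - M * M) * fdot X Y)%fps /\
    (forall e, d2 (X e) = A * X e + C * Y e + L * fcross X Y e)%fps /\
    (forall e, d2 (Y e) = B * X e + D * Y e + M * fcross X Y e)%fps /\
    (forall e, d1 (X e) = B * X e + D * Y e + M * fcross X Y e)%fps /\
    (forall e, d1 (Y e) = P * X e + Q * Y e + N * fcross X Y e)%fps /\
    X e1 O O O = 1 /\ X e2 O O O = 0 /\ X e3 O O O = 0 /\
    Y e1 O O O = 0 /\ Y e2 O O O = 1 /\ Y e3 O O O = 0.
Proof.
  intros Hr HL HM HN H0.
  set (V0 := fun c => match c with Fl => / L O O O | FX e1 => 1 | FY e2 => 1 | _ => 0 end).
  set (pP := fun U : frame_var -> fps =>
    (U Fl * (d1 M - d2 N + (U FB + U FB) * M - U FA * N))%fps).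
  set (pQ := fun U : frame_var -> fps =>
    (U Fl * (d2 M - d1 L + (U FD + U FD) * M - U FC * N))%fps).
  set (W := fun (U : frame_var -> fps) => fcross (fun e => U (FX e)) (fun e => U (FY e))).
  set (g := fun (U : frame_var -> fps) (a b : ambient -> frame_var) =>
     fdot (fun e => U (a e)) (fun e => U (b e))).
  set (k := (L * N - M * M)%fps).
  set (X1 := fun c (U : frame_var -> fps) => match c with
    | Fl => (- (U Fl * U Fl * d1 L))%fps
    | FA => (d2 (U FB) + U FD * U FB - U FC * pP U - k * g U FX FY)%fps
    | FC => (d2 (U FD) + U FB * U FC + U FD * U FD - U FA * U FD - U FC * pQ U + k * g U FX FX)%fps
    | FB => (d2 (pP U) + pP U * U FA + pQ U * U FB - U FB * U FB - U FD * pP U - k * g U FY FY)%fps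
    | FD => (d2 (pQ U) + pP U * U FC - U FB * U FD + k * g U FX FY)%fps
    | FX e => (U FB * U (FX e) + U FD * U (FY e) + M * W U e)%fps
    | FY e => (pP U * U (FX e) + pQ U * U (FY e) + N * W U e)%fps end).
  set (X2 := fun c (U : frame_var -> fps) => match c with
    | Fl => (- (U Fl * U Fl * d2 L))%fps
    | FX e => (U FA * U (FX e) + U FC * U (FY e) + L * W U e)%fps
    | FY e => (U FB * U (FX e) + U FD * U (FY e) + M * W U e)%fps
    | _ => 0%fps end).
  set (X3 := fun c (U : frame_var -> fps) => match c with
    | Fl => (- (U Fl * U Fl * d3 L))%fps
    | _ => 0%fps end).
  set (K := 1 + Rabs (/ L O O O)).
  assert (HK : 0 < K /\ forall c, Rabs (V0 c) <= K).
  { unfold K. pose proof (Rabs_pos (/ L O O O)).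
    split; [lra|]. intros [| | | | |[]|[]]; simpl; rewrite ?Rabs_R0, ?Rabs_R1; lra. }
  destruct HK as [HK HV0]. clearbody K.
  destruct (cauchy_kovalevskaya (Fl :: FA :: FB :: FC :: FD :: FX e1 :: FX e2 :: FX e3
     :: FY e1 :: FY e2 :: FY e3 :: nil) (8 * r) K V0
     X1 X2 X3) as (U & lam & Hlam & HU & U0 & U1 & U2 & U3); auto; try lra.
  { intros [| | | | |[]|[]]; simpl; tauto. }
  { intros [| | | | |[]|[]]; unfold X1, pP, pQ, k, g, W, fdot, fcross; cbv beta iota; qlin_tac. }
  { intros [| | | | |[]|[]]; unfold X2, W, fcross; cbv beta iota; qlin_tac. }
  { intros [| | | | |[]|[]]; unfold X3; cbv beta iota; qlin_tac. }
  assert (E1 : forall c, d1 (U c) = X1 c U) by (intros c; apply fps_ext; intros; apply U1).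
  assert (Hinv : (L * U Fl = 1)%fps).
  { apply fps_inverse.
    - rewrite U0. simpl. now field.
    - apply E1.
    - intros; apply U2.
    - intros; apply U3. }
  set (r' := lam ^ 3 * (8 * r)).
  assert (Hr' : 1 <= lam ^ 3) by now apply pow_R1_Rle.
  assert (Hr'r : r <= r') by (unfold r'; nra).
  assert (Hcls : forall c, cls r' (U c)).
  { intros c. exists K, O; split; [lra|]. intros i j l. rewrite Nat.add_0_r.
    apply maj_cls; auto; lra. }
  assert (HL' : cls r' L) by (apply (cls_mono r); auto; lra).
  assert (HM' : cls r' M) by (apply (cls_mono r); auto; lra).
  assert (HN' : cls r' N) by (apply (cls_mono r); auto; lra).
  set (A := U FA) in *. set (B := U FB) in *. set (C := U FC) in *. set (D := U FD) in *.
  set (P := pP U) in *. set (Q := pQ U) in *.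
  set (X := fun e => U (FX e)). set (Y := fun e => U (FY e)).
  assert (HP : (L * P = d1 M - d2 N + (B + B) * M - A * N)%fps).
  { unfold P, pP. fold A B. transitivity (L * U Fl * (d1 M - d2 N + (B + B) * M - A * N))%fps;
    [ring|rewrite Hinv; ring]. }
  assert (HQ : (L * Q = d2 M - d1 L + (D + D) * M - C * N)%fps).
  { unfold Q, pQ. fold C D. transitivity (L * U Fl * (d2 M - d1 L + (D + D) * M - C * N))%fps;
    [ring|rewrite Hinv; ring]. }
  pose proof (E1 FA) as EA. pose proof (E1 FB) as EB. pose proof (E1 FC) as EC. pose proof (E1 FD) as ED.
  assert (EX : forall e, (d1 (X e) = B * X e + D * Y e + M * fcross X Y e)%fps) by (intro; apply E1).
  assert (EY : forall e, (d1 (Y e) = P * X e + Q * Y e + N * fcross X Y e)%fps) by (intro; apply E1).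
  change (d1 A = (d2 B + D * B - C * P - k * fdot X Y)%fps) in EA.
  change (d1 C = (d2 D + B * C + D * D - A * D - C * Q + k * fdot X X)%fps) in EC.
  change (d1 B = (d2 P + P * A + Q * B - B * B - D * P - k * fdot Y Y)%fps) in EB.
  change (d1 D = (d2 Q + P * C - B * D + k * fdot X Y)%fps) in ED.
  set (ZX := fun e => (d2 (X e) - (A * X e + C * Y e + L * fcross X Y e))%fps).
  set (ZY := fun e => (d2 (Y e) - (B * X e + D * Y e + M * fcross X Y e))%fps).
  assert (HQ' : (d1 L - d2 M + L * Q - (D + D) * M + C * N = 0)%fps) by (rewrite HQ; ring).
  assert (HP' : (d1 M - d2 N - L * P + (B + B) * M - A * N = 0)%fps) by (rewrite HP; ring).
  (* The defects of the Gauss formulas in the direction x1 vanish for x2 = b and satisfy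
     a linear system in x2, hence vanish identically. *)
  assert (DZX : forall e, (d1 (ZX e) = B * ZX e + D * ZY e
      + M * (fcross ZX Y e + fcross X ZY e))%fps).
  { intros e.
    transitivity (B * ZX e + D * ZY e + M * (fcross ZX Y e + fcross X ZY e)
      - (d1 L - d2 M + L * Q - (D + D) * M + C * N) * fcross X Y e)%fps;
    [|rewrite HQ'; ring].
    unfold ZX, ZY.
    destruct e; unfold fcross; cbv beta iota;
    rewrite !d1_sub;
    change (d1 (d2 (X e1))) with (d2 (d1 (X e1)));
    change (d1 (d2 (X e2))) with (d2 (d1 (X e2)));
    change (d1 (d2 (X e3))) with (d2 (d1 (X e3)));
    rewrite ?EX, ?EY; unfold fcross; cbv beta iota;
    rewrite ?d1_add, ?d1_mul, ?d1_sub, ?d1_mul, ?d2_add, ?d2_mul, ?d2_sub, ?d2_mul,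
       ?EX, ?EY, ?EA, ?EC; unfold k, fdot, fcross; cbv beta iota; ring. }
  assert (DZY : forall e, (d1 (ZY e) = P * ZX e + Q * ZY e
      + N * (fcross ZX Y e + fcross X ZY e))%fps).
  { intros e.
    transitivity (P * ZX e + Q * ZY e + N * (fcross ZX Y e + fcross X ZY e)
      - (d1 M - d2 N - L * P + (B + B) * M - A * N) * fcross X Y e)%fps;
    [|rewrite HP'; ring].
    unfold ZX, ZY.
    destruct e; unfold fcross; cbv beta iota;
    rewrite !d1_sub;
    change (d1 (d2 (Y e1))) with (d2 (d1 (Y e1)));
    change (d1 (d2 (Y e2))) with (d2 (d1 (Y e2)));
    change (d1 (d2 (Y e3))) with (d2 (d1 (Y e3)));
    rewrite ?EX, ?EY; unfold fcross; cbv beta iota;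
    rewrite ?d1_add, ?d1_mul, ?d1_sub, ?d1_mul, ?d2_add, ?d2_mul, ?d2_sub, ?d2_mul,
       ?EX, ?EY, ?EB, ?ED; unfold k, fdot, fcross; cbv beta iota; ring. }
  assert (HZ : forall c : ambient * bool, (if snd c then ZX (fst c) else ZY (fst c)) = 0%fps).
  { assert (plane : forall (c : ambient * bool) j l, (if snd c then ZX (fst c) else ZY (fst c)) O j l = 0).
    { intros [e []] j l; cbn [fst snd].
      - change (d2 (X e) O j l + - X2 (FX e) U O j l = 0).
        replace (X2 (FX e) U O j l) with (d2 (X e) O j l) by apply U2. ring.
      - change (d2 (Y e) O j l + - X2 (FY e) U O j l = 0).
        replace (X2 (FY e) U O j l) with (d2 (Y e) O j l) by apply U2. ring. }
    apply vanish_all; try (intros; apply plane).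
    intros [e []] i j l H; simpl.
    - change (d1 (ZX e) i j l = 0). rewrite DZX. apply (zero_below_at i j l).
      assert (VX : forall e', zero_below i j l (ZX e')) by (intros e' a b c; apply (H (e', true))).
      assert (VY : forall e', zero_below i j l (ZY e')) by (intros e' a b c; apply (H (e', false))).
      destruct e; unfold fcross; cbv beta iota; zero_below_tac.
    - change (d1 (ZY e) i j l = 0). rewrite DZY. apply (zero_below_at i j l).
      assert (VX : forall e', zero_below i j l (ZX e')) by (intros e' a b c; apply (H (e', true))).
      assert (VY : forall e', zero_below i j l (ZY e')) by (intros e' a b c; apply (H (e', false))).
      destruct e; unfold fcross; cbv beta iota; zero_below_tac. }
  assert (HX2 : forall e, (d2 (X e) = A * X e + C * Y e + L * fcross X Y e)%fps).
  { intros e. pose proof (HZ (e, true)) as E. simpl in E. unfold ZX in E.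
    transitivity (d2 (X e) - (A * X e + C * Y e + L * fcross X Y e)
       + (A * X e + C * Y e + L * fcross X Y e))%fps; [ring|rewrite E; ring]. }
  assert (HY2 : forall e, (d2 (Y e) = B * X e + D * Y e + M * fcross X Y e)%fps).
  { intros e. pose proof (HZ (e, false)) as E. simpl in E. unfold ZY in E.
    transitivity (d2 (Y e) - (B * X e + D * Y e + M * fcross X Y e)
       + (B * X e + D * Y e + M * fcross X Y e))%fps; [ring|rewrite E; ring]. }
  assert (Hr0 : 0 <= r') by lra.
  assert (HPc : cls r' P).
  { unfold P, pP. repeat first [apply cls_mul; [lra| |] | apply cls_sub; [lra| |] | apply cls_add; [lra| |]
     | apply cls_d1; [lra|] | apply cls_d2; [lra|] | apply Hcls | assumption]. }
  assert (HQc : cls r' Q).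
  { unfold Q, pQ. repeat first [apply cls_mul; [lra| |] | apply cls_sub; [lra| |] | apply cls_add; [lra| |]
     | apply cls_d1; [lra|] | apply cls_d2; [lra|] | apply Hcls | assumption]. }
  exists r', A, B, C, D, P, Q, X, Y.
  repeat match goal with |- _ /\ _ => split end; try assumption; try apply Hcls;
    try (intro; apply Hcls); apply U0.
Qed.

(** * Functions represented by power series *)

Lemma hom_tr n p1 p2 p3 : forall f, hom n p3 p2 p1 (tr f) = hom n p1 p2 p3 f.
Proof.
  induction n; intros f; [reflexivity|]. simpl.
  change (d1 (tr f)) with (tr (d3 f)). change (d2 (tr f)) with (tr (d2 f)).
  change (d3 (tr f)) with (tr (d1 f)). rewrite !IHn. ring.
Qed.

Lemma ev_tr f p1 p2 p3 : ev (tr f) p3 p2 p1 = ev f p1 p2 p3.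
Proof. apply Series_ext; intros; now rewrite hom_tr. Qed.

Lemma cls_tr r f : cls r f -> cls r (tr f).
Proof.
  intros (C & m & HC & H). exists C, m; split; auto. intros i j k. unfold tr.
  replace (i + j + k)%nat with (k + j + i)%nat by lia. apply H.
Qed.

Lemma ev_lipschitz r q f : 0 <= r -> 0 <= q -> r * q < 1 -> cls r f ->
  exists K, 0 <= K /\ forall p1 p2 p3 s1 s2 s3, l1 p1 p2 p3 <= q -> l1 s1 s2 s3 <= q ->
    Rabs (ev f s1 s2 s3 - ev f p1 p2 p3) <= K * l1 (s1 - p1) (s2 - p2) (s3 - p3).
Proof.
  intros Hr Hq Hrq Hf.
  destruct (ev_bounded r q _ Hr Hq Hrq (cls_d1 r f Hr Hf)) as (K1 & HK1 & B1).
  destruct (ev_bounded r q _ Hr Hq Hrq (cls_d2 r f Hr Hf)) as (K2 & HK2 & B2).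
  destruct (ev_bounded r q _ Hr Hq Hrq (cls_d3 r f Hr Hf)) as (K3 & HK3 & B3).
  exists (K1 + K2 + K3). split; [lra|]. intros p1 p2 p3 s1 s2 s3 Hp Hs.
  assert (Hseg : forall z, 0 <= z <= 1 ->
    l1 (p1 + z * (s1 - p1)) (p2 + z * (s2 - p2)) (p3 + z * (s3 - p3)) <= q).
  { intros z Hz. unfold l1 in *.
    assert (T : forall p s, Rabs (p + z * (s - p)) <= (1 - z) * Rabs p + z * Rabs s).
    { intros p s. replace (p + z * (s - p)) with ((1 - z) * p + z * s) by ring.
      eapply Rle_trans; [apply Rabs_triang|]. rewrite !Rabs_mult, !(Rabs_pos_eq z), (Rabs_pos_eq (1 - z)) by lra.
      lra. }
    pose proof (T p1 s1). pose proof (T p2 s2). pose proof (T p3 s3). nra. }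
  assert (HD : forall z, 0 <= z <= 1 ->
    is_derive (fun z => ev f (p1 + z * (s1 - p1)) (p2 + z * (s2 - p2)) (p3 + z * (s3 - p3))) z
      ((fun z => (s1 - p1) * ev (d1 f) (p1 + z * (s1 - p1)) (p2 + z * (s2 - p2)) (p3 + z * (s3 - p3))
     + (s2 - p2) * ev (d2 f) (p1 + z * (s1 - p1)) (p2 + z * (s2 - p2)) (p3 + z * (s3 - p3))
     + (s3 - p3) * ev (d3 f) (p1 + z * (s1 - p1)) (p2 + z * (s2 - p2)) (p3 + z * (s3 - p3))) z)).
  { intros z Hz. apply (ev_is_derive r); auto.
    eapply Rle_lt_trans; [|exact Hrq]. apply Rmult_le_compat_l; auto. }
  destruct (MVT_gen _ 0 1 _ (fun z Hz => HD z ltac:(rewrite Rmin_left, Rmax_right in Hz by lra; lra)))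
    as (c & Hc & E).
  { intros z Hz. rewrite Rmin_left, Rmax_right in Hz by lra.
    apply derivable_continuous_pt, ex_derive_Reals_0. eexists; apply HD; lra. }
  rewrite Rmin_left, Rmax_right in Hc by lra.
  rewrite !Rmult_1_l, !Rmult_0_l, !Rplus_0_r, Rminus_0_r, Rmult_1_r in E.
  replace (p1 + (s1 - p1)) with s1 in E by ring.
  replace (p2 + (s2 - p2)) with s2 in E by ring.
  replace (p3 + (s3 - p3)) with s3 in E by ring.
  rewrite E. specialize (Hseg c Hc).
  specialize (B1 _ _ _ Hseg). specialize (B2 _ _ _ Hseg). specialize (B3 _ _ _ Hseg).
  unfold l1. eapply Rle_trans; [apply Rabs_triang|].
  eapply Rle_trans; [apply Rplus_le_compat_r, Rabs_triang|]. rewrite !Rabs_mult.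
  pose proof (Rabs_pos (s1 - p1)). pose proof (Rabs_pos (s2 - p2)). pose proof (Rabs_pos (s3 - p3)).
  nra.
Qed.

Lemma ev_pos_near r f : 0 < r -> cls r f -> 0 < f O O O ->
  exists eta, 0 < eta /\ forall p1 p2 p3, l1 p1 p2 p3 < eta -> 0 < ev f p1 p2 p3.
Proof.
  intros Hr Hf H0.
  assert (Hq : 0 < / (2 * r)) by (apply Rinv_0_lt_compat; lra).
  destruct (ev_lipschitz r (/ (2 * r)) f) as (K & HK & HL); auto; try lra.
  { replace (r * / (2 * r)) with (/ 2) by (field; lra). lra. }
  assert (He : 0 < f O O O / (K + 1)) by (apply Rdiv_lt_0_compat; lra).
  exists (Rmin (/ (2 * r)) (f O O O / (K + 1))). split; [now apply Rmin_pos|].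
  intros p1 p2 p3 Hp.
  assert (Hp1 : l1 p1 p2 p3 < / (2 * r)) by (eapply Rlt_le_trans; [exact Hp|apply Rmin_l]).
  assert (Hp2 : l1 p1 p2 p3 < f O O O / (K + 1)) by (eapply Rlt_le_trans; [exact Hp|apply Rmin_r]).
  assert (H : Rabs (ev f p1 p2 p3 - ev f 0 0 0) <= K * l1 p1 p2 p3).
  { rewrite <- (Rminus_0_r p1), <- (Rminus_0_r p2), <- (Rminus_0_r p3) at 2.
    apply HL; [unfold l1; rewrite Rabs_R0; lra|lra]. }
  rewrite ev_0 in H. apply Rlt_div_r in Hp2; [|lra].
  pose proof (l1_pos p1 p2 p3). apply Rabs_le_between in H. nra.
Qed.

Definition cube (a b d : R) (t x1 x2 : R) : Prop := Rabs t < d /\ square a b d x1 x2.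

(* [F] is expanded in the variables (x2 - b, x1 - a, t), in this order. *)
Definition rep (r a b d : R) (f : stfield) (F : fps) : Prop :=
  cls r F /\ forall t x1 x2, cube a b d t x1 x2 -> f t x1 x2 = ev F (x2 - b) (x1 - a) t.

Definition admissible (r d : R) : Prop := 0 <= r /\ 0 < d /\ r * (3 * d) < 1.

Lemma cube_l1 a b d t x1 x2 : cube a b d t x1 x2 -> l1 (x2 - b) (x1 - a) t < 3 * d.
Proof. unfold cube, square, l1. lra. Qed.

Lemma cube_dom r a b d t x1 x2 : admissible r d -> cube a b d t x1 x2 ->
  r * l1 (x2 - b) (x1 - a) t < 1.
Proof.
  intros (Hr & Hd & H) Hc. eapply Rle_lt_trans; [|exact H].
  apply Rmult_le_compat_l; auto. now apply Rlt_le, cube_l1.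
Qed.

Lemma rep_const r a b d c : admissible r d -> rep r a b d (fun _ _ _ => c) (fconst c).
Proof.
  intros (Hr & _); split; [now apply cls_const|]. intros; now rewrite ev_const.
Qed.

Lemma rep_add r a b d f g F G : admissible r d -> rep r a b d f F -> rep r a b d g G ->
  rep r a b d (fun t x1 x2 => f t x1 x2 + g t x1 x2) (F + G)%fps.
Proof.
  intros A [HF Hf] [HG Hg]. pose proof A as (Hr & _). split; [now apply cls_add|].
  intros t x1 x2 H. rewrite Hf, Hg, (ev_add r) by first [assumption | exact (cube_dom r a b d t x1 x2 A H)].
  reflexivity.
Qed.

Lemma rep_opp r a b d f F : rep r a b d f F ->
  rep r a b d (fun t x1 x2 => - f t x1 x2) (- F)%fps.
Proof.
  intros [HF Hf]. split; [now apply cls_opp|].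
  intros t x1 x2 H. now rewrite Hf, ev_opp by auto.
Qed.

Lemma rep_sub r a b d f g F G : admissible r d -> rep r a b d f F -> rep r a b d g G ->
  rep r a b d (fun t x1 x2 => f t x1 x2 - g t x1 x2) (F - G)%fps.
Proof. intros A Hf Hg. apply rep_add; auto. now apply rep_opp. Qed.

Lemma rep_mul r a b d f g F G : admissible r d -> rep r a b d f F -> rep r a b d g G ->
  rep r a b d (fun t x1 x2 => f t x1 x2 * g t x1 x2) (F * G)%fps.
Proof.
  intros A [HF Hf] [HG Hg]. pose proof A as (Hr & _). split; [now apply cls_mul|].
  intros t x1 x2 H. rewrite Hf, Hg, (ev_mul r) by first [assumption | exact (cube_dom r a b d t x1 x2 A H)].
  reflexivity.
Qed.

Lemma rep_pow2 r a b d f F : admissible r d -> rep r a b d f F ->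
  rep r a b d (fun t x1 x2 => f t x1 x2 ^ 2) (F * F)%fps.
Proof.
  intros A Hf. destruct (rep_mul r a b d f f F F A Hf Hf) as [H1 H2]. split; auto.
  intros t x1 x2 H. rewrite <- H2 by auto. ring.
Qed.

Lemma locally_abs (c d x : R) : Rabs (x - c) < d -> locally x (fun z => Rabs (z - c) < d).
Proof.
  intros H. assert (He : 0 < d - Rabs (x - c)) by lra.
  exists (mkposreal _ He). intros z Hz.
  change (Rabs (z - x) < d - Rabs (x - c)) in Hz.
  replace (z - c) with ((z - x) + (x - c)) by ring.
  eapply Rle_lt_trans; [apply Rabs_triang|]. lra.
Qed.

Lemma is_derive_near (f g : R -> R) (x l : R) :
  locally x (fun z => f z = g z) -> is_derive f x l -> is_derive g x l.
Proof. apply is_derive_ext_loc. Qed.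

Lemma rep_is_derive r a b d f F t x1 x2 : admissible r d -> rep r a b d f F ->
  cube a b d t x1 x2 ->
  is_derive (fun s => f s x1 x2) t (ev (d3 F) (x2 - b) (x1 - a) t) /\
  is_derive (fun z => f t z x2) x1 (ev (d2 F) (x2 - b) (x1 - a) t) /\
  is_derive (fun z => f t x1 z) x2 (ev (d1 F) (x2 - b) (x1 - a) t).
Proof.
  intros A [HF Hf] Hc. pose proof A as (Hr & _). pose proof (cube_dom r a b d t x1 x2 A Hc) as Hdom.
  destruct Hc as (Ht & H1 & H2). split; [|split].
  - apply (is_derive_near (fun z => ev F (x2 - b) (x1 - a) z)).
    { rewrite <- (Rminus_0_r t) in Ht. refine (filter_imp _ _ _ (locally_abs 0 d t Ht)).
      intros z Hz. rewrite Rminus_0_r in Hz. symmetry. apply Hf. split; [|split]; assumption. }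
    pose proof (ev_is_derive r F (x2 - b) (x1 - a) 0 0 0 1 t Hr HF) as D.
    rewrite !Rmult_0_r, !Rplus_0_r, Rmult_1_r, Rplus_0_l in D. specialize (D Hdom).
    rewrite !Rmult_0_l, !Rplus_0_l, Rmult_1_l in D.
    eapply is_derive_ext; [|exact D]. intros z; cbv beta. f_equal; ring.
  - apply (is_derive_near (fun z => ev F (x2 - b) (z - a) t)).
    { refine (filter_imp _ _ _ (locally_abs a d x1 H1)).
      intros z Hz. symmetry. apply Hf. split; [|split]; assumption. }
    pose proof (ev_is_derive r F (x2 - b) (- a) t 0 1 0 x1 Hr HF) as D.
    rewrite !Rmult_0_r, !Rplus_0_r, Rmult_1_r, (Rplus_comm (- a)) in D. specialize (D Hdom).
    rewrite !Rmult_0_l, !Rplus_0_l, !Rplus_0_r, Rmult_1_l in D.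
    eapply is_derive_ext; [|exact D]. intros z; cbv beta. f_equal; ring.
  - apply (is_derive_near (fun z => ev F (z - b) (x1 - a) t)).
    { refine (filter_imp _ _ _ (locally_abs b d x2 H2)).
      intros z Hz. symmetry. apply Hf. split; [|split]; assumption. }
    pose proof (ev_is_derive r F (- b) (x1 - a) t 1 0 0 x2 Hr HF) as D.
    rewrite !Rmult_0_r, !Rplus_0_r, Rmult_1_r, (Rplus_comm (- b)) in D. specialize (D Hdom).
    rewrite !Rmult_0_l, !Rplus_0_r, Rmult_1_l in D.
    eapply is_derive_ext; [|exact D]. intros z; cbv beta. f_equal; ring.
Qed.

Lemma rep_dt r a b d f F : admissible r d -> rep r a b d f F ->
  rep r a b d (fun t x1 x2 => dt (fun s z1 z2 => f s z1 z2) t x1 x2) (d3 F).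
Proof.
  intros A Hf; split; [apply cls_d3; [apply A|apply Hf]|].
  intros t x1 x2 H. apply is_derive_unique. apply (rep_is_derive r a b d f F t x1 x2 A Hf H).
Qed.

Lemma rep_dx1 r a b d f F : admissible r d -> rep r a b d f F ->
  rep r a b d (fun t x1 x2 => partial i1 (fun z1 z2 => f t z1 z2) x1 x2) (d2 F).
Proof.
  intros A Hf; split; [apply cls_d2; [apply A|apply Hf]|].
  intros t x1 x2 H. apply is_derive_unique. apply (rep_is_derive r a b d f F t x1 x2 A Hf H).
Qed.

Lemma rep_dx2 r a b d f F : admissible r d -> rep r a b d f F ->
  rep r a b d (fun t x1 x2 => partial i2 (fun z1 z2 => f t z1 z2) x1 x2) (d1 F).
Proof.
  intros A Hf; split; [apply cls_d1; [apply A|apply Hf]|].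
  intros t x1 x2 H. apply is_derive_unique. apply (rep_is_derive r a b d f F t x1 x2 A Hf H).
Qed.

Lemma rep_lipschitz r a b d f F : admissible r d -> rep r a b d f F ->
  exists K, 0 <= K /\ forall t x1 x2 t' x1' x2', cube a b d t x1 x2 -> cube a b d t' x1' x2' ->
    Rabs (f t' x1' x2' - f t x1 x2) <= K * (Rabs (t' - t) + Rabs (x1' - x1) + Rabs (x2' - x2)).
Proof.
  intros (Hr & Hd & H) [HF Hf].
  destruct (ev_lipschitz r (3 * d) F Hr ltac:(lra) H HF) as (K & HK & HL).
  exists K; split; auto. intros t x1 x2 t' x1' x2' Hc Hc'. rewrite !Hf by auto.
  eapply Rle_trans; [apply HL; eapply Rlt_le, cube_l1; eauto|]. unfold l1.
  replace (x2' - b - (x2 - b)) with (x2' - x2) by ring.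
  replace (x1' - a - (x1 - a)) with (x1' - x1) by ring. apply Req_le; ring.
Qed.

Lemma rep_continuous r a b d f F t x1 x2 : admissible r d -> rep r a b d f F ->
  cube a b d t x1 x2 -> forall eps : posreal, exists del : posreal, forall t' x1' x2',
    Rabs (t' - t) < del -> Rabs (x1' - x1) < del -> Rabs (x2' - x2) < del ->
    Rabs (f t' x1' x2' - f t x1 x2) < eps.
Proof.
  intros A Hf Hc eps. destruct (rep_lipschitz r a b d f F A Hf) as (K & HK & HL).
  pose proof Hc as (Ht & H1 & H2).
  set (m := Rmin (d - Rabs t) (Rmin (d - Rabs (x1 - a)) (d - Rabs (x2 - b)))).
  assert (Hm : 0 < m) by (unfold m; repeat apply Rmin_pos; lra).
  assert (Hm' : m <= d - Rabs t /\ m <= d - Rabs (x1 - a) /\ m <= d - Rabs (x2 - b)).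
  { unfold m; repeat split; [apply Rmin_l|eapply Rle_trans; [apply Rmin_r|apply Rmin_l]|
     eapply Rle_trans; [apply Rmin_r|apply Rmin_r]]. }
  clearbody m.
  assert (He : 0 < eps / (3 * (K + 1))) by (apply Rdiv_lt_0_compat; [apply cond_pos|lra]).
  assert (Hdel : 0 < Rmin m (eps / (3 * (K + 1)))) by now apply Rmin_pos.
  exists (mkposreal _ Hdel). simpl. intros t' x1' x2' Ht' H1' H2'.
  pose proof (Rmin_l m (eps / (3 * (K + 1)))). pose proof (Rmin_r m (eps / (3 * (K + 1)))).
  assert (T : forall c x x' M, Rabs (x' - x) < M -> M <= d - Rabs (x - c) -> Rabs (x' - c) < d).
  { intros c x x' M E1 E2. replace (x' - c) with ((x' - x) + (x - c)) by ring.
    eapply Rle_lt_trans; [apply Rabs_triang|]. lra. }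
  assert (Hc' : cube a b d t' x1' x2').
  { split; [|split].
    - rewrite <- (Rminus_0_r t'). apply (T 0 t t' m); [lra|rewrite Rminus_0_r; lra].
    - apply (T a x1 x1' m); lra.
    - apply (T b x2 x2' m); lra. }
  eapply Rle_lt_trans; [apply HL; auto|].
  set (e := eps / (3 * (K + 1))) in *.
  assert (Ee : (pos eps) = (K + 1) * (3 * e)) by (unfold e; field; lra). rewrite Ee.
  pose proof (Rabs_pos (t' - t)). nra.
Qed.

Lemma rep_smooth r a b d f F : admissible r d -> rep r a b d f F ->
  smooth_st (fun t x1 x2 => Rabs t < d /\ square a b d x1 x2) f.
Proof.
  intros A Hf n. revert f F Hf. induction n; intros f F Hf.
  - intros t x1 x2 Hc. apply filterlim_locally. intros eps.
    destruct (rep_continuous r a b d f F t x1 x2 A Hf Hc eps) as [del Hdel].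
    exists del. intros [[t' x1'] x2'] [[Ht H1] H2]. apply Hdel; assumption.
  - split; [|split].
    + intros t x1 x2 Hc.
      destruct (rep_is_derive r a b d f F t x1 x2 A Hf Hc) as (D3 & D2 & D1).
      split; [eexists; apply D3|]. intros []; eexists; [apply D2|apply D1].
    + apply (IHn _ (d3 F)). exact (rep_dt r a b d f F A Hf).
    + intros []; [apply (IHn _ (d2 F)); exact (rep_dx1 r a b d f F A Hf)
                 |apply (IHn _ (d1 F)); exact (rep_dx2 r a b d f F A Hf)].
Qed.

Lemma rep_slice_smooth r a b d f F t (D : R -> R -> Prop) : admissible r d -> rep r a b d f F ->
  Rabs t < d -> (forall x1 x2, D x1 x2 -> square a b d x1 x2) -> smooth_plane D (f t).
Proof.
  intros A Hf Ht HD n. revert f F Hf. induction n; intros f F Hf.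
  - intros x1 x2 Hx. apply filterlim_locally. intros eps.
    destruct (rep_continuous r a b d f F t x1 x2 A Hf (conj Ht (HD _ _ Hx)) eps) as [del Hdel].
    exists del. intros [x1' x2'] [H1 H2].
    apply Hdel; [rewrite Rminus_diag, Rabs_R0; apply cond_pos|assumption|assumption].
  - split.
    + intros x1 x2 Hx.
      destruct (rep_is_derive r a b d f F t x1 x2 A Hf (conj Ht (HD _ _ Hx))) as (_ & D2 & D1).
      intros []; eexists; [apply D2|apply D1].
    + intros []; [apply (IHn (dx i1 f) (d2 F)); exact (rep_dx1 r a b d f F A Hf)
                 |apply (IHn (dx i2 f) (d1 F)); exact (rep_dx2 r a b d f F A Hf)].
Qed.

Lemma fact_mul_le j l : (fact j * fact l <= fact (j + l))%nat.
Proof.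
  induction j; simpl; [lia|]. nia.
Qed.

Lemma hom_plane (h k : R) n : forall f,
  hom n 0 h k f / INR (fact n) =
  sum_f_R0 (fun m => f O m (n - m)%nat / (INR (fact m) * INR (fact (n - m))) * h ^ m * k ^ (n - m)) n.
Proof.
  induction n; intros f; [simpl; field|].
  apply Rmult_eq_reg_l with (INR (S n)); [|apply not_0_INR; lia].
  transitivity (h * (hom n 0 h k (d2 f) / INR (fact n)) + k * (hom n 0 h k (d3 f) / INR (fact n))).
  { rewrite fact_simpl, mult_INR. simpl hom. field.
    split; first [apply INR_fact_neq_0|apply not_0_INR; lia]. }
  rewrite !IHn, !scal_sum.
  rewrite (sum_eq _ (fun l =>
     INR l * (f O l (S n - l)%nat / (INR (fact l) * INR (fact (S n - l))) * h ^ l * k ^ (S n - l))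
     + INR (S n - l) * (f O l (S n - l)%nat / (INR (fact l) * INR (fact (S n - l))) * h ^ l * k ^ (S n - l))) (S n)).
  2:{ intros l Hl. rewrite minus_INR by lia. ring. }
  rewrite sum_plus. f_equal.
  - rewrite (decomp_sum _ (S n)) by lia. simpl Nat.pred. simpl (INR 0).
    rewrite Rmult_0_l, Rplus_0_l.
    apply sum_eq; intros l Hl. unfold d2. rewrite fact_simpl, mult_INR.
    rewrite Nat.sub_succ. simpl pow. field.
    repeat split; first [apply INR_fact_neq_0|apply not_0_INR; lia].
  - rewrite tech5, Nat.sub_diag. simpl (INR 0). rewrite (Rmult_0_l (f _ _ _ / _ * _ * _)), Rplus_0_r.
    apply sum_eq; intros l Hl. unfold d3. replace (S n - l)%nat with (S (n - l)) by lia.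
    rewrite fact_simpl, mult_INR. simpl pow. field.
    repeat split; first [apply INR_fact_neq_0|apply not_0_INR; lia].
Qed.

Lemma sum_f_R0_term (u : nat -> R) n m : (forall k, 0 <= u k) -> (m <= n)%nat -> u m <= sum_f_R0 u n.
Proof.
  intros H Hm. induction n.
  - replace m with O by lia. apply Rle_refl.
  - rewrite tech5. destruct (Nat.eq_dec m (S n)) as [->|].
    + pose proof (cond_pos_sum u n H). lra.
    + specialize (H (S n)). specialize (IHn ltac:(lia)). lra.
Qed.

Lemma analytic_fps f a b : analytic_at f a b ->
  exists r s F, 1 <= r /\ 0 < s /\ cls r F /\
   forall h k, Rabs h < s -> Rabs k < s -> ev F 0 h k = f (a + h) (b + k).
Proof.
  intros (c & s & Hs & H).
  set (F := (fun _ j k => c j k * (INR (fact j) * INR (fact k))) : fps).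
  destruct (H (s / 2) (s / 2)) as [E _]; try (rewrite Rabs_pos_eq; lra).
  set (T := fun n => sum_n (fun m => Rabs (c m (n - m)%nat * (s / 2) ^ m * (s / 2) ^ (n - m))) n) in *.
  set (S0 := Series T).
  assert (HT : forall n, 0 <= T n).
  { intros n. unfold T. rewrite sum_n_Reals. apply cond_pos_sum. intros; apply Rabs_pos. }
  assert (HS : forall j k, Rabs (c j k) * (s / 2) ^ (j + k) <= S0).
  { intros j k. apply Rle_trans with (T (j + k)%nat); [|now apply term_le_Series].
    unfold T. rewrite sum_n_Reals.
    apply Rle_trans with (Rabs (c j (j + k - j)%nat * (s / 2) ^ j * (s / 2) ^ (j + k - j))).
    - replace (j + k - j)%nat with k by lia. rewrite !Rabs_mult, !(Rabs_pos_eq (_ ^ _)) by (apply pow_le; lra).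
      rewrite pow_add. apply Req_le; ring.
    - apply (sum_f_R0_term (fun m => Rabs (c m (j + k - m)%nat * (s / 2) ^ m * (s / 2) ^ (j + k - m)))); [|lia].
      intros; apply Rabs_pos. }
  assert (HS0 : 0 <= S0).
  { eapply Rle_trans; [|apply (HS O O)]. apply Rmult_le_pos; [apply Rabs_pos|apply pow_le; lra]. }
  exists (Rmax 1 (2 / s)), s, F. split; [apply Rmax_l|]. split; [auto|]. split.
  - exists S0, O. split; auto. intros i j k. rewrite Nat.add_0_r. unfold F.
    assert (Hjk : Rabs (c j k) <= S0 * (2 / s) ^ (j + k)).
    { replace (2 / s) with (/ (s / 2)) by (field; lra). rewrite pow_inv.
      apply (Rle_div_r (Rabs (c j k)) S0); [apply pow_lt; lra|apply HS]. }
    rewrite Rabs_mult, <- mult_INR, (Rabs_pos_eq (INR _)) by apply pos_INR.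
    apply Rmult_le_compat; [apply Rabs_pos|apply pos_INR| |].
    + eapply Rle_trans; [exact Hjk|]. apply Rmult_le_compat_l; auto.
      assert (0 < 2 / s) by (apply Rdiv_lt_0_compat; lra).
      apply Rle_trans with (Rmax 1 (2 / s) ^ (j + k)).
      * apply pow_incr. split; [lra|apply Rmax_r].
      * apply Rle_pow; [apply Rmax_l|lia].
    + apply le_INR. eapply Nat.le_trans; [apply fact_mul_le|]. apply fact_le. lia.
  - intros h k Hh Hk. destruct (H h k Hh Hk) as [_ HF].
    rewrite <- (is_series_unique _ _ HF). apply Series_ext. intros n.
    rewrite hom_plane, sum_n_Reals. apply sum_eq. intros m Hm. unfold F. field.
    split; apply INR_fact_neq_0.
Qed.

Lemma power_ode (f f' h h' : R -> R) (gamma c : R) :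
  (forall z, 0 <= z <= 1 -> is_derive f z (f' z) /\ is_derive h z (h' z) /\ 0 < f z /\
     h' z * f z = gamma * h z * f' z) ->
  h 0 = c * Rpower (f 0) gamma -> h 1 = c * Rpower (f 1) gamma.
Proof.
  intros H H0. set (G := fun z => h z * exp (- (gamma * ln (f z)))).
  assert (HG : forall z, 0 <= z <= 1 -> is_derive G z 0).
  { intros z Hz. destruct (H z Hz) as (Df & Dh & Hf & E). unfold G. evar_last.
    - apply (is_derive_mult h (fun z => exp (- (gamma * ln (f z)))) z (h' z)
        ((- (gamma * (f' z * / f z))) * exp (- (gamma * ln (f z))))); [exact Dh| |intros; apply Rmult_comm].
      apply (is_derive_comp exp (fun z => - (gamma * ln (f z)))); [apply is_derive_exp|].
      apply (is_derive_opp (fun z => gamma * ln (f z))). apply is_derive_scal.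
      apply (is_derive_comp ln f); [now apply is_derive_ln|exact Df].
    - change (h' z * exp (- (gamma * ln (f z))) +
        h z * (- (gamma * (f' z * / f z)) * exp (- (gamma * ln (f z)))) = 0).
      replace (h' z) with (gamma * h z * f' z / f z) by (rewrite <- E; field; lra).
      field; lra. }
  assert (E : G 1 = G 0).
  { destruct (MVT_gen G 0 1 (fun _ => 0)) as (c' & _ & E).
    - intros z Hz. rewrite Rmin_left, Rmax_right in Hz by lra. apply HG; lra.
    - intros z Hz. rewrite Rmin_left, Rmax_right in Hz by lra.
      apply derivable_continuous_pt, ex_derive_Reals_0. eexists; apply HG; lra.
    - lra. }
  unfold G in E. rewrite H0 in E. unfold Rpower in *.
  rewrite (Rmult_assoc c), <- exp_plus, Rplus_opp_r, exp_0, Rmult_1_r in E.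
  rewrite <- E, Rmult_assoc, <- exp_plus, Rplus_opp_l, exp_0. ring.
Qed.

Lemma power_line r eta gamma c rho p a1 a2 a3 b1 b2 b3 :
  0 <= r -> r * eta <= 1 -> cls r rho -> cls r p ->
  (forall p1 p2 p3, l1 p1 p2 p3 < eta -> 0 < ev rho p1 p2 p3) ->
  (forall s, 0 <= s <= 1 -> l1 (a1 + s * b1) (a2 + s * b2) (a3 + s * b3) < eta) ->
  (forall s, 0 <= s <= 1 ->
    let E := fun f => ev f (a1 + s * b1) (a2 + s * b2) (a3 + s * b3) in
    (b1 * E (d1 p) + b2 * E (d2 p) + b3 * E (d3 p)) * E rho
    = gamma * E p * (b1 * E (d1 rho) + b2 * E (d2 rho) + b3 * E (d3 rho))) ->
  ev p a1 a2 a3 = c * Rpower (ev rho a1 a2 a3) gamma ->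
  ev p (a1 + b1) (a2 + b2) (a3 + b3) = c * Rpower (ev rho (a1 + b1) (a2 + b2) (a3 + b3)) gamma.
Proof.
  intros Hr Hre Hrho Hp Hpos Hseg Hode H0.
  rewrite <- (Rmult_1_l b1), <- (Rmult_1_l b2), <- (Rmult_1_l b3).
  assert (Hdom : forall s, 0 <= s <= 1 -> r * l1 (a1 + s * b1) (a2 + s * b2) (a3 + s * b3) < 1).
  { intros s Hs. specialize (Hseg s Hs). pose proof (l1_pos (a1 + s * b1) (a2 + s * b2) (a3 + s * b3)).
    destruct (Req_dec r 0) as [->|]; [lra|]. nra. }
  apply (power_ode (fun s => ev rho (a1 + s * b1) (a2 + s * b2) (a3 + s * b3))
    (fun s => b1 * ev (d1 rho) (a1 + s * b1) (a2 + s * b2) (a3 + s * b3)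
     + b2 * ev (d2 rho) (a1 + s * b1) (a2 + s * b2) (a3 + s * b3)
     + b3 * ev (d3 rho) (a1 + s * b1) (a2 + s * b2) (a3 + s * b3))
    (fun s => ev p (a1 + s * b1) (a2 + s * b2) (a3 + s * b3))
    (fun s => b1 * ev (d1 p) (a1 + s * b1) (a2 + s * b2) (a3 + s * b3)
     + b2 * ev (d2 p) (a1 + s * b1) (a2 + s * b2) (a3 + s * b3)
     + b3 * ev (d3 p) (a1 + s * b1) (a2 + s * b2) (a3 + s * b3)) gamma c).
  - intros s Hs. split; [|split; [|split]].
    + apply (ev_is_derive r); auto.
    + apply (ev_is_derive r); auto.
    + auto.
    + apply (Hode s Hs).
  - rewrite !Rmult_0_l, !Rplus_0_r. exact H0.
Qed.

Lemma pressure_law r eta gamma c rho sig p :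
  0 <= r -> r * eta <= 1 -> cls r rho -> cls r sig -> cls r p ->
  (forall p1 p2 p3, l1 p1 p2 p3 < eta -> 0 < ev rho p1 p2 p3) ->
  (rho * sig = 1)%fps ->
  p O O O = c * Rpower (rho O O O) gamma ->
  d1 p = (fconst gamma * p * sig * d1 rho)%fps ->
  (forall j k, d2 p O j k = (fconst gamma * p * sig * d2 rho)%fps O j k) ->
  (forall k, d3 p O O k = (fconst gamma * p * sig * d3 rho)%fps O O k) ->
  forall p1 p2 p3, l1 p1 p2 p3 < eta ->
    ev p p1 p2 p3 = c * Rpower (ev rho p1 p2 p3) gamma.
Proof.
  intros Hr Hre Hrho Hsig Hp Hpos Hinv H0 H1 H2 H3 p1 p2 p3 Hl.
  assert (Hdom : forall p1 p2 p3, l1 p1 p2 p3 < eta -> r * l1 p1 p2 p3 < 1).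
  { intros q1 q2 q3 Hq. pose proof (l1_pos q1 q2 q3).
    destruct (Req_dec r 0) as [->|]; [lra|]. nra. }
  assert (Hrel : forall dp drho q1 q2 q3, l1 q1 q2 q3 < eta -> cls r drho ->
    ev dp q1 q2 q3 = ev (fconst gamma * p * sig * drho)%fps q1 q2 q3 ->
    ev dp q1 q2 q3 * ev rho q1 q2 q3 = gamma * ev p q1 q2 q3 * ev drho q1 q2 q3).
  { intros dp drho q1 q2 q3 Hq Hd ->. specialize (Hdom _ _ _ Hq).
    assert (Hg : cls r (fconst gamma)) by now apply cls_const.
    assert (Hgp : cls r (fconst gamma * p)%fps) by now apply cls_mul.
    assert (Hgps : cls r (fconst gamma * p * sig)%fps) by now apply cls_mul.
    rewrite !(ev_mul r) by assumption. rewrite ev_const.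
    assert (E : ev rho q1 q2 q3 * ev sig q1 q2 q3 = 1).
    { rewrite <- (ev_mul r), Hinv, ev_const by assumption. reflexivity. }
    transitivity (gamma * ev p q1 q2 q3 * ev drho q1 q2 q3 * (ev rho q1 q2 q3 * ev sig q1 q2 q3));
    [ring|rewrite E; ring]. }
  assert (Hle : forall s x, 0 <= s <= 1 -> Rabs (0 + s * x) <= Rabs x).
  { intros s x Hs. rewrite Rplus_0_l, Rabs_mult, (Rabs_pos_eq s) by lra.
    pose proof (Rabs_pos x). nra. }
  assert (S3 : ev p 0 0 p3 = c * Rpower (ev rho 0 0 p3) gamma).
  { rewrite <- (Rplus_0_l p3). rewrite <- (Rplus_0_l 0) at 1 2 4 5.
    apply (power_line r eta); auto.
    - intros s Hs. unfold l1 in *. rewrite Rmult_0_r, Rplus_0_r, Rabs_R0.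
      specialize (Hle s p3 Hs). pose proof (Rabs_pos p1). pose proof (Rabs_pos p2). lra.
    - intros s Hs E. unfold E. rewrite !Rmult_0_r, !Rplus_0_r, !Rmult_0_l, !Rplus_0_l.
      rewrite Rmult_assoc, (Hrel (d3 p) (d3 rho)); [ring| |now apply cls_d3|now apply ev_axis].
      unfold l1 in *. rewrite Rabs_R0. specialize (Hle s p3 Hs). rewrite Rplus_0_l in Hle.
      pose proof (Rabs_pos p1). pose proof (Rabs_pos p2). lra.
    - rewrite !ev_0. exact H0. }
  assert (S2 : ev p 0 p2 p3 = c * Rpower (ev rho 0 p2 p3) gamma).
  { rewrite <- (Rplus_0_l p2). rewrite <- (Rplus_0_r p3). rewrite <- (Rplus_0_l 0) at 1 4.
    apply (power_line r eta); auto.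
    - intros s Hs. unfold l1 in *. rewrite !Rmult_0_r, !Rplus_0_r, Rabs_R0.
      specialize (Hle s p2 Hs). pose proof (Rabs_pos p1). lra.
    - intros s Hs E. unfold E. rewrite !Rmult_0_r, !Rplus_0_r, !Rmult_0_l, !Rplus_0_l, !Rplus_0_r.
      rewrite Rmult_assoc, (Hrel (d2 p) (d2 rho)); [ring| |now apply cls_d2|now apply ev_plane].
      unfold l1 in *. rewrite Rabs_R0. specialize (Hle s p2 Hs). rewrite Rplus_0_l in Hle.
      pose proof (Rabs_pos p1). lra. }
  rewrite <- (Rplus_0_l p1), <- (Rplus_0_r p2), <- (Rplus_0_r p3).
  apply (power_line r eta); auto.
  - intros s Hs. unfold l1 in *. rewrite !Rmult_0_r, !Rplus_0_r.
    specialize (Hle s p1 Hs). lra.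
  - intros s Hs E. unfold E. rewrite !Rmult_0_r, !Rplus_0_r, !Rmult_0_l, !Rplus_0_l, !Rplus_0_r.
    rewrite Rmult_assoc, (Hrel (d1 p) (d1 rho)); [ring| |now apply cls_d1|now rewrite <- H1].
    unfold l1 in *. specialize (Hle s p1 Hs). rewrite Rplus_0_l in Hle. lra.
Qed.

(* [gam A B C D P Q k i j] is the symbol with upper index [k] and lower indices [i], [j]. *)
Definition gam {T : Type} (A B C D P Q : T) (k i j : index) : T :=
  match k, i, j with
  | i1, i1, i1 => A | i1, i2, i2 => P | i1, _, _ => B
  | i2, i1, i1 => C | i2, i2, i2 => Q | i2, _, _ => D
  end.

Lemma christoffel_unique (g : metric) x1 x2 (A B C D P Q : R) :
  g i2 i1 = g i1 i2 -> detg g x1 x2 <> 0 ->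
  let g11 := g i1 i1 x1 x2 in let g12 := g i1 i2 x1 x2 in let g22 := g i2 i2 x1 x2 in
  partial i1 (g i1 i1) x1 x2 = 2 * (A * g11 + C * g12) ->
  partial i1 (g i1 i2) x1 x2 = A * g12 + C * g22 + B * g11 + D * g12 ->
  partial i1 (g i2 i2) x1 x2 = 2 * (B * g12 + D * g22) ->
  partial i2 (g i1 i1) x1 x2 = 2 * (B * g11 + D * g12) ->
  partial i2 (g i1 i2) x1 x2 = B * g12 + D * g22 + P * g11 + Q * g12 ->
  partial i2 (g i2 i2) x1 x2 = 2 * (P * g12 + Q * g22) ->
  forall k i j, christoffel g k i j x1 x2 = gam A B C D P Q k i j.
Proof.
  intros Hsym Hdet g11 g12 g22 H1 H2 H3 H4 H5 H6 k i j.
  unfold christoffel, sum2, ginv.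
  destruct k, i, j; simpl gam; rewrite ?Hsym, ?H1, ?H2, ?H3, ?H4, ?H5, ?H6;
    unfold detg in *; rewrite ?Hsym in *; fold g11 g12 g22 in Hdet |- *; field; exact Hdet.
Qed.

Lemma riemannian_of_minors (g : metric) x1 x2 : g i2 i1 = g i1 i2 ->
  0 < g i1 i1 x1 x2 -> 0 < detg g x1 x2 -> riemannian g x1 x2.
Proof.
  intros Hsym H1 Hd. split.
  - intros [] []; auto; now rewrite Hsym.
  - intros c Hc. unfold sum2, detg in *. rewrite Hsym in *.
    set (g11 := g i1 i1 x1 x2) in *. set (g12 := g i1 i2 x1 x2) in *. set (g22 := g i2 i2 x1 x2) in *.
    set (u := c i1) in *. set (v := c i2) in *.
    apply Rmult_lt_reg_l with g11; auto. rewrite Rmult_0_r.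
    replace (g11 * (g11 * u * u + g12 * u * v + (g12 * v * u + g22 * v * v))) with
      ((g11 * u + g12 * v) ^ 2 + (g11 * g22 - g12 * g12) * v ^ 2) by ring.
    pose proof (pow2_ge_0 (g11 * u + g12 * v)).
    destruct (Req_dec v 0) as [Hv|Hv].
    + assert (Hu : u <> 0) by (destruct Hc as [[] Hc]; [exact Hc|now elim Hc]).
      rewrite Hv, Rmult_0_r, Rplus_0_r. rewrite pow_ne_zero, Rmult_0_r, Rplus_0_r by discriminate.
      apply pow2_gt_0. apply Rmult_integral_contrapositive; lra.
    + assert (0 < v ^ 2) by now apply pow2_gt_0. nra.
Qed.

Lemma lagrange_identity (X Y : ambient -> R) :
  dot (cross X Y) (cross X Y) = dot X X * dot Y Y - dot X Y * dot X Y.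
Proof. unfold dot, sum3, cross; ring. Qed.

Lemma normal_component (X Y Z : ambient -> R) (a c l : R) :
  0 < dot (cross X Y) (cross X Y) ->
  (forall e, Z e = a * X e + c * Y e + l * cross X Y e) ->
  dot Z (fun e => cross X Y e / sqrt (dot (cross X Y) (cross X Y)))
    / sqrt (dot X X * dot Y Y - dot X Y * dot X Y) = l.
Proof.
  intros H HZ. rewrite <- lagrange_identity. set (s := sqrt _).
  assert (Hs : 0 < s) by now apply sqrt_lt_R0.
  assert (Hss : s * s = dot (cross X Y) (cross X Y)) by (apply sqrt_sqrt; lra).
  transitivity (l * dot (cross X Y) (cross X Y) / (s * s)).
  - unfold dot at 1, sum3. rewrite !HZ. unfold dot, sum3, cross. field. lra.
  - rewrite <- Hss. field. lra.
Qed.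

Definition primitive (X Y : fps) : fps := fun i j k =>
  match i, j with
  | _, S j => X i j k
  | S i, O => Y i O k
  | O, O => 0
  end.

Lemma primitive_d2 X Y : d2 (primitive X Y) = X.
Proof. apply fps_ext; intros [] j k; reflexivity. Qed.

Lemma primitive_d1 X Y : d1 X = d2 Y -> d1 (primitive X Y) = Y.
Proof.
  intros H. apply fps_ext; intros i [|j] k; [reflexivity|].
  change (d1 X i j k = Y i (S j) k). now rewrite H.
Qed.

Lemma cls_primitive r X Y : 1 <= r -> cls r X -> cls r Y -> cls r (primitive X Y).
Proof.
  intros Hr (C & m & HC & H) (C' & m' & HC' & H').
  exists (C + C'), (max m m'); split; [lra|].
  assert (T : forall n m0 D x, 0 <= D -> D <= C + C' -> (m0 <= max m m')%nat ->
     Rabs x <= D * r ^ n * INR (fact (n + m0)) ->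
     Rabs x <= (C + C') * r ^ (S n) * INR (fact (S n + max m m'))).
  { intros n m0 D x HD HD' Hm Hx. eapply Rle_trans; [exact Hx|].
    assert (0 <= r ^ n) by (apply pow_le; lra).
    apply Rmult_le_compat; [now apply Rmult_le_pos|apply pos_INR| |apply le_INR, fact_le; lia].
    apply Rmult_le_compat; auto. apply Rle_pow; auto. }
  intros i j k. destruct j as [|j]; [destruct i as [|i]|].
  - simpl primitive. rewrite Rabs_R0. apply Rmult_le_pos; [apply Rmult_le_pos; [lra|apply pow_le; lra]|apply pos_INR].
  - change (primitive X Y (S i) O k) with (Y i O k).
    replace (S i + 0 + k)%nat with (S (i + 0 + k)) by lia. apply (T _ m' C'); auto; lra || lia.
  - replace (primitive X Y i (S j) k) with (X i j k) by now destruct i.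
    replace (i + S j + k)%nat with (S (i + j + k)) by lia. apply (T _ m C); auto; lra || lia.
Qed.

(** * Geometry of the induced metric *)

Definition pick2 {T : Type} (x y : T) (i : index) : T := match i with i1 => x | i2 => y end.

Definition induced (X Y : fvec) (i j : index) : fps := fdot (pick2 X Y i) (pick2 X Y j).

Definition induced_metric (a b : R) (X Y : fvec) : R -> metric := fun t i j x1 x2 =>
  ev (induced X Y i j) (x2 - b) (x1 - a) t.

Record frame_equations (L M N A B C D P Q : fps) (X Y : fvec) : Prop := {
  codazzi1 : (L * P = d1 M - d2 N + (B + B) * M - A * N)%fps;
  codazzi2 : (L * Q = d2 M - d1 L + (D + D) * M - C * N)%fps;
  gauss_B : (d1 B = d2 P + P * A + Q * B - B * B - D * P - (L * N - M * M) * fdot Y Y)%fps;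
  gauss_D : (d1 D = d2 Q + P * C - B * D + (L * N - M * M) * fdot X Y)%fps;
  frame_X1 : forall e, d2 (X e) = (A * X e + C * Y e + L * fcross X Y e)%fps;
  frame_Y1 : forall e, d2 (Y e) = (B * X e + D * Y e + M * fcross X Y e)%fps;
  frame_X2 : forall e, d1 (X e) = (B * X e + D * Y e + M * fcross X Y e)%fps;
  frame_Y2 : forall e, d1 (Y e) = (P * X e + Q * Y e + N * fcross X Y e)%fps }.

Ltac rep_tac A :=
  repeat first
  [ match goal with H : rep _ _ _ _ _ _ |- _ => exact H end
  | match goal with H : forall _, rep _ _ _ _ _ _ |- _ => apply H end
  | match goal with H : forall _ _, rep _ _ _ _ _ _ |- _ => apply H end
  | match goal with H : forall _ _ _, rep _ _ _ _ _ _ |- _ => apply H end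
  | eapply (rep_const _ _ _ _ _ A)
  | eapply (rep_pow2 _ _ _ _ _ _ A)
  | eapply (rep_mul _ _ _ _ _ _ _ _ A)
  | eapply (rep_sub _ _ _ _ _ _ _ _ A)
  | eapply (rep_add _ _ _ _ _ _ _ _ A)
  | eapply rep_opp
  | eapply (rep_dt _ _ _ _ _ _ A)
  | eapply (rep_dx1 _ _ _ _ _ _ A)
  | eapply (rep_dx2 _ _ _ _ _ _ A) ].

Lemma rep_eq r a b d f g F G : rep r a b d f F -> rep r a b d g G -> F = G ->
  forall t x1 x2, cube a b d t x1 x2 -> f t x1 x2 = g t x1 x2.
Proof. intros [_ Hf] [_ Hg] <- t x1 x2 H. now rewrite Hf, Hg. Qed.

Lemma rep_ext r a b d f g F : (forall t x1 x2, cube a b d t x1 x2 -> f t x1 x2 = g t x1 x2) ->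
  rep r a b d f F -> rep r a b d g F.
Proof. intros E [HF Hf]. split; auto. intros t x1 x2 H. now rewrite <- E, Hf. Qed.

Lemma rep_ev r a b d F : cls r F -> rep r a b d (fun t x1 x2 => ev F (x2 - b) (x1 - a) t) F.
Proof. now split. Qed.

Section Geometry.
Variables (r a b d : R) (L M N A B C D P Q : fps) (X Y : fvec).
Hypotheses (Had : admissible r d) (Hr1 : 1 <= r)
  (cL : cls r L) (cM : cls r M) (cN : cls r N) (cA : cls r A) (cB : cls r B) (cC : cls r C)
  (cD : cls r D) (cP : cls r P) (cQ : cls r Q)
  (cX : forall e, cls r (X e)) (cY : forall e, cls r (Y e))
  (HF : frame_equations L M N A B C D P Q X Y).

Let g := induced_metric a b X Y.
Let Dt := (fdot X X * fdot Y Y - fdot X Y * fdot X Y)%fps.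

Hypotheses (Hpos1 : forall t x1 x2, cube a b d t x1 x2 -> 0 < ev (fdot X X) (x2 - b) (x1 - a) t)
  (Hpos2 : forall t x1 x2, cube a b d t x1 x2 -> 0 < ev Dt (x2 - b) (x1 - a) t).

Let Hr0 : 0 <= r.
Proof. lra. Qed.

Lemma cls_dot V W : (forall e, cls r (V e)) -> (forall e, cls r (W e)) -> cls r (fdot V W).
Proof. intros HV HW. unfold fdot. repeat apply cls_add; auto; apply cls_mul; auto. Qed.

Lemma metric_rep i j : rep r a b d (fun t => g t i j) (induced X Y i j).
Proof.
  apply (rep_ev r a b d). unfold induced. destruct i, j; now apply cls_dot.
Qed.

Lemma metric_sym t : g t i2 i1 = g t i1 i2.
Proof.
  unfold g, induced_metric. replace (induced X Y i2 i1) with (induced X Y i1 i2); [reflexivity|].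
  unfold induced, fdot; simpl; ring.
Qed.

Lemma detg_rep : rep r a b d (fun t x1 x2 => detg (g t) x1 x2) Dt.
Proof.
  pose proof metric_rep as H.
  replace Dt with (induced X Y i1 i1 * induced X Y i2 i2 - induced X Y i1 i2 * induced X Y i2 i1)%fps.
  - unfold detg. apply rep_sub; auto; apply rep_mul; auto.
  - unfold Dt, induced, fdot; simpl; ring.
Qed.

Lemma detg_pos t x1 x2 : cube a b d t x1 x2 -> 0 < detg (g t) x1 x2.
Proof. intros H. rewrite (proj2 detg_rep t x1 x2 H). auto. Qed.

Lemma metric_riemannian t x1 x2 : cube a b d t x1 x2 -> riemannian (g t) x1 x2.
Proof.
  intros H. apply riemannian_of_minors; [apply metric_sym|now apply Hpos1|now apply detg_pos].
Qed.

Let Gam : index -> index -> index -> fps := gam A B C D P Q.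

Lemma christoffel_rep k i j :
  rep r a b d (fun t x1 x2 => christoffel (g t) k i j x1 x2) (Gam k i j).
Proof.
  assert (RA := rep_ev r a b d A cA). assert (RB := rep_ev r a b d B cB).
  assert (RC := rep_ev r a b d C cC). assert (RD := rep_ev r a b d D cD).
  assert (RP := rep_ev r a b d P cP). assert (RQ := rep_ev r a b d Q cQ).
  assert (R2 := rep_const r a b d 2 Had).
  assert (E2 : forall f, (fconst 2 * f = f + f)%fps).
  { intros f. apply fps_ext; intros. rewrite fmul_const. unfold fadd; ring. }
  assert (Rg := metric_rep).
  assert (c1 : cls r (Gam k i j)) by (destruct k, i, j; assumption).
  apply rep_ext with (fun t x1 x2 => ev (Gam k i j) (x2 - b) (x1 - a) t); [|now apply rep_ev].
  intros t x1 x2 H. symmetry.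
  transitivity (gam (ev A (x2 - b) (x1 - a) t) (ev B (x2 - b) (x1 - a) t) (ev C (x2 - b) (x1 - a) t)
    (ev D (x2 - b) (x1 - a) t) (ev P (x2 - b) (x1 - a) t) (ev Q (x2 - b) (x1 - a) t) k i j);
  [|destruct k, i, j; reflexivity].
  apply christoffel_unique; [apply metric_sym|apply Rgt_not_eq; now apply detg_pos| | | | | |];
  revert t x1 x2 H; (eapply rep_eq; [rep_tac Had|rep_tac Had|]);
  rewrite ?E2; unfold induced, fdot; simpl pick2;
  rewrite ?d1_add, ?d1_mul, ?d2_add, ?d2_mul, ?(frame_X1 _ _ _ _ _ _ _ _ _ _ _ HF), ?(frame_Y1 _ _ _ _ _ _ _ _ _ _ _ HF),
    ?(frame_X2 _ _ _ _ _ _ _ _ _ _ _ HF), ?(frame_Y2 _ _ _ _ _ _ _ _ _ _ _ HF);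
  unfold fcross; ring.
Qed.

Lemma riemann_rep1 : rep r a b d (fun t x1 x2 => riemann (g t) i1 i2 i1 i2 x1 x2)
  ((L * N - M * M) * fdot Y Y)%fps.
Proof.
  pose proof christoffel_rep as H. unfold riemann, sum2.
  match goal with |- rep _ _ _ _ _ ?G => eassert (E : _ = G); [|rewrite <- E; rep_tac Had] end.
  unfold Gam, gam. rewrite (gauss_B _ _ _ _ _ _ _ _ _ _ _ HF). ring.
Qed.

Lemma riemann_rep2 : rep r a b d (fun t x1 x2 => riemann (g t) i2 i2 i1 i2 x1 x2)
  (- ((L * N - M * M) * fdot X Y))%fps.
Proof.
  pose proof christoffel_rep as H. unfold riemann, sum2.
  match goal with |- rep _ _ _ _ _ ?G => eassert (E : _ = G); [|rewrite <- E; rep_tac Had] end.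
  unfold Gam, gam. rewrite (gauss_D _ _ _ _ _ _ _ _ _ _ _ HF). ring.
Qed.

Lemma gauss_rep : rep r a b d (fun t x1 x2 => gauss_curvature (g t) x1 x2) (L * N - M * M)%fps.
Proof.
  assert (ck : cls r (L * N - M * M)%fps) by (apply cls_sub; auto; apply cls_mul; auto).
  apply rep_ext with (fun t x1 x2 => ev (L * N - M * M)%fps (x2 - b) (x1 - a) t); [|now apply rep_ev].
  intros t x1 x2 H. pose proof (detg_pos t x1 x2 H) as Hd.
  unfold gauss_curvature, sum2.
  apply Rmult_eq_reg_r with (detg (g t) x1 x2); [|lra].
  unfold Rdiv. rewrite Rmult_assoc, Rinv_l, Rmult_1_r by lra.
  pose proof metric_rep. pose proof riemann_rep1. pose proof riemann_rep2. pose proof detg_rep.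
  pose proof (rep_ev r a b d _ ck).
  clear Hd. revert t x1 x2 H. eapply rep_eq; [rep_tac Had|rep_tac Had|].
  unfold Dt, induced, pick2, fdot. ring.
Qed.

Lemma geometry_immersed (l m n : stfield) t :
  rep r a b d l L -> rep r a b d m M -> rep r a b d n N -> Rabs t < d ->
  locally_isometrically_immersed (square a b d) (g t) (l t) (m t) (n t).
Proof.
  intros Rl Rm Rn Ht a' b' [Ha Hb].
  set (y := fun (e : ambient) (t x1 x2 : R) => ev (primitive (X e) (Y e)) (x2 - b) (x1 - a) t).
  assert (closed : forall e, d1 (X e) = d2 (Y e)).
  { intros e. now rewrite (frame_X2 _ _ _ _ _ _ _ _ _ _ _ HF), (frame_Y1 _ _ _ _ _ _ _ _ _ _ _ HF). }
  assert (Ry : forall e, rep r a b d (y e) (primitive (X e) (Y e))).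
  { intros e. apply (rep_ev r a b d). now apply cls_primitive. }
  set (rr := Rmin (d - Rabs (a' - a)) (d - Rabs (b' - b))).
  assert (Hrr : 0 < rr) by (unfold rr; apply Rmin_pos; lra).
  assert (Hsub : forall x1 x2, square a' b' rr x1 x2 -> square a b d x1 x2).
  { intros x1 x2 [H1 H2].
    pose proof (Rmin_l (d - Rabs (a' - a)) (d - Rabs (b' - b))).
    pose proof (Rmin_r (d - Rabs (a' - a)) (d - Rabs (b' - b))). fold rr in H, H0.
    split.
    - replace (x1 - a) with ((x1 - a') + (a' - a)) by ring. eapply Rle_lt_trans; [apply Rabs_triang|lra].
    - replace (x2 - b) with ((x2 - b') + (b' - b)) by ring. eapply Rle_lt_trans; [apply Rabs_triang|lra]. }
  set (Xp := fun x1 x2 e => ev (X e) (x2 - b) (x1 - a) t).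
  set (Yp := fun x1 x2 e => ev (Y e) (x2 - b) (x1 - a) t).
  assert (T1 : forall x1 x2 e, square a b d x1 x2 -> partial i1 (y e t) x1 x2 = Xp x1 x2 e).
  { intros x1 x2 e H. pose proof (rep_dx1 r a b d _ _ Had (Ry e)) as [_ E].
    rewrite primitive_d2 in E. exact (E t x1 x2 (conj Ht H)). }
  assert (T2 : forall x1 x2 e, square a b d x1 x2 -> partial i2 (y e t) x1 x2 = Yp x1 x2 e).
  { intros x1 x2 e H. pose proof (rep_dx2 r a b d _ _ Had (Ry e)) as [_ E].
    rewrite primitive_d1 in E by apply closed. exact (E t x1 x2 (conj Ht H)). }
  assert (Tan1 : forall x1 x2, square a b d x1 x2 -> tangent (fun e => y e t) i1 x1 x2 = Xp x1 x2).
  { intros; apply functional_extensionality; intros e; now apply T1. }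
  assert (Tan2 : forall x1 x2, square a b d x1 x2 -> tangent (fun e => y e t) i2 x1 x2 = Yp x1 x2).
  { intros; apply functional_extensionality; intros e; now apply T2. }
  assert (Hdot : forall V W x1 x2, (forall e, cls r (V e)) -> (forall e, cls r (W e)) -> square a b d x1 x2 ->
    ev (fdot V W) (x2 - b) (x1 - a) t = dot (fun e => ev (V e) (x2 - b) (x1 - a) t)
        (fun e => ev (W e) (x2 - b) (x1 - a) t)).
  { intros V W x1 x2 HV HW H. pose proof (cube_dom r a b d t x1 x2 Had (conj Ht H)).
    unfold fdot, dot, sum3. rewrite !(ev_add r), !(ev_mul r) by
      (auto; repeat apply cls_add; auto; apply cls_mul; auto). reflexivity. }
  assert (Hdet : forall x1 x2, square a b d x1 x2 -> detg (g t) x1 x2 =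
    dot (Xp x1 x2) (Xp x1 x2) * dot (Yp x1 x2) (Yp x1 x2) - dot (Xp x1 x2) (Yp x1 x2) * dot (Xp x1 x2) (Yp x1 x2)).
  { intros x1 x2 H. unfold detg. rewrite metric_sym. unfold g, induced_metric, induced; simpl pick2.
    rewrite !Hdot by auto. reflexivity. }
  assert (Hw : forall x1 x2, square a b d x1 x2 ->
     0 < dot (cross (Xp x1 x2) (Yp x1 x2)) (cross (Xp x1 x2) (Yp x1 x2))).
  { intros x1 x2 H. rewrite lagrange_identity, <- Hdet by auto. apply detg_pos. now split. }
  assert (HRX := fun e => rep_ev r a b d _ (cX e)). assert (HRY := fun e => rep_ev r a b d _ (cY e)).
  assert (RA := rep_ev r a b d A cA). assert (RB := rep_ev r a b d B cB).
  assert (RC := rep_ev r a b d C cC). assert (RD := rep_ev r a b d D cD).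
  assert (RP := rep_ev r a b d P cP). assert (RQ := rep_ev r a b d Q cQ).
  assert (Hsec : forall i j (a0 c0 l0 : fps) x1 x2, square a b d x1 x2 -> cls r a0 -> cls r c0 -> cls r l0 ->
    (forall e, partial i (pick2 (fun z1 z2 => Xp z1 z2 e) (fun z1 z2 => Yp z1 z2 e) j) x1 x2
      = ev (a0 * X e + c0 * Y e + l0 * fcross X Y e)%fps (x2 - b) (x1 - a) t) ->
    second_form (fun e => y e t) i j x1 x2 / sqrt (detg (g t) x1 x2) = ev l0 (x2 - b) (x1 - a) t).
  { intros i j a0 c0 l0 x1 x2 H ca cc cl E.
    unfold second_form, unit_normal. rewrite Tan1, Tan2, Hdet by auto.
    apply normal_component with (a := ev a0 (x2 - b) (x1 - a) t) (c := ev c0 (x2 - b) (x1 - a) t);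
    [now apply Hw|].
    intros e. transitivity (partial i (pick2 (fun z1 z2 => Xp z1 z2 e) (fun z1 z2 => Yp z1 z2 e) j) x1 x2).
    - assert (E' : forall z1 z2, square a b d z1 z2 -> partial j (y e t) z1 z2 =
        pick2 (fun z1 z2 => Xp z1 z2 e) (fun z1 z2 => Yp z1 z2 e) j z1 z2).
      { intros z1 z2 Hz. destruct j; [now apply T1|now apply T2]. }
      destruct H as [H1 H2]. destruct i; unfold partial at 1 3; apply Derive_ext_loc.
      + refine (filter_imp _ _ _ (locally_abs a d x1 H1)). intros z Hz. apply E'. now split.
      + refine (filter_imp _ _ _ (locally_abs b d x2 H2)). intros z Hz. apply E'. now split.
    - rewrite E.
      assert (Ra0 := rep_ev r a b d a0 ca). assert (Rc0 := rep_ev r a b d c0 cc).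
      assert (Rl0 := rep_ev r a b d l0 cl).
      assert (cW : rep r a b d (fun t x1 x2 => cross (fun e => ev (X e) (x2 - b) (x1 - a) t)
         (fun e => ev (Y e) (x2 - b) (x1 - a) t) e) (fcross X Y e)).
      { destruct e; unfold cross, fcross; cbv beta iota; rep_tac Had. }
      symmetry. revert E. clear - Had Ht H cW Ra0 Rc0 Rl0 HRX HRY. intros _.
      pose proof (conj Ht H : cube a b d t x1 x2) as Hc. clear Ht H. unfold Xp, Yp.
      refine (proj2 (_ : rep r a b d (fun t x1 x2 => ev a0 (x2 - b) (x1 - a) t * ev (X e) (x2 - b) (x1 - a) t
         + ev c0 (x2 - b) (x1 - a) t * ev (Y e) (x2 - b) (x1 - a) t
         + ev l0 (x2 - b) (x1 - a) t * cross (fun e => ev (X e) (x2 - b) (x1 - a) t)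
         (fun e => ev (Y e) (x2 - b) (x1 - a) t) e) _) t x1 x2 Hc). rep_tac Had. }
  exists rr, (fun e => y e t). split; [exact Hrr|]. split; [split|].
  - intros e. apply (rep_slice_smooth r a b d (y e) _ t _ Had (Ry e) Ht Hsub).
  - intros x1 x2 H c Hc. apply Hsub in H.
    specialize (Hw x1 x2 H). rewrite lagrange_identity in Hw.
    assert (Hc' : forall e, c i1 * Xp x1 x2 e + c i2 * Yp x1 x2 e = 0).
    { intros e. rewrite <- (Hc e). unfold sum2. now rewrite Tan1, Tan2. }
    set (V := Xp x1 x2) in *. set (W := Yp x1 x2) in *.
    assert (D1 : c i1 * dot V V + c i2 * dot V W = 0).
    { transitivity (V e1 * (c i1 * V e1 + c i2 * W e1) + V e2 * (c i1 * V e2 + c i2 * W e2)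
       + V e3 * (c i1 * V e3 + c i2 * W e3)); [unfold dot, sum3; ring|rewrite !Hc'; ring]. }
    assert (D2 : c i1 * dot V W + c i2 * dot W W = 0).
    { transitivity (W e1 * (c i1 * V e1 + c i2 * W e1) + W e2 * (c i1 * V e2 + c i2 * W e2)
       + W e3 * (c i1 * V e3 + c i2 * W e3)); [unfold dot, sum3; ring|rewrite !Hc'; ring]. }
    intros []; apply Rmult_eq_reg_r with (dot V V * dot W W - dot V W * dot V W); try lra.
    + transitivity (dot W W * (c i1 * dot V V + c i2 * dot V W) - dot V W * (c i1 * dot V W + c i2 * dot W W));
      [ring|rewrite D1, D2; ring].
    + transitivity (dot V V * (c i1 * dot V W + c i2 * dot W W) - dot V W * (c i1 * dot V V + c i2 * dot V W));
      [ring|rewrite D1, D2; ring].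
  - intros x1 x2 H. apply Hsub in H. split.
    + intros i j. unfold g, induced_metric, induced.
      assert (cp : forall i e, cls r (pick2 X Y i e)) by (intros [] e; simpl; auto).
      rewrite Hdot by (assumption || apply cp).
      destruct i, j; simpl pick2; rewrite ?Tan1, ?Tan2 by auto; reflexivity.
    + split; [|split].
      * rewrite (proj2 Rl t x1 x2 (conj Ht H)). apply Hsec with A C; auto. intros e. rewrite <- (frame_X1 _ _ _ _ _ _ _ _ _ _ _ HF).
        exact (proj2 (rep_dx1 r a b d _ _ Had (HRX e)) t x1 x2 (conj Ht H)).
      * rewrite (proj2 Rm t x1 x2 (conj Ht H)). apply Hsec with B D; auto. intros e. rewrite <- (frame_Y1 _ _ _ _ _ _ _ _ _ _ _ HF).
        exact (proj2 (rep_dx1 r a b d _ _ Had (HRY e)) t x1 x2 (conj Ht H)).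
      * rewrite (proj2 Rn t x1 x2 (conj Ht H)). apply Hsec with P Q; auto. intros e. rewrite <- (frame_Y2 _ _ _ _ _ _ _ _ _ _ _ HF).
        exact (proj2 (rep_dx2 r a b d _ _ Had (HRY e)) t x1 x2 (conj Ht H)).
Qed.

End Geometry.

(** * The coupled system *)

Lemma coupled_system gamma r a b d rho u v (g : R -> metric) (Rh U V Pr A B C D P Q : fps) :
  let L := (Rh * (V * V) + Pr)%fps in
  let M := (- (Rh * U * V))%fps in
  let N := (Rh * (U * U) + Pr)%fps in
  admissible r d -> rep r a b d rho Rh -> rep r a b d u U -> rep r a b d v V ->
  rep r a b d (fun t x1 x2 => pressure gamma (rho t) x1 x2) Pr ->
  (forall k i j, rep r a b d (fun t x1 x2 => christoffel (g t) k i j x1 x2) (gam A B C D P Q k i j)) ->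
  rep r a b d (fun t x1 x2 => gauss_curvature (g t) x1 x2) (L * N - M * M)%fps ->
  (L * P = d1 M - d2 N + (B + B) * M - A * N)%fps ->
  (L * Q = d2 M - d1 L + (D + D) * M - C * N)%fps ->
  (d3 Rh + d2 (Rh * U) + d1 (Rh * V) = 0)%fps ->
  (d3 (Rh * U) + d2 (Rh * (U * U) + Pr) + d1 (Rh * U * V) = 0)%fps ->
  (d3 (Rh * V) + d2 (Rh * U * V) + d1 (Rh * (V * V) + Pr) = 0)%fps ->
  forall t x1 x2, cube a b d t x1 x2 ->
    geometric_fluid_system gamma rho u v g t x1 x2 /\ euler_equations gamma rho u v t x1 x2.
Proof.
  intros L M N Had Hrho Hu Hv Hp HGam HK Hcod1 Hcod2 Emass Eu Ev t x1 x2 Hc.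
  assert (E2 : forall f, (fconst 2 * f = f + f)%fps).
  { intros f. apply fps_ext; intros. rewrite fmul_const. unfold fadd; ring. }
  assert (HL : rep r a b d (fun t x1 x2 => Lcoef gamma (rho t) (u t) (v t) x1 x2) L)
    by (unfold Lcoef, L; rep_tac Had).
  assert (HM : rep r a b d (fun t x1 x2 => Mcoef (rho t) (u t) (v t) x1 x2) M)
    by (unfold Mcoef, M; rep_tac Had).
  assert (HN : rep r a b d (fun t x1 x2 => Ncoef gamma (rho t) (u t) (v t) x1 x2) N)
    by (unfold Ncoef, N; rep_tac Had).
  assert (R0 : rep r a b d (fun _ _ _ => 0) 0%fps) by now apply rep_const.
  assert (mass : mass_equation rho u v t x1 x2).
  { unfold mass_equation. revert t x1 x2 Hc.
    eapply rep_eq; [rep_tac Had|exact R0|exact Emass]. }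
  assert (F1 : (d3 (Rh * U) = - (d2 N - d1 M))%fps).
  { transitivity ((d3 (Rh * U) + d2 (Rh * (U * U) + Pr) + d1 (Rh * U * V)) - (d2 N - d1 M))%fps.
    - unfold N, M. rewrite d1_opp. ring.
    - rewrite Eu. ring. }
  assert (F2 : (d3 (Rh * V) = d2 M - d1 L)%fps).
  { transitivity ((d3 (Rh * V) + d2 (Rh * U * V) + d1 (Rh * (V * V) + Pr)) + (d2 M - d1 L))%fps.
    - unfold L, M. rewrite d2_opp. ring.
    - rewrite Ev. ring. }
  assert (G1 : (d2 N - d1 M = (B + B) * M - A * N - L * P)%fps) by (rewrite Hcod1; ring).
  assert (G2 : (d2 M - d1 L = L * Q - (D + D) * M + C * N)%fps) by (rewrite Hcod2; ring).
  clearbody L M N.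
  split.
  - unfold geometric_fluid_system. cbv zeta.
    split; [|split; [|split; [|split; [|split; [|exact mass]]]]]; clear mass; revert t x1 x2 Hc;
    (eapply rep_eq; [rep_tac Had|rep_tac Had|]); unfold gam; try reflexivity;
    rewrite ?E2, ?F1, ?F2, ?G1, ?G2; ring.
  - unfold euler_equations. clear HL HM HN.
    split; [|split; [|exact mass]]; clear mass; revert t x1 x2 Hc.
    + eapply rep_eq; [rep_tac Had|exact R0|exact Eu].
    + eapply rep_eq; [rep_tac Had|exact R0|exact Ev].
Qed.

Lemma tr_0 : tr 0%fps = 0%fps.
Proof. apply fps_ext; intros i j k; unfold tr; destruct i, j, k; reflexivity. Qed.

Theorem theorem8p1 (gamma : R) (Hgamma : 1 <= gamma)
    (U : R -> R -> Prop) (HU : open_plane U)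
    (rho0 u0 v0 kappa0 : field)
    (Hrho0 : forall x1 x2, U x1 x2 -> analytic_at rho0 x1 x2)
    (Hu0 : forall x1 x2, U x1 x2 -> analytic_at u0 x1 x2)
    (Hv0 : forall x1 x2, U x1 x2 -> analytic_at v0 x1 x2)
    (Hpos : forall x1 x2, U x1 x2 -> 0 < rho0 x1 x2)
    (Hkappa0 : forall x1 x2, U x1 x2 ->
       Rpower (rho0 x1 x2) (2 * gamma) / gamma ^ 2
       + (u0 x1 x2 ^ 2 + v0 x1 x2 ^ 2) * (Rpower (rho0 x1 x2) (gamma + 1) / gamma)
       = kappa0 x1 x2)
    (Hnz : forall x1 x2, U x1 x2 -> rho0 x1 x2 * u0 x1 x2 * v0 x1 x2 <> 0)
    (a b : R) (Hab : U a b) :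
  exists (delta : R) (rho u v : stfield) (g : R -> metric),
    let Omega := square a b delta in
    let Q := fun t x1 x2 => Rabs t < delta /\ Omega x1 x2 in
    0 < delta /\
    (forall x1 x2, Omega x1 x2 -> U x1 x2) /\
    smooth_st Q rho /\ smooth_st Q u /\ smooth_st Q v /\
    (forall i j, smooth_st Q (fun t => g t i j)) /\
    (forall t x1 x2, Q t x1 x2 -> 0 < rho t x1 x2) /\
    (forall t x1 x2, Q t x1 x2 -> riemannian (g t) x1 x2) /\
    (forall x1 x2, Omega x1 x2 ->
       rho 0 x1 x2 = rho0 x1 x2 /\ u 0 x1 x2 = u0 x1 x2 /\ v 0 x1 x2 = v0 x1 x2 /\
       gauss_curvature (g 0) x1 x2 = kappa0 x1 x2) /\
    (forall t x1 x2, Q t x1 x2 -> geometric_fluid_system gamma rho u v g t x1 x2) /\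
    (forall t x1 x2, Q t x1 x2 -> euler_equations gamma rho u v t x1 x2) /\
    (forall t, Rabs t < delta ->
       locally_isometrically_immersed Omega (g t)
         (Lcoef gamma (rho t) (u t) (v t))
         (Mcoef (rho t) (u t) (v t))
         (Ncoef gamma (rho t) (u t) (v t))).
Proof.
  destruct (analytic_fps rho0 a b (Hrho0 a b Hab)) as (r1 & s1 & Fr & Hr1 & Hs1 & cFr & EFr).
  destruct (analytic_fps u0 a b (Hu0 a b Hab)) as (r2 & s2 & Fu & Hr2 & Hs2 & cFu & EFu).
  destruct (analytic_fps v0 a b (Hv0 a b Hab)) as (r3 & s3 & Fv & Hr3 & Hs3 & cFv & EFv).
  set (r0 := r1 + r2 + r3).
  apply (cls_mono r1 r0) in cFr; [|unfold r0; lra].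
  apply (cls_mono r2 r0) in cFu; [|unfold r0; lra].
  apply (cls_mono r3 r0) in cFv; [|unfold r0; lra].
  assert (Hr0 : 1 <= r0) by (unfold r0; lra). clearbody r0.
  assert (Fr0 : Fr O O O = rho0 a b).
  { rewrite <- ev_0, EFr by (rewrite Rabs_R0; auto). now rewrite !Rplus_0_r. }
  assert (Hrho00 : 0 < Fr O O O) by (rewrite Fr0; now apply Hpos).
  destruct (euler_formal gamma Fr Fu Fv r0 (/ gamma * Rpower (Fr O O O) gamma))
    as (r' & frho & fsig & fu & fv & fp & Hr' & crho & csig & cu & cv & cp & Hinv & Emass & Eu & Ev
        & Einit & Ep0 & Ep1 & Ep2 & Ep3); auto; [lra|].
  assert (Hrho000 : frho O O O = Fr O O O) by apply Einit.
  set (Rh := tr frho). set (Uf := tr fu). set (Vf := tr fv). set (Pr := tr fp).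
  set (L := (Rh * (Vf * Vf) + Pr)%fps). set (M := (- (Rh * Uf * Vf))%fps).
  set (N := (Rh * (Uf * Uf) + Pr)%fps).
  assert (cR : cls r' Rh) by now apply cls_tr. assert (cU : cls r' Uf) by now apply cls_tr.
  assert (cV : cls r' Vf) by now apply cls_tr. assert (cPr : cls r' Pr) by now apply cls_tr.
  assert (cL : cls r' L) by (unfold L; repeat first [apply cls_add; [lra| |] | apply cls_mul; [lra| |]]; auto).
  assert (cM : cls r' M) by (unfold M; apply cls_opp; repeat (apply cls_mul; [lra| |]); auto).
  assert (cN : cls r' N) by (unfold N; repeat first [apply cls_add; [lra| |] | apply cls_mul; [lra| |]]; auto).
  assert (HL0 : L O O O <> 0).
  { apply Rgt_not_eq. unfold L, fadd. rewrite !fmul_000.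
    change (Rh O O O) with (frho O O O). change (Pr O O O) with (fp O O O).
    rewrite Ep0, Hrho000.
    assert (0 < / gamma * Rpower (Fr O O O) gamma)
      by (apply Rmult_lt_0_compat; [apply Rinv_0_lt_compat; lra|apply exp_pos]).
    pose proof (pow2_ge_0 (Vf O O O)). nra. }
  destruct (frame_formal L M N r' ltac:(lra) cL cM cN HL0)
    as (r & A & B & C & D & P & Q & X & Y & Hr & cA & cB & cC & cD & cP & cQ & cX & cY
        & H1 & H2 & HA & HC & HB & HD & HX1 & HY1 & HX2 & HY2 & X1 & X2 & X3 & Y1 & Y2 & Y3).
  assert (HF : frame_equations L M N A B C D P Q X Y) by (constructor; assumption).
  assert (Hup : forall f, cls r' f -> cls r f) by (intros f; apply cls_mono; lra).
  set (Dt := (fdot X X * fdot Y Y - fdot X Y * fdot X Y)%fps).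
  assert (cXX : cls r (fdot X X)) by (apply cls_dot; auto; lra).
  assert (cDt : cls r Dt) by (unfold Dt; apply cls_sub; [lra| |]; apply cls_mul; try lra; apply cls_dot; auto; lra).
  destruct (ev_pos_near r frho ltac:(lra) (Hup _ crho)) as (n1 & Hn1 & P1); [now rewrite Hrho000|].
  destruct (ev_pos_near r (fdot X X) ltac:(lra) cXX) as (n2 & Hn2 & P2).
  { unfold fdot, fadd. rewrite !fmul_000, X1, X2, X3. lra. }
  destruct (ev_pos_near r Dt ltac:(lra) cDt) as (n3 & Hn3 & P3).
  { unfold Dt, fdot, fsub, fadd, fopp. rewrite !fmul_000.
    rewrite X1, X2, X3, Y1, Y2, Y3. lra. }
  destruct (HU (a, b) Hab) as [e He].
  assert (Hd : exists d, 0 < d /\ d <= s1 /\ d <= s2 /\ d <= s3 /\ 3 * d <= n1 /\ 3 * d <= n2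
     /\ 3 * d <= n3 /\ d <= e /\ r * (3 * d) < 1).
  { assert (Hq : 0 < / (6 * r)) by (apply Rinv_0_lt_compat; lra).
    pose proof (cond_pos e).
    set (l := s1 :: s2 :: s3 :: n1 / 3 :: n2 / 3 :: n3 / 3 :: pos e :: / (6 * r) :: nil).
    assert (Hl : exists d, 0 < d /\ forall x, In x l -> d <= x).
    { assert (Hl : forall x, In x l -> 0 < x).
      { intros x Hx. simpl in Hx. intuition (subst; lra). }
      clearbody l. clear - Hl. induction l as [|x l IH]; [exists 1; split; [lra|intros ? []]|].
      destruct IH as (d & Hd & H); [intros; apply Hl; now right|].
      exists (Rmin x d). split; [apply Rmin_pos; auto; apply Hl; now left|].
      intros y [<-|Hy]; [apply Rmin_l|]. eapply Rle_trans; [apply Rmin_r|auto]. }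
    destruct Hl as (d & Hd & Hl). exists d. split; auto.
    assert (T : forall x, In x l -> d <= x) by auto.
    pose proof (T s1 ltac:(simpl; tauto)). pose proof (T s2 ltac:(simpl; tauto)).
    pose proof (T s3 ltac:(simpl; tauto)). pose proof (T (n1 / 3) ltac:(simpl; tauto)).
    pose proof (T (n2 / 3) ltac:(simpl; tauto)). pose proof (T (n3 / 3) ltac:(simpl; tauto)).
    pose proof (T (pos e) ltac:(simpl; tauto)). pose proof (T (/ (6 * r)) ltac:(simpl; tauto)).
    repeat split; try lra.
    apply Rle_lt_trans with (r * (3 * / (6 * r))); [apply Rmult_le_compat_l; lra|].
    replace (r * (3 * / (6 * r))) with (/ 2) by (field; lra). lra. }
  destruct Hd as (d & Hd & Hd1 & Hd2 & Hd3 & Hd4 & Hd5 & Hd6 & Hd7 & Hd8).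
  assert (Had : admissible r d) by (split; [lra|split; lra]).
  set (rho := fun t x1 x2 : R => ev Rh (x2 - b) (x1 - a) t).
  set (u := fun t x1 x2 : R => ev Uf (x2 - b) (x1 - a) t).
  set (v := fun t x1 x2 : R => ev Vf (x2 - b) (x1 - a) t).
  assert (Rrho : rep r a b d rho Rh) by (apply (rep_ev r a b d); auto).
  assert (Ru : rep r a b d u Uf) by (apply (rep_ev r a b d); auto).
  assert (Rv : rep r a b d v Vf) by (apply (rep_ev r a b d); auto).
  assert (Rp : rep r a b d (fun t x1 x2 => pressure gamma (rho t) x1 x2) Pr).
  { apply rep_ext with (fun t x1 x2 => ev Pr (x2 - b) (x1 - a) t); [|apply rep_ev; auto].
    intros t x1 x2 H. unfold pressure, rho, Pr, Rh. rewrite !ev_tr.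
    rewrite (pressure_law r (3 * d) gamma (/ gamma) frho fsig fp); auto; try lra.
    - intros p1 p2 p3 Hp. apply P1. lra.
    - now rewrite Hrho000.
    - apply cube_l1 in H. unfold l1 in *. lra. }
  assert (HP2 : forall t x1 x2, cube a b d t x1 x2 -> 0 < ev (fdot X X) (x2 - b) (x1 - a) t).
  { intros t x1 x2 H. apply P2. apply cube_l1 in H. lra. }
  assert (HP3 : forall t x1 x2, cube a b d t x1 x2 -> 0 < ev Dt (x2 - b) (x1 - a) t).
  { intros t x1 x2 H. apply P3. apply cube_l1 in H. lra. }
  assert (Hr1' : 1 <= r) by lra.
  apply Hup in cL, cM, cN, cR, cU, cV, cPr.
  pose proof (christoffel_rep r a b d L M N A B C D P Q X Y Had Hr1' cA cB cC cD cP cQ cX cY HF HP3) as RG.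
  pose proof (gauss_rep r a b d L M N A B C D P Q X Y Had Hr1' cL cM cN cA cB cC cD cP cQ cX cY HF HP3) as RK.
  set (g := induced_metric a b X Y) in *.
  assert (Hsys : forall t x1 x2, cube a b d t x1 x2 ->
    geometric_fluid_system gamma rho u v g t x1 x2 /\ euler_equations gamma rho u v t x1 x2).
  { apply (coupled_system gamma r a b d rho u v g Rh Uf Vf Pr A B C D P Q); auto.
    - pose proof (f_equal tr Emass) as E.
      change (d3 Rh + d2 (tr (frho * fu)) + d1 (tr (frho * fv)) = tr 0)%fps in E.
      rewrite !tr_mul, tr_0 in E. exact E.
    - pose proof (f_equal tr Eu) as E.
      change (d3 (tr (frho * fu)) + d2 (tr (frho * (fu * fu)) + Pr) + d1 (tr (frho * fu * fv)) = tr 0)%fps in E.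
      rewrite !tr_mul, tr_0 in E. exact E.
    - pose proof (f_equal tr Ev) as E.
      change (d3 (tr (frho * fv)) + d2 (tr (frho * fu * fv)) + d1 (tr (frho * (fv * fv)) + Pr) = tr 0)%fps in E.
      rewrite !tr_mul, tr_0 in E. exact E. }
  assert (HUd : forall x1 x2, square a b d x1 x2 -> U x1 x2).
  { intros x1 x2 [Hx1 Hx2]. apply (He (x1, x2)). split.
    - change (Rabs (x1 - a) < e). lra.
    - change (Rabs (x2 - b) < e). lra. }
  exists d, rho, u, v, g. cbv zeta.
  split; [exact Hd|]. split; [exact HUd|].
  split; [exact (rep_smooth r a b d rho Rh Had Rrho)|].
  split; [exact (rep_smooth r a b d u Uf Had Ru)|].
  split; [exact (rep_smooth r a b d v Vf Had Rv)|].
  split. { intros i j. apply (rep_smooth r a b d _ (induced X Y i j) Had). now apply metric_rep. }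
  split. { intros t x1 x2 H. unfold rho, Rh. rewrite ev_tr. apply P1.
    apply cube_l1 in H. unfold l1 in *. lra. }
  split. { intros t x1 x2 H. now apply (metric_riemannian r a b d X Y). }
  split.
  { intros x1 x2 H. pose proof H as [Hx1 Hx2].
    assert (Hin : forall f F F0, (forall j k, F O j k = F0 O j k) ->
      (forall h k, Rabs h < d -> Rabs k < d -> ev F0 0 h k = f (a + h) (b + k)) ->
      ev (tr F) (x2 - b) (x1 - a) 0 = f x1 x2).
    { intros f F F0 E E'. rewrite ev_tr, (ev_plane F F0), E' by auto.
      f_equal; ring. }
    assert (I1 : rho 0 x1 x2 = rho0 x1 x2).
    { apply (Hin rho0 frho Fr); [intros; apply Einit|intros; apply EFr; lra]. }
    assert (I2 : u 0 x1 x2 = u0 x1 x2).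
    { apply (Hin u0 fu Fu); [intros; apply Einit|intros; apply EFu; lra]. }
    assert (I3 : v 0 x1 x2 = v0 x1 x2).
    { apply (Hin v0 fv Fv); [intros; apply Einit|intros; apply EFv; lra]. }
    repeat split; auto.
    assert (Hc : cube a b d 0 x1 x2) by (split; [rewrite Rabs_R0|]; auto).
    destruct (Hsys 0 x1 x2 Hc) as [(_ & _ & <- & _) _].
    rewrite <- Hkappa0 by auto. unfold Lcoef, Mcoef, Ncoef, pressure.
    rewrite I1, I2, I3.
    rewrite Rpower_plus, Rpower_1 by now apply Hpos, HUd.
    replace (2 * gamma) with (gamma + gamma) by ring. rewrite Rpower_plus. field. lra. }
  split. { intros t x1 x2 H. now apply Hsys. }
  split. { intros t x1 x2 H. now apply Hsys. }
  intros t Ht.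
  apply (geometry_immersed r a b d L M N A B C D P Q X Y Had Hr1' cL cM cN cA cB cC cD cP cQ cX cY HF HP3
    (fun t => Lcoef gamma (rho t) (u t) (v t)) (fun t => Mcoef (rho t) (u t) (v t))
    (fun t => Ncoef gamma (rho t) (u t) (v t))); auto.
  - unfold Lcoef, L. clearbody rho u v. rep_tac Had.
  - unfold Mcoef, M. clearbody rho u v. rep_tac Had.
  - unfold Ncoef, N. clearbody rho u v. rep_tac Had.
Qed.
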